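(* Let $\Omega$ be a bounded domain in $\mathbb{R}^n$. Suppose that $\mathcal{A}(x,z)$ is a nonnegative semidefinite matrix in $\Omega\times\mathbb{R}$ satisfying the structural condition $$k\,\xi^{T}A(x)\xi\le\xi^{T}\mathcal{A}(x,z)\xi\le K\,\xi^{T}A(x)\xi\qquad\text{for a.e. }x\in\Omega\text{ and all }z\in\mathbb{R},\ \xi\in\mathbb{R}^n,$$ for some positive constants $k,K$. Let $u$ be a nonnegative weak subsolution of $\nabla^{\mathrm{tr}}\mathcal{A}(x,u(x))\nabla u=\phi$ in $\Omega$. Then $$\operatorname*{ess\,sup}_{x\in\Omega}u(x)\le\sup_{x\in\partial\Omega}u(x)+C\|\phi\|_{X(\Omega)},$$ where the constant $C$ depends only on $\Omega$, provided that: (1) the function $\phi$ is $A$-admissible for $\Omega$; (2) the $\Phi$-Sobolev Orlicz bump inequality for $\Omega$ holds with $\Phi=\Phi_m$ for some $m>2$.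
   Context: $A(x)=B(x)^{\mathrm{tr}}B(x)$ where $B(x)$ is a Lipschitz continuous $n\times n$ real matrix on $\Omega$, and $\nabla_A=B(x)\nabla$. $W_A^{1,2}(\Omega)$ has norm $\left(\int_\Omega|v|^2+|\nabla_Av|^2\right)^{1/2}$, and $(W_A^{1,2})_0(\Omega)$ is the closure in it of the Lipschitz functions with compact support in $\Omega$; $(W_A^{1,1})_0(\Omega)$ is defined analogously using $\int|v|+|\nabla_Av|$. It is assumed $\phi\in L^2_{\mathrm{loc}}(\Omega)$. $u\in W_A^{1,2}(\Omega)$ is a weak subsolution if $-\int_\Omega\nabla w^{\mathrm{tr}}\mathcal{A}(x,u(x))\nabla u\ge\int_\Omega\phi w$ for all nonnegative $w\in(W_A^{1,2})_0(\Omega)$. $\sup_{x\in\partial\Omega}u(x)\equiv\inf\{\ell\in\mathbb{R}:(u-\ell)^+\in(W_A^{1,2})_0(\Omega)\}$, where $(u-\ell)^+=\max\{u-\ell,0\}$. $\phi$ is $A$-admissible for $\Omega$ if $\|\phi\|_{X(\Omega)}\equiv\sup_{v\in(W_A^{1,1})_0(\Omega)}\dfrac{\int_\Omega|v\phi|\,dy}{\int_\Omega|\nabla_Av|\,dy}<\infty$. The $\Phi$-Sobolev Orlicz bump inequality for $\Omega$: there is $C$ with $\Phi^{(-1)}\left(\int_\Omega\Phi(|w|)\,dx\right)\le C\|\nabla_Aw\|_{L^1(\Omega)}$ for all Lipschitz $w$ with compact support in $\Omega$, where $\Phi^{(-1)}$ is the inverse function. For $m>1$ and $E=e^{2^m}$: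 $\Phi_m(t)=e^{\left((\ln t)^{1/m}+1\right)^m}$ for $t\ge E$ and $\Phi_m(t)=\frac{\Phi_m(E)}{E}t$ for $0\le t\le E$.
   Formalization: The constant C may depend on the matrix A and the lower ellipticity constant k as well as on Ω (not on K, 𝒜, φ, u): independence of k is false, since replacing 𝒜, φ by t𝒜, tφ keeps u and multiplies the norm of φ by t. *)

(* Defs.v *)
From HB Require Import structures.
From mathcomp Require Import all_boot all_order all_algebra.
From mathcomp Require Import all_classical all_reals all_analysis ess_sup_inf.

Set Implicit Arguments.
Unset Strict Implicit.
Unset Printing Implicit Defensive.

Import Order.TTheory GRing.Theory Num.Theory.
Import numFieldNormedType.Exports.

Local Open Scope classical_set_scope.
Local Open Scope ring_scope.

(** * Lebesgue measure on R^n

    R^n is ['rV[R]_n.+1], so every dimension is at least 1.  Lebesgue outer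
    measure is the infimum of the total volume over countable covers by boxes;
    the measurable sets are the Caratheodory measurable ones, so that the
    measure is complete. *)

Section lebesgue_measure_Rn.
Variables (R : realType) (n : nat).
Notation Rn := 'rV[R]_n.+1.

Definition box (ab : Rn * Rn) : set Rn :=
  [set x | forall i, x 0 i \in `]ab.1 0 i, ab.2 0 i]].

(* The maximum makes a box with ab.2 0 i < ab.1 0 i, which is empty, have
   volume 0. *)
Definition box_vol (ab : Rn * Rn) : R :=
  \prod_(i < n.+1) Num.max 0 (ab.2 0 i - ab.1 0 i).

Definition box_cover (X : set Rn) : set (nat -> Rn * Rn) :=
  [set F | X `<=` \bigcup_k box (F k)].

Definition lebesgue_outer (X : set Rn) : \bar R :=
  ereal_inf [set (\sum_(k <oo) (box_vol (F k))%:E)%E | F in box_cover X].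

Lemma box_vol_ge0 ab : 0 <= box_vol ab.
Proof. by apply: prodr_ge0 => i _; rewrite le_max lexx. Qed.

Lemma box_volE_ge0 ab : (0 <= (box_vol ab)%:E)%E.
Proof. by rewrite lee_fin box_vol_ge0. Qed.

Lemma box_vol0 : box_vol (0, 0) = 0.
Proof. by rewrite /box_vol big_ord_recl /= mxE subrr maxxx mul0r. Qed.

Lemma lebesgue_outer_ge0 X : (0 <= lebesgue_outer X)%E.
Proof.
by apply: le_ereal_inf_tmp => x [F _ <-]; apply: nneseries_ge0 => k _ _; exact: box_volE_ge0.
Qed.

Lemma lebesgue_outer0 : lebesgue_outer set0 = 0%E.
Proof.
apply/eqP; rewrite eq_le lebesgue_outer_ge0 andbT.
apply: ereal_inf_lbound; exists (fun=> (0, 0)); first by move=> ?.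
by apply: eseries0 => k _ _; rewrite box_vol0.
Qed.

Lemma le_lebesgue_outer :
  {homo lebesgue_outer : X Y / X `<=` Y >-> (X <= Y)%E}.
Proof.
move=> X Y XY; apply/ereal_inf_le_tmp => x [F YF <-].
by exists F => //; apply: subset_trans XY YF.
Qed.

Lemma lebesgue_outer_sigma_subadditive : sigma_subadditive lebesgue_outer.
Proof.
move=> A; have [[i ioo]|] := pselect (exists i, lebesgue_outer (A i) = +oo%E).
  rewrite (eseries_pinfty _ _ ioo) ?leey// => k _.
  by rewrite -ltNye (lt_le_trans _ (lebesgue_outer_ge0 _)).
rewrite -forallNE => Aoo.
suff add2e (e : {posnum R}) : (lebesgue_outer (\bigcup_n A n) <=
    \sum_(i <oo) lebesgue_outer (A i) + e%:num%:E)%E.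
  by apply/lee_addgt0Pr => _/posnumP[].
apply: le_trans (epsilon_trick _ _ _) => //; last first.
  by move=> k; exact: lebesgue_outer_ge0.
pose P k (F : nat -> Rn * Rn) := box_cover (A k) F /\
  (\sum_(j <oo) (box_vol (F j))%:E <=
     lebesgue_outer (A k) + (e%:num / (2 ^ k.+1)%:R)%:E)%E.
have [G PG] : {G : nat -> nat -> Rn * Rn & forall k, P k (G k)}.
  apply: (@choice _ _ P) => k; rewrite /P /lebesgue_outer.
  set S := (X in ereal_inf X); move infS : (ereal_inf S) => iS.
  case: iS infS => [r Sr|Soo|Soo].
  - have en1 : (0 < e%:num / (2 ^ k.+1)%:R)%R by [].
    have /(lb_ereal_inf_adherent en1) : ereal_inf S \is a fin_num by rewrite Sr.
    move=> [x [F AF Fx] xS].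
    by exists F; split => //; rewrite Fx -Sr; exact/ltW.
  - by have := Aoo k; rewrite /lebesgue_outer Soo.
  - suff : lbound S 0%E by move/le_ereal_inf_tmp; rewrite Soo.
    by move=> /= _ [F AF <-]; apply: nneseries_ge0 => j _ _; exact: box_volE_ge0.
pose v (kj : nat * nat) : \bar R := (box_vol (uncurry G kj))%:E.
have v_ge0 x : (0 <= v x)%E by exact: box_volE_ge0.
apply: (@le_trans _ _ (\esum_(i in setT) v i)%E).
  apply: ereal_inf_lbound => /=.
  have /card_esym/ppcard_eqP[f] := card_nat2.
  exists (uncurry G \o f).
    move=> t [i _ Ait]; have [j _ Bijt] := (PG i).1 t Ait.
    by exists (f^-1%FUN (i, j)) => //=; rewrite invK ?inE.
  rewrite -(esum_pred_image v _ xpredT) ?[fun=> _]set_true//.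
  by rewrite image_eq.
rewrite (_ : esum _ _ = \sum_(i <oo) \sum_(j <oo) (box_vol (G i j))%:E)%E;
    last first.
  pose J : nat -> set (nat * nat) := fun i => [set (i, j) | j in setT].
  rewrite (_ : setT = \bigcup_k J k); last first.
    by rewrite predeqE => -[a b]; split => // _; exists a => //; exists b.
  rewrite esum_bigcupT /=; last 2 first.
    - apply/trivIsetP => i j _ _ ij.
      rewrite predeqE => -[k m] /=; split => //= -[] [_] _ [<-{k} _].
      by move=> [m' _] [] /esym/eqP; rewrite (negbTE ij).
    - by move=> k; exact: v_ge0.
  rewrite -(image_id [set: nat]) -fun_true esum_pred_image//; last first.
    by move=> k _; exact: esum_ge0.
  apply: eq_eseriesr => /= j _.
  rewrite -(esum_pred_image v (pair j) predT)//=; last first.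
    by move=> ? ? _ _; exact: (@can_inj _ _ _ snd).
  by congr esum; rewrite predeqE => -[a b]; split; move=> [i _ <-]; exists i.
apply: lee_lim.
- apply: is_cvg_nneseries => k *.
  by apply: nneseries_ge0 => m *; exact: (v_ge0 (k, m)).
- apply: is_cvg_nneseries => k *; apply: adde_ge0 => //.
  exact: lebesgue_outer_ge0.
- by near=> k; apply: lee_sum => i _; exact: (PG i).2.
Unshelve. all: by end_near. Qed.

HB.instance Definition _ := isOuterMeasure.Build R Rn lebesgue_outer
  lebesgue_outer0 lebesgue_outer_ge0 le_lebesgue_outer
  lebesgue_outer_sigma_subadditive.

Definition leb_outer : {outer_measure set Rn -> \bar R} := lebesgue_outer.

Definition leb : {measure set (caratheodory_type leb_outer) -> \bar R} :=
  leb_outer.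

End lebesgue_measure_Rn.
Arguments leb {R n}.

(* R^n as a measurableType, with the Lebesgue sigma-algebra. *)
Notation leb_space R n := (caratheodory_type (@leb_outer R n)).

Section degenerate_sobolev.
Variables (R : realType) (n : nat).
Notation Rn := 'rV[R]_n.+1.
(* Gradients and the vectors paired with the matrices are columns. *)
Notation vec := 'cV[R]_n.+1.
Notation mat := 'M[R]_n.+1.

Definition bounded_domain (Omega : set Rn) :=
  [/\ open Omega, connected Omega, Omega !=set0 & bounded_set Omega].

(* The library norm on matrices is the maximum norm. *)
Definition enorm (v : vec) : R := Num.sqrt (\sum_i v i 0 ^+ 2).

Definition qform (M : mat) (p q : vec) : R := (p^T *m M *m q) 0 0.

Definition nonneg_semidefinite (M : mat) :=
  M^T = M /\ forall xi, 0 <= qform M xi xi.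

Definition ae_in (Omega : set Rn) (P : Rn -> Prop) :=
  {ae leb, forall x : leb_space R n, Omega x -> P x}.

Definition measurable_in (Omega : set Rn) (f : Rn -> R) :=
  measurable_fun (Omega : set (leb_space R n)) (f : leb_space R n -> R).

Definition Lp_loc (p : nat) (Omega : set Rn) (f : Rn -> R) :=
  measurable_in Omega f /\
  forall D : set Rn, compact D -> D `<=` Omega ->
    (\int[leb]_(x in D) (`|f x| ^+ p)%:E < +oo)%E.

Definition compact_support_in (Omega : set Rn) (f : Rn -> R) :=
  compact (closure [set x | f x != 0]) /\ closure [set x | f x != 0] `<=` Omega.

Definition lipschitz_c (Omega : set Rn) (f : Rn -> R) :=
  lipschitz f /\ compact_support_in Omega f.

Definition partial (j : 'I_n.+1) (f : Rn -> R) : Rn -> R :=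
  'D_('e_j) f.

(* Compactly supported functions of class C^1. *)
Definition C1_c (Omega : set Rn) (f : Rn -> R) :=
  [/\ forall j x, derivable f x 'e_j,
      forall j, continuous (partial j f) &
      compact_support_in Omega f].

(* [is_gradA Omega B v g]: in the sense of distributions on Omega, g is the
   A-gradient B nabla v.  The coefficients of B are merely Lipschitz, so the
   partial derivatives on the right-hand side exist almost everywhere. *)
Definition is_gradA (Omega : set Rn) (B : Rn -> mat)
    (v : Rn -> R) (g : Rn -> vec) :=
  [/\ Lp_loc 1 Omega v,
      forall i, Lp_loc 1 Omega (fun x => g x i 0) &
      forall psi, C1_c Omega psi -> forall i,
        (\int[leb]_(x in Omega) (g x i 0 * psi x)%:E =
         - (\int[leb]_(x in Omega)
              (v x * \sum_j partial j (fun y => B y i j * psi y) x)%:E))%E].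

(* The p-th power of the norm of W_A^{1,p}, g being the A-gradient of v. *)
Definition WA_energy (p : nat) (Omega : set Rn)
    (v : Rn -> R) (g : Rn -> vec) : \bar R :=
  (\int[leb]_(x in Omega) (`|v x| ^+ p + enorm (g x) ^+ p)%:E)%E.

Definition WA_norm (p : nat) (Omega : set Rn)
    (v : Rn -> R) (g : Rn -> vec) : \bar R :=
  poweR (WA_energy p Omega v g) p%:R^-1.

(* v belongs to W_A^{1,p}(Omega) and nabla_A v = g. *)
Definition in_WA (p : nat) (Omega : set Rn) (B : Rn -> mat)
    (v : Rn -> R) (g : Rn -> vec) :=
  is_gradA Omega B v g /\ (WA_energy p Omega v g < +oo)%E.

(* v belongs to (W_A^{1,p})_0(Omega) and nabla_A v = g. *)
Definition in_WA0 (p : nat) (Omega : set Rn) (B : Rn -> mat)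
    (v : Rn -> R) (g : Rn -> vec) :=
  in_WA p Omega B v g /\
  exists (f : nat -> Rn -> R) (h : nat -> Rn -> vec),
    (forall k, lipschitz_c Omega (f k) /\ in_WA p Omega B (f k) (h k)) /\
    WA_norm p Omega (fun x => f k x - v x) (fun x => h k x - g x)
      @[k --> \oo] --> (0 : \bar R)%E.

(* (nabla w)^tr M (nabla u) in terms of p = nabla_A w and q = nabla_A u, for a
   symmetric M with 0 <= M <= K B^tr B.  Elements of W_A^{1,2} have no gradient
   in general, only an A-gradient, which lies in the range of B almost
   everywhere.  Since M vanishes on the kernel of B, the value is
   xi^tr M eta for all xi, eta with B xi = p and B eta = q. *)
Definition formA (B M : mat) (p q : vec) : R :=
  qform M (pinvmx B *m p) (pinvmx B *m q).

Definition structural (Omega : set Rn) (B : Rn -> mat) (k K : R)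
    (cA : Rn -> R -> mat) :=
  ae_in Omega (fun x => forall (z : R) (xi : vec),
    k * qform ((B x)^T *m B x) xi xi <= qform (cA x z) xi xi /\
    qform (cA x z) xi xi <= K * qform ((B x)^T *m B x) xi xi).

(* The right-hand side is absolutely convergent as soon as phi is admissible. *)
Definition weak_subsolution (Omega : set Rn) (B : Rn -> mat)
    (cA : Rn -> R -> mat) (phi u : Rn -> R) :=
  exists2 gu, in_WA 2 Omega B u gu &
  forall w gw, in_WA0 2 Omega B w gw -> ae_in Omega (fun x => 0 <= w x) ->
    (- (\int[leb]_(x in Omega) (formA (B x) (cA x (u x)) (gw x) (gu x))%:E) >=
     \int[leb]_(x in Omega) (phi x * w x)%:E)%E.

Definition bdry_sup (Omega : set Rn) (B : Rn -> mat) (u : Rn -> R) : \bar R :=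
  ereal_inf [set l%:E | l in [set l : R |
    exists g, in_WA0 2 Omega B (fun x => Num.max (u x - l) 0) g]].

Definition ess_sup_in (Omega : set Rn) (u : Rn -> R) : \bar R :=
  ess_sup leb (patch (fun=> -oo%E) Omega (EFin \o u) : leb_space R n -> \bar R).

(* Division in \bar R: the quotient is 0 when both integrals vanish, and +oo
   when only the denominator does. *)
Definition X_norm (Omega : set Rn) (B : Rn -> mat) (phi : Rn -> R) : \bar R :=
  ereal_sup [set r | exists v g, in_WA0 1 Omega B v g /\
    r = ((\int[leb]_(x in Omega) `|v x * phi x|%:E) /
         (\int[leb]_(x in Omega) (enorm (g x))%:E))%E].

Definition admissible (Omega : set Rn) (B : Rn -> mat) (phi : Rn -> R) :=
  (X_norm Omega B phi < +oo)%E.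

(* Inverse of Phi : [0, +oo[ -> [0, +oo[. *)
Definition Phi_inv (Phi : R -> R) : R -> R :=
  'pinv_(fun=> 0) [set t | 0 <= t] Phi.

(* The integral of Phi(|w|) is finite when Phi is continuous and vanishes at 0,
   and w is continuous with compact support. *)
Definition Orlicz_bump (Omega : set Rn) (B : Rn -> mat) (Phi : R -> R) :=
  exists C : R, forall w g, lipschitz_c Omega w -> is_gradA Omega B w g ->
    ((Phi_inv Phi (fine (\int[leb]_(x in Omega) (Phi `|w x|)%:E)))%:E <=
     C%:E * (\int[leb]_(x in Omega) (enorm (g x))%:E))%E.

Definition E_ (m : R) : R := expR (2 `^ m).

Definition Phi_top (m t : R) : R := expR ((ln t `^ m^-1 + 1) `^ m).

Definition Phi_ (m t : R) : R :=
  if E_ m <= t then Phi_top m t else Phi_top m (E_ m) / E_ m * t.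

End degenerate_sobolev.

(* Main.v *)
(* Fix a level l with w = (u - l)^+ in W_0^{1,2}, of A-gradient g.  A locality
   argument shows that g is the A-gradient of u on {w > 0}.  Testing the
   equation with smooth truncations of w above height s, and using
   admissibility and Young's inequality, gives
     int_{w > s} |grad_A T(w)| <= (r / k) |{w > s}|   for r >= ||phi||_X.
   Inserting a suitable multiple of T(w) in the bump inequality and applying
   Chebyshev's inequality yields
     Phi(h / (A M)) |{w > s + h}| <= Phi(1)   whenever |{w > s}| <= M,
   with A proportional to r.  As Phi_m(e^{t^2}) >= e^{(t+1)^2} for m > 2, a De
   Giorgi iteration with summable steps shows that w <= C r almost everywhere.

   Everything rests on calculus with distributional A-gradients: Lipschitz
   functions are differentiable in coordinate directions almost everywhere,
   and mollification allows Lipschitz test functions. *)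
From HB Require Import structures.
Require Import Defs.
From mathcomp Require Import all_boot all_order all_algebra.
From mathcomp Require Import all_classical all_reals all_analysis ess_sup_inf.
From mathcomp Require Import measurable_realfun ring lra.
Import Order.TTheory GRing.Theory Num.Theory.
Import numFieldNormedType.Exports.
Set Implicit Arguments.
Unset Strict Implicit.
Unset Printing Implicit Defensive.
Local Open Scope classical_set_scope.
Local Open Scope ring_scope.

(** * Lebesgue measure *)

(** The bump inequality is not homogeneous, so it is applied only to functions rescaled until its
    right-hand side is below 1; the inverse function then enters only through [Phi_inv y >= 1] for
    [y > Phi_ m 1]. The rescaling also makes the iteration scale-free: its constant [S] depends only
    on [m] and on the measure of [Omega], which is why [C] is uniform in [phi], [u] and [cA].

    Two obstacles shape the rest. The positive part of [w - s] has a kink, and classical partial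
    derivatives obey no chain rule where a Lipschitz approximant meets it; [strunc] replaces it,
    with a derivative that starts from 0 at the level [s], stays in [0, 1] and is Lipschitz, so that
    one Taylor estimate ([quad_der]) gives the chain rule at every point of derivability. And [B] is
    only Lipschitz: products with [B] or with approximants leave C^1, hence the passage to Lipschitz
    test functions. No pointwise convergence of derivatives is at hand there; bounded sequences
    tested against L^1 ([weak_null]) take its place, and do so again for truncated gradients. *)

Lemma lip_continuous {R : realType} (V : normedModType R) (f : V -> R) (L : R) :
  (forall x y, `|f x - f y| <= L * `|x - y|) -> continuous f.
Proof.
move=> fL x; apply/cvgrPdist_le => e e0.
have L1 : 0 < `|L| + 1 by rewrite ltr_wpDl.
have e1 : 0 < e / (`|L| + 1) by rewrite divr_gt0.
near=> y.
have xy : `|x - y| <= e / (`|L| + 1).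
  by near: y; apply: cvgr_dist_le; [exact: cvg_id|].
apply: le_trans (fL x y) _; apply: (@le_trans _ _ ((`|L| + 1) * `|x - y|)).
  by rewrite ler_wpM2r// (le_trans (ler_norm _))// lerDl.
by rewrite mulrC -ler_pdivlMr.
Unshelve. all: by end_near. Qed.

Section continuous_real.
Context {R : realType} {T : topologicalType}.
Implicit Types F G : T -> R.

Lemma ctsD F G : continuous F -> continuous G -> continuous (fun x => F x + G x).
Proof. by move=> cF cG x; exact: (continuousD (cF x) (cG x)). Qed.

Lemma ctsB F G : continuous F -> continuous G -> continuous (fun x => F x - G x).
Proof. by move=> cF cG x; exact: (continuousB (cF x) (cG x)). Qed.

Lemma ctsM F G : continuous F -> continuous G -> continuous (fun x => F x * G x).
Proof. by move=> cF cG x; exact: (continuousM (cF x) (cG x)). Qed.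

Lemma cts_comp (t : R -> R) F : continuous t -> continuous F -> continuous (fun x => t (F x)).
Proof. by move=> ct cF x; exact: (@continuous_comp _ _ _ F t x (cF x) (ct _)). Qed.

Lemma cts_cst (c : R) : continuous (fun _ : T => c).
Proof. exact: cst_continuous. Qed.

End continuous_real.

Section lebesgue_space.
Context {R : realType} {n : nat}.
Notation Rn := 'rV[R]_n.+1.
Implicit Types (X : set Rn) (x : Rn).

(** Cutting along [x_i = c] replaces one edge length by two with the same sum. If [c] misses the
    edge, one piece has a reversed edge and the maximum in [box_vol] gives it volume 0. *)
Lemma box_vol_split (a b : Rn) (i : 'I_n.+1) (c : R) :
  box_vol (a, b) =
    box_vol (a, \row_j if j == i then Num.min (b 0 j) c else b 0 j) +
    box_vol (\row_j if j == i then Num.max (a 0 j) c else a 0 j, b).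
Proof.
rewrite /box_vol /= (bigD1 i)//= [in X in _ = X + _](bigD1 i)//=.
rewrite [in X in _ = _ + X](bigD1 i)//= !mxE eqxx.
under [in X in _ = X + _]eq_bigr => j ji do rewrite mxE (negbTE ji).
under [in X in _ = _ + X]eq_bigr => j ji do rewrite mxE (negbTE ji).
rewrite -mulrDl; congr (_ * _).
set p := a 0 i; set q := b 0 i.
case: (leP q c) => ?; case: (leP p c) => ?; case: (leP 0 (q - p)) => ?;
  case: (leP 0 (c - p)) => ?; case: (leP 0 (q - c)) => ?; lra.
Qed.

(** The Caratheodory criterion can be checked cover by cover: a cover of a set splits along the
    hyperplane into covers of the two parts, with the same total volume. *)
Lemma halfspace_measurable (i : 'I_n.+1) (c : R) :
  measurable ([set x | x 0 i <= c] : set (leb_space R n)).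
Proof.
apply: le_caratheodory_measurable => X.
apply: le_ereal_inf_tmp => _ [F XF <-].
pose F1 k := ((F k).1, \row_j if j == i then Num.min ((F k).2 0 j) c else (F k).2 0 j).
pose F2 k := (\row_j if j == i then Num.max ((F k).1 0 j) c else (F k).1 0 j, (F k).2).
have -> : (\sum_(k <oo) (box_vol (F k))%:E =
    \sum_(k <oo) (box_vol (F1 k))%:E + \sum_(k <oo) (box_vol (F2 k))%:E)%E.
  rewrite -nneseriesD; try by move=> *; exact: box_volE_ge0.
  apply: eq_eseriesr => k _; rewrite -EFinD; congr EFin.
  by rewrite (surjective_pairing (F k)) (box_vol_split _ _ i c).
apply: leeD; apply: ereal_inf_lbound; [exists F1|exists F2] => //=.
- move=> x [/XF[k _ Fk] xc]; exists k => // j; have := Fk j.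
  rewrite /= mxE; case: eqP => [->|//].
  by rewrite !in_itv/= le_min xc andbT.
- move=> x [/XF[k _ Fk] /negP xc]; exists k => // j; have := Fk j.
  rewrite /= mxE; case: eqP => [->|//].
  by rewrite !in_itv/= gt_max => /andP[-> ->]; rewrite ltNge xc.
Qed.

Lemma coord_measurable (i : 'I_n.+1) :
  measurable_fun setT (fun x : leb_space R n => x 0 i : R).
Proof.
apply: (measurability _ (RGenOInfty.measurableE R)) => //.
move=> _ [_ [c ->] <-]; rewrite setTI.
rewrite (_ : _ @^-1` _ = ~` [set x : Rn | x 0 i <= c]).
  by apply: measurableC; exact: halfspace_measurable.
apply/seteqP; split => x /=; rewrite in_itv/= andbT ltNge; first by move/negP.
by move=> H; apply/negP.
Qed.

Definition obox (a b : Rn) : set Rn := [set x | forall i, a 0 i < x 0 i < b 0 i].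
Definition cbox (a b : Rn) : set Rn := [set x | forall i, a 0 i <= x 0 i <= b 0 i].

Lemma open_box_measurable (a b : Rn) :
  measurable (obox a b : set (leb_space R n)).
Proof.
rewrite (_ : obox a b = \bigcap_(i in [set: 'I_n.+1])
    (fun x : leb_space R n => x 0 i) @^-1` `]a 0 i, b 0 i[).
  apply: fin_bigcap_measurable => // i _.
  by rewrite -[X in measurable X]setTI; apply: coord_measurable.
apply/seteqP; split=> x /= H i; first by move=> _; rewrite /= in_itv/= H.
by have := H i I; rewrite /= in_itv.
Qed.

Lemma box_measurable (ab : Rn * Rn) : measurable (box ab : set (leb_space R n)).
Proof.
rewrite (_ : box ab = \bigcap_(i in [set: 'I_n.+1])
    (fun x : leb_space R n => x 0 i) @^-1` `]ab.1 0 i, ab.2 0 i]).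
  apply: fin_bigcap_measurable => // i _.
  by rewrite -[X in measurable X]setTI; apply: coord_measurable.
by apply/seteqP; split=> x /= H i //; [move=> _; exact: H|exact: (H i I)].
Qed.

(** Boxes with rational corners are countable. Keeping those whose closed box lies in [U] makes
    finite unions of them compact subsets of [U], as needed for the supports of test functions. *)
Lemma open_rational_boxes (U : set Rn) : open U -> exists a b : nat -> Rn,
  U = \bigcup_k obox (a k) (b k) /\
  forall k, cbox (a k) (b k) `<=` U.
Proof.
move=> oU.
pose T := ('rV[rat]_n.+1 * 'rV[rat]_n.+1)%type.
pose good (q : T) := cbox (map_mx ratr q.1) (map_mx ratr q.2) `<=` U.
(* Codes of no pair, or of a box that leaves [U], are sent to the corners 1 and 0, whose box is
   empty. *)
pose dec k : Rn * Rn := if @unpickle T k is Some q then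
  if `[< good q >] then (map_mx ratr q.1, map_mx ratr q.2) else (const_mx 1, 0) else (const_mx 1, 0).
have bad (x : Rn) : ~ (forall i, (const_mx 1 : Rn) 0 i <= x 0 i <= (0 : Rn) 0 i).
  move=> /(_ 0); rewrite !mxE => /andP[]; lra.
have dec_sub k : cbox (dec k).1 (dec k).2 `<=` U.
  rewrite /dec; case: unpickle => [q|]; last by move=> x /= /bad.
  case: asboolP => [gq|_]; last by move=> x /= /bad.
  by move=> x /= H; apply: gq => i; have := H i; rewrite !mxE.
exists (fun k => (dec k).1), (fun k => (dec k).2); split; last exact: dec_sub.
apply/seteqP; split => [x Ux|x [k _] H]; last first.
  by apply: (dec_sub k) => i; have /andP[/ltW-> /ltW->] := H i.
have /nbhs_ballP[e /= e0 xeU] := oU _ Ux.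
have e0' i : {q : rat * rat | x 0 i - e < ratr q.1 < x 0 i /\ x 0 i < ratr q.2 < x 0 i + e}.
  apply: cid; have [|q1] := @rat_in_itvoo R (x 0 i - e) (x 0 i); first by lra.
  have [|q2] := @rat_in_itvoo R (x 0 i) (x 0 i + e); first by lra.
  by rewrite !in_itv/= => h2 h1; exists (q1, q2).
pose q : T := (\row_i (sval (e0' i)).1, \row_i (sval (e0' i)).2).
have gq : good q.
  move=> y /= H; apply: xeU; split => // j i; rewrite ord1 /ball/=.
  have := H i; rewrite !mxE.
  by case: (e0' i) => /= qi [/andP[h1 h2] /andP[h3 h4]] /andP[h5 h6]; rewrite ltr_norml; apply/andP; split; lra.
exists (pickle q) => // i; rewrite /dec pickleK (asboolT gq) !mxE.
by case: (e0' i) => /= qi [/andP[h1 h2] /andP[h3 h4]]; apply/andP.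
Qed.

Lemma open_leb_measurable (U : set Rn) : open U -> measurable (U : set (leb_space R n)).
Proof.
move=> /open_rational_boxes[a [b [-> _]]].
by apply: bigcupT_measurable => k; exact: open_box_measurable.
Qed.

Lemma closed_leb_measurable (U : set Rn) : closed U -> measurable (U : set (leb_space R n)).
Proof.
move=> cU; rewrite -[U]setCK; apply: measurableC.
by apply: open_leb_measurable; exact: closed_openC.
Qed.

Lemma continuous_leb_measurable (f : Rn -> R) : continuous f ->
  measurable_fun setT (f : leb_space R n -> R).
Proof.
move=> /continuousP cf; apply: (measurability _ (RGenOpens.measurableE R)) => //.
move=> _ [_ [a [b ->]] <-]; rewrite setTI.
by apply: open_leb_measurable; apply: cf; exact: interval_open.
Qed.

Lemma coord_le_norm (x : Rn) i : `|x 0 i| <= `|x|.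
Proof.
rewrite [leRHS]/Num.norm /= mx_normrE.
have /mapP[j Hj ->] : `|x 0 i| \in [seq `|x y.1 y.2| | y : 'I_1 * 'I_n.+1].
  by apply/mapP; exists (ord0, i) => //=; rewrite mem_enum.
by apply/bigmax_geP; right => /=; exists j.
Qed.

Lemma norm_le_coord (x : Rn) (e : R) : 0 <= e -> (forall i, `|x 0 i| <= e) -> `|x| <= e.
Proof.
move=> e0 H; rewrite [leLHS]/Num.norm /= mx_normrE; apply/bigmax_leP; split => //=.
by move=> -[i j] _ /=; rewrite ord1.
Qed.

Lemma bounded_set_box X : bounded_set X ->
  exists M, X `<=` box (const_mx (- M), const_mx M).
Proof.
move=> [M [_ H]]; exists (M + 2) => x Xx i; rewrite !mxE.
have xM : `|x 0 i| <= M + 1.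
  by apply: le_trans (coord_le_norm _ _) _; apply: H => //; rewrite ltrDl.
move: xM; rewrite ler_norml in_itv/= => /andP[? ?]; apply/andP; split; lra.
Qed.

Lemma leb_box_le (ab : Rn * Rn) : (leb (box ab) <= (box_vol ab)%:E)%E.
Proof.
apply: ereal_inf_lbound; exists (fun k => if k == 0%N then ab else (0, 0)).
  by move=> x; exists 0%N.
rewrite (nneseries_split 0 1)//; last by move=> k _; exact: box_volE_ge0.
rewrite add0n big_nat1 eqxx eseries0 ?adde0// => k k0 _.
by case: eqP k0 => [->//|_ _]; rewrite box_vol0.
Qed.

(** The volume depends continuously on the enlargement. This is the room needed to replace the
    half-open boxes of a cover by open ones. *)
Lemma box_vol_blow (ab : Rn * Rn) (e : R) : 0 < e -> exists d, 0 < d /\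
  ((box_vol (ab.1, ab.2 + const_mx d))%:E <= (box_vol ab + e)%:E)%E.
Proof.
move=> e0; pose m i := Num.max 0 (ab.2 0 i - ab.1 0 i).
have H : (fun d : R => \prod_(i < n.+1) (m i + d)) @ (0 : R) --> \prod_(i < n.+1) m i.
  apply: (@cvg_big R 'I_n.+1 *%R 1 xpredT _ R (nbhs (0 : R)) _ (fun i d => m i + d) m).
  exact: mul_continuous.
  move=> i _; rewrite -[X in _ --> X]addr0; apply: cvgD; [exact: cvg_cst|exact: cvg_id].
move/cvgrPdist_lt : H => /(_ _ e0)/nbhs_ballP[d /= d0 dP].
exists (d / 2); split; first by rewrite divr_gt0.
have := dP (d / 2); rewrite /ball/= sub0r normrN ger0_norm; last by rewrite divr_ge0// ltW.
rewrite ltr_pdivrMr// ltr_pMr// ltr1n => /(_ isT).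
rewrite ltr_norml => /andP[/= + _]; rewrite ltrBrDl ltrBlDr => H.
rewrite lee_fin addrC; apply: le_trans (ltW H).
apply: ler_prod => i _; rewrite le_max lexx/= /m !mxE.
have := divr_gt0 d0 (@ltr0Sn R 1).
by case: (leP 0 (ab.2 0 i - ab.1 0 i)) => ?; rewrite ge_max => ?; apply/andP; split; lra.
Qed.

Lemma obox_open (a b : Rn) : open (obox a b).
Proof.
rewrite openE => x Hx.
apply: (@filter_forall Rn 'I_n.+1 (fun i => [set y : Rn | a 0 i < y 0 i < b 0 i]) (nbhs x)) => i.
have : open ((fun y : Rn => y 0 i) @^-1` `]a 0 i, b 0 i[).
  by apply: open_comp => [y _|]; [exact: coord_continuous|exact: interval_open].
rewrite openE => /(_ x); rewrite /= /interior in_itv/= Hx => /(_ isT).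
by apply: filterS => y /=; rewrite in_itv.
Qed.

Lemma leb_box_fin (ab : Rn * Rn) : (leb (box ab) < +oo)%E.
Proof. by apply: le_lt_trans (leb_box_le _) _; exact: ltry. Qed.

Lemma leb_bounded_fin X : bounded_set X -> (leb X < +oo)%E.
Proof.
move=> /bounded_set_box[M XM]; apply: le_lt_trans (leb_box_fin (const_mx (- M), const_mx M)).
exact: le_lebesgue_outer.
Qed.

Lemma leb_sigma_finite : sigma_finite setT (@leb R n).
Proof.
exists (fun k => box (const_mx (- k%:R), const_mx k%:R)).
  apply/seteqP; split => // x _.
  pose k := (Num.truncn `|x : Rn|).+1; exists k => // i; rewrite !mxE in_itv/=.
  have := coord_le_norm (x : Rn) i; have := truncnS_gt `|x : Rn|; rewrite -/k => h1 h2.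
  have := le_lt_trans h2 h1; rewrite ltr_norml => /andP[h3 h4].
  by rewrite h3 ltW.
move=> k; split; [exact: box_measurable|exact: leb_box_fin].
Qed.

Lemma lebesgue_outer_shift (a : Rn) X :
  lebesgue_outer [set (x + a)%R | x in X] = lebesgue_outer X.
Proof.
suff H (b : Rn) (Y : set Rn) : (lebesgue_outer [set (x + b)%R | x in Y] <= lebesgue_outer Y)%E.
  apply/eqP; rewrite eq_le H/=.
  have {1}-> : X = [set (x - a)%R | x in [set (x + a)%R | x in X]].
    apply/seteqP; split=> [x Xx|_ [_ [x Xx <-] <-]]; last by rewrite addrK.
    by exists (x + a); [exists x|rewrite addrK].
  exact: H.
apply: le_ereal_inf_tmp => _ [F YF <-].
apply: ereal_inf_lbound; exists (fun k => ((F k).1 + b, (F k).2 + b)).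
  move=> _ [x /YF[k _ Fk] <-]; exists k => // i; have := Fk i.
  by rewrite !in_itv/= !mxE ltrD2r lerD2r.
apply: eq_eseriesr => k _; congr EFin; apply: eq_bigr => i _ /=.
by rewrite !mxE opprD addrACA subrr addr0.
Qed.

Lemma shift_measurable (a : Rn) (X : set (leb_space R n)) : measurable X ->
  measurable ((fun x : leb_space R n => (x : Rn) + a : leb_space R n) @^-1` X).
Proof.
move=> mX; apply: le_caratheodory_measurable => Y.
have pre Z : (fun x : leb_space R n => (x : Rn) + a) @^-1` Z = [set (x : Rn) - a | x in Z].
  apply/seteqP; split => [x /= Zx|_ [x Zx <-]]; last by rewrite /= subrK.
  by exists (x + a) => //; rewrite addrK.
have E (Z : set Rn) : leb_outer R n Z = leb_outer R n [set (x + a)%R | x in Z].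
  exact/esym/lebesgue_outer_shift.
rewrite [leRHS]E [X in (X + _ <= _)%E]E [X in (_ + X <= _)%E]E [leRHS](mX _).
apply: leeD; apply: le_lebesgue_outer.
  by move=> _ [x [Yx Xx] <-]; split => //; exists x.
by move=> _ [x [Yx Xx] <-]; split => //; exists x.
Qed.

Definition shift_leb (a : Rn) (x : leb_space R n) : leb_space R n := (x : Rn) + a.

Lemma measurable_shift_leb a : measurable_fun setT (shift_leb a).
Proof. by move=> _ Y mY; rewrite setTI; exact: shift_measurable. Qed.

Lemma leb_shift (a : Rn) (X : set Rn) : leb (shift_leb a @^-1` X) = leb X.
Proof.
rewrite -[RHS](lebesgue_outer_shift (- a)); congr (lebesgue_outer _).
apply/seteqP; split => [x Xx|_ [x Xx <-]]; last by rewrite /shift_leb/= subrK.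
by exists (x + a) => //; rewrite addrK.
Qed.

Lemma ge0_integral_shift (a : Rn) (f : leb_space R n -> \bar R) :
  measurable_fun setT f -> (forall x, (0 <= f x)%E) ->
  (\int[leb]_x f (shift_leb a x) = \int[leb]_x f x)%E.
Proof.
move=> mf f0.
have := ge0_integral_pushforward (measurable_shift_leb a) leb measurableT mf (fun x _ => f0 x).
rewrite preimage_setT => <-; apply: eq_measure_integral; first exact: measurable_shift_leb.
by move=> mphi A mA _; exact: leb_shift.
Qed.

Lemma integral_shift (a : Rn) (f : leb_space R n -> \bar R) :
  measurable_fun setT f -> (\int[leb]_x f (shift_leb a x) = \int[leb]_x f x)%E.
Proof.
move=> mf; have -> : (fun x => f (shift_leb a x)) = f \o shift_leb a by [].
rewrite integralE funepos_comp funeneg_comp [RHS]integralE; congr (_ - _)%E.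
  exact: (ge0_integral_shift a (measurable_funepos mf)).
exact: (ge0_integral_shift a (measurable_funeneg mf)).
Qed.

(** Half of [e] pays for a nearly optimal cover of [E] by boxes; the other half, split as a
    geometric series, pays for enlarging them to open boxes. Their union is then cut down to
    [Omega]. *)
Lemma leb_outer_regular (E Omega : set (leb_space R n)) (e : R) : measurable E ->
  open (Omega : set Rn) -> E `<=` Omega -> (leb E < +oo)%E -> 0 < e ->
  exists U : set (leb_space R n),
    [/\ open (U : set Rn), E `<=` U, U `<=` Omega & (leb (U `\` E) < e%:E)%E].
Proof.
move=> mE oO EO Efin e0.
have e2 : 0 < e / 2 by rewrite divr_gt0.
have : leb E \is a fin_num by rewrite ge0_fin_numE.
move=> /(lb_ereal_inf_adherent e2)[_ [F EF <-]] FE.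
pose blow (d : R) (ab : Rn * Rn) := obox ab.1 (ab.2 + const_mx d).
have [d dP] : {d : nat -> R & forall k,
    (leb (blow (d k) (F k)) <= (box_vol (F k))%:E + (e / 2 / (2 ^ k.+1)%:R)%:E)%E /\ 0 < d k}.
  apply: (@choice _ _ (fun k d => (leb (blow d (F k)) <= (box_vol (F k))%:E +
    (e / 2 / (2 ^ k.+1)%:R)%:E)%E /\ 0 < d)) => k.
  have ek : 0 < e / 2 / (2 ^ k.+1)%:R by rewrite divr_gt0.
  have [d [d0 dk]] := box_vol_blow (F k) ek; exists d; split => //.
  rewrite -EFinD; apply: le_trans (dk); apply: le_trans (leb_box_le _).
  apply: le_lebesgue_outer => x /= H i; rewrite in_itv/=.
  by have /andP[-> /ltW ->] := H i.
pose U := Omega `&` \bigcup_k blow (d k) (F k).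
have oU : open (U : set Rn) by apply: openI => //; apply: bigcup_open => k _; exact: obox_open.
have EU : E `<=` U.
  move=> x Ex; split; first exact: EO.
  have [k _ Fk] := EF _ Ex; exists k => // i; have := Fk i.
  rewrite in_itv/= !mxE => /andP[-> /le_lt_trans->//]; rewrite ltrDl.
  by have [] := dP k.
have mU : measurable U by exact: open_leb_measurable.
have Ub : (leb U < leb E + e%:E)%E.
  apply: (@le_lt_trans _ _ (\sum_(k <oo) leb (blow (d k) (F k)))%E).
    apply: measure_sigma_subadditive => //; first by move=> k; exact: open_box_measurable.
    by move=> x [].
  apply: (@le_lt_trans _ _ (\sum_(k <oo) ((box_vol (F k))%:E + (e / 2 / (2 ^ k.+1)%:R)%:E))%E).
    by apply: lee_nneseries => // k _; have [] := dP k.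
  apply: le_lt_trans; first by apply: epsilon_trick => //; [move=> k; exact: box_volE_ge0|exact: ltW].
  rewrite [in X in (_ < X)%E](splitr e) EFinD addeA lteD2rE//. 
exists U; split => //; first by move=> x [].
rewrite measureD//; last by apply: lt_trans Ub _; rewrite -ge0_fin_numE// in Efin; rewrite -(fineK Efin) -EFinD ltry.
rewrite (setIidr EU) lteBlDr// ?[(e%:E + _)%E]addeC//.
by rewrite ge0_fin_numE.
Qed.

End lebesgue_space.

(** * Lipschitz functions *)

Section lipschitz_real.
Context {R : realType}.
Notation lam := (@lebesgue_measure R).
Implicit Types (f : R -> R) (L : R).

(** A cover of a null set by half-open intervals of total length below [e / (L + 1)] has Stieltjes
    mass at most [e]. The [+ 1] avoids a division by 0. *)
Lemma stieltjes_lipschitz_null (G : cumulative R R) L :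
  (forall x y, x <= y -> G y - G x <= L * (y - x)) ->
  lebesgue_stieltjes_measure G `<< lam.
Proof.
move=> GL; apply/null_content_dominatesP => A mA A0.
have L0 : 0 <= L.
  by have := GL 0 1 ler01; have := cumulative_is_nondecreasing G 0 1 ler01; lra.
apply/eqP; rewrite eq_le measure_ge0 andbT; apply/lee_addgt0Pr => e e0; rewrite add0e.
have L1 : 0 < L + 1 by lra.
have e1 : 0 < e / (L + 1) by rewrite divr_gt0.
have : lam A \is a fin_num by rewrite A0.
move=> /(lb_ereal_inf_adherent e1)[_ [F [mF AF] <-]].
rewrite -[ereal_inf _]/(lam A) A0 add0e => Fe.
apply: (@le_trans _ _ (\sum_(k <oo) wlength G (F k))%E).
  by apply: ereal_inf_lbound; exists F.
apply: (@le_trans _ _ (\sum_(k <oo) ((L + 1)%:E * wlength idfun (F k)))%E).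
  apply: lee_nneseries => [k _ _|k _]; first exact: wlength_ge0.
  have [[a b] _ <-] := mF k.
  have [ab|ba] := leP a b; last first.
    have -> : `](a, b).1, (a, b).2]%classic = set0 by apply: set_itv_ge; rewrite bnd_simp -leNgt ltW.
    by rewrite !wlength0 mule0.
  rewrite !wlength_itv_bnd// -EFinM lee_fin; apply: le_trans (GL _ _ ab) _.
  by rewrite ler_wpM2r ?subr_ge0// lerDl.
rewrite nneseriesZl; last by move=> k _; exact: wlength_ge0.
have -> : e%:E = ((L + 1)%:E * (e / (L + 1))%:E)%E.
  by rewrite -EFinM mulrC divfK// gt_eqF.
by apply: lee_wpmul2l; [rewrite lee_fin ltW|exact: ltW].
Qed.

(** On []a, b]] the Stieltjes measure of [f] is finite and absolutely continuous, so it has a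
    Radon-Nikodym density. Hence [f - f a] is the indefinite integral of an integrable function, and
    Lebesgue differentiation applies. *)
Lemma monotone_lipschitz_derivable_itv f L a b : {homo f : x y / x <= y} ->
  (forall x y, x <= y -> f y - f x <= L * (y - x)) ->
  {ae lam, forall x, a < x < b -> derivable f x 1}.
Proof.
move=> fnd fL.
have fc : right_continuous f.
  apply: right_continuousW; apply: (@lip_continuous _ R^o f L) => x y.
  have [xy|/ltW xy] := leP x y.
    by rewrite distrC (distrC x) !ger0_norm ?subr_ge0 ?fnd// fL.
  by rewrite !ger0_norm ?subr_ge0 ?fnd// fL.
pose G : cumulative R R := HB.pack f (isCumulative.Build R _ R f fnd fc).
pose nu := lebesgue_stieltjes_measure G.
have nu_itv x y : x <= y -> nu `]x, y]%classic = (f y - f x)%:E.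
  move=> xy; rewrite /nu /lebesgue_stieltjes_measure /measure_extension.
  by rewrite measurable_mu_extE/= ?wlength_itv_bnd//; exact: is_ocitv.
have [ab|ba] := ltP a b; last first.
  by apply: aeW => x /andP[ax xb]; have := lt_trans ax xb; rewrite ltNge ba.
have mab : measurable (`]a, b]%classic : set (measurableTypeR R)) by exact: measurable_itv.
have nufin : (nu `]a, b]%classic < +oo)%E by rewrite nu_itv ?ltry// ltW.
pose m : {finite_measure set _ -> \bar R} := mfrestr mab nufin.
have mlam : m `<< lam.
  apply/null_content_dominatesP => A mA A0.
  have /null_content_dominatesP H := stieltjes_lipschitz_null (G := G) fL.
  apply/eqP; rewrite eq_le measure_ge0 andbT -(H _ mA A0).
  by apply: le_measure; rewrite ?inE//; exact: measurableI.
pose g := fine \o Radon_Nikodym_SigmaFinite.f m lam.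
have gE : EFin \o g = Radon_Nikodym_SigmaFinite.f m lam.
  by apply/funext => x; rewrite /g/= fineK// Radon_Nikodym_SigmaFinite.f_fin_num.
have gint : lam.-integrable setT (EFin \o g).
  by rewrite gE; exact: Radon_Nikodym_SigmaFinite.f_integrable.
have gy y : lam.-integrable [set` Interval (BRight a) (BRight y)] (EFin \o g).
  exact: (integrableS measurableT).
have := FTC1 gy (open_integrable_locally openT gint).
apply: filterS; first exact: (ae_filter_ringOfSetsType lam).
move=> x + /andP[ax xb] => /(_ ax)[dF _].
pose F y := (\int[lam]_(t in [set` Interval (BRight a) (BRight y)]) g t)%R.
have fE : {near x, (fun y => F y + f a) =1 f}.
  near=> y.
  have /andP[ay yb] : a < y < b by near: y; apply: (@near_in_itvoo _ a b); rewrite in_itv/= ax.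
  rewrite /F /Rintegral; under eq_integral do rewrite -[(g _)%:E]/((EFin \o g) _) gE.
  rewrite -(Radon_Nikodym_SigmaFinite.f_integral mlam)//.
  rewrite /m/= /mfrestr /mrestr setIidl; last first.
    by move=> z /=; rewrite !in_itv/= => /andP[-> /le_trans->//]; exact: ltW.
  by have := nu_itv a y (ltW ay); rewrite /nu /= => ->; rewrite /= subrK.
by apply: near_eq_derivable fE _; apply: derivableD.
Unshelve. all: by end_near. Qed.

Lemma lipschitz_derivable_ae f L :
  (forall x y, `|f x - f y| <= L * `|x - y|) ->
  {ae lam, forall x, derivable f x 1}.
Proof.
(* Adding [L * x] makes [f] nondecreasing and keeps it Lipschitz, with constant [2 * L]. *)
move=> fL; pose G x := f x + L * x.
have Gle x y : x <= y -> f x - f y <= L * (y - x) /\ f y - f x <= L * (y - x).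
  move=> xy; have := fL x y; rewrite (distrC x) [X in _ <= L * X]ger0_norm ?subr_ge0//.
  by rewrite ler_norml => /andP[? ?]; split; lra.
have Gnd : {homo G : x y / x <= y}.
  by move=> x y /Gle[]; rewrite /G; lra.
have GL x y : x <= y -> G y - G x <= (2 * L) * (y - x).
  by move=> /Gle[]; rewrite /G; lra.
have : {ae lam, forall x k, - k%:R < x < k%:R -> derivable G x 1}.
  by apply/ae_foralln => k; exact: monotone_lipschitz_derivable_itv Gnd GL.
apply: filterS; first exact: (ae_filter_ringOfSetsType lam).
move=> x /(_ (Num.truncn `|x|).+1) H.
have -> : f = (fun y => G y - L * y) by apply/funext => y; rewrite /G addrK.
apply: derivableB; last exact: derivableM.
by apply: H; rewrite -ltr_norml truncnS_gt.
Qed.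

End lipschitz_real.

Section sigma_finite_copy.
Context d (T : measurableType d) (R : realType) (m : {measure set T -> \bar R}).
Hypothesis sfm : sigma_finite setT m.

(** An alias of [m] that carries the proof of sigma-finiteness as an argument, so that the
    sigma-finite structure can be attached to it and Tonelli's theorem applied. *)
Definition sigma_finite_copy of sigma_finite setT m : set T -> \bar R := m.
HB.instance Definition _ := Measure.copy (sigma_finite_copy sfm) m.
HB.instance Definition _ := @Measure_isSigmaFinite.Build _ T R (sigma_finite_copy sfm) sfm.

End sigma_finite_copy.

Lemma fubini_tonelli_sigma_finite d1 d2 (T1 : measurableType d1) (T2 : measurableType d2)
    (R : realType) (m1 : {measure set T1 -> \bar R}) (m2 : {sigma_finite_measure set T2 -> \bar R})
    (f : T1 * T2 -> \bar R) :
  sigma_finite setT m1 -> measurable_fun setT f -> (forall x, 0 <= f x)%E ->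
  (\int[m1]_x \int[m2]_y f (x, y) = \int[m2]_y \int[m1]_x f (x, y))%E.
Proof.
by move=> sf mf f0; exact: (@fubini_tonelli _ _ _ _ _ (sigma_finite_copy sf) m2 f mf f0).
Qed.

(** * Partial derivatives of Lipschitz functions almost everywhere *)

Section partial_ae.
Context {R : realType} {n : nat}.
Notation Rn := 'rV[R]_n.+1.
Implicit Types (F : Rn -> R) (L : R) (j : 'I_n.+1).

Lemma dist_half (a b l e : R) : `|l - a| < e / 2 -> `|l - b| < e / 2 -> `|a - b| <= e.
Proof.
rewrite !ltr_norml => /andP[? ?] /andP[? ?]; rewrite ler_norml; apply/andP; split; lra.
Qed.

Lemma norm_near (s p M : R) : `|s - p| < `|s| -> `|s - p| < M - `|s| -> 0 < `|p| < M.
Proof.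
have := ler_dist_dist s p; rewrite ler_norml => /andP[? ?] ? ?.
by apply/andP; split; lra.
Qed.

Lemma dist_quarter (a b p q e k : R) : `|a - p| < e / 4 -> `|b - q| < e / 4 ->
  `|p - q| <= k -> k < e / 2 -> `|a - b| < e.
Proof.
rewrite !ltr_norml ler_norml => /andP[? ?] /andP[? ?] /andP[? ?] ?.
by apply/andP; split; lra.
Qed.

Definition dquot (j : 'I_n.+1) F (h : R) (y : Rn) : R := h^-1 * (F (h *: 'e_j + y) - F y).

(* By continuity of F, the Cauchy criterion for the difference quotients need only be tested on rational
   increments, which makes the set of derivability Borel. *)
Definition cauchy_quot j F : set Rn :=
  \bigcap_k \bigcup_m \bigcap_(pq : rat * rat)
    [set y | 0 < `|ratr pq.1 : R| < m.+1%:R^-1 -> 0 < `|ratr pq.2 : R| < m.+1%:R^-1 ->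
       `|dquot j F (ratr pq.1) y - dquot j F (ratr pq.2) y| <= k.+1%:R^-1].

Lemma derivable_cauchy_quot j F y : derivable F y 'e_j -> cauchy_quot j F y.
Proof.
move=> /cvg_ex[l /= Fl] k _.
have k0 : 0 < k.+1%:R^-1 / 2 :> R by rewrite divr_gt0.
move/cvgrPdist_lt : Fl => /(_ _ k0); rewrite /dnbhs /= near_withinE.
move=> /nbhs_ballP[d /= d0 dP].
pose m := Num.truncn d^-1.
have md : m.+1%:R^-1 < d.
  by rewrite -[ltRHS]invrK ltf_pV2 ?posrE ?invr_gt0// /m truncnS_gt.
exists m => // -[p q] _ /= /andP[p0 pm] /andP[q0 qm].
have H r : 0 < `|ratr r : R| -> `|ratr r : R| < m.+1%:R^-1 -> `|l - dquot j F (ratr r) y| < k.+1%:R^-1 / 2.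
  move=> r0 rm; apply: dP; last by rewrite -normr_gt0.
  by rewrite /ball/= sub0r normrN (lt_trans rm).
exact: (dist_half (H _ p0 pm) (H _ q0 qm)).
Qed.

Lemma dquot_cvg j F y h : continuous F -> h != 0 ->
  dquot j F t y @[t --> h] --> dquot j F h y.
Proof.
move=> cF h0; apply: cvgM; first exact: cvgV.
apply: cvgB; last exact: cvg_cst.
apply: (@cvg_comp _ _ _ (fun t : R => t *: 'e_j + y) F _ (nbhs (h *: 'e_j + y))); last exact: cF.
apply: cvgD; last exact: cvg_cst.
by apply: cvgZr_tmp; exact: cvg_id.
Qed.

(** Away from 0 the difference quotient is continuous in its increment, so each real increment can
    be traded for a rational one in the same range at a cost of [e / 4]; two trades and the rational
    criterion at [e / 2] add up to [e]. *)
Lemma cauchy_quot_derivable j F y : continuous F -> cauchy_quot j F y -> derivable F y 'e_j.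
Proof.
move=> cF Fy; apply/cauchy_cvgP/cauchy_ballP => e e0.
pose k := Num.truncn (e / 2)^-1.
have ke : k.+1%:R^-1 < e / 2.
  by rewrite -[ltRHS]invrK ltf_pV2 ?posrE ?invr_gt0 ?divr_gt0// /k truncnS_gt.
have [m _ mP] := Fy k I.
have e4 : 0 < e / 4 by rewrite divr_gt0.
have m0 : 0 < m.+1%:R^-1 :> R by rewrite invr_gt0.
have H (s : R) : 0 < `|s| < m.+1%:R^-1 -> exists p : rat,
    0 < `|ratr p : R| < m.+1%:R^-1 /\ `|dquot j F s y - dquot j F (ratr p) y| < e / 4.
  move=> /andP[s0 sm].
  have snz : s != 0 by rewrite -normr_gt0.
  have /cvgrPdist_lt/(_ _ e4)/nbhs_ballP[d /= d0 dP] := dquot_cvg (j := j) (y := y) cF snz.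
  pose d' := Num.min d (Num.min `|s| (m.+1%:R^-1 - `|s|)).
  have d'0 : 0 < d' by rewrite !lt_min d0 s0 subr_gt0.
  have [|p] := @rat_in_itvoo R (s - d') (s + d'); first by lra.
  rewrite in_itv/= => /andP[sp ps]; exists p.
  have spd : `|s - ratr p| < d' by rewrite ltr_norml; apply/andP; split; lra.
  move: (spd); rewrite !lt_min => /andP[pd /andP[ps' pm]]; split; last first.
    exact: dP.
  exact: norm_near ps' pm.
exists (dquot j F ^~ y @` [set s | 0 < `|s| < m.+1%:R^-1],
        dquot j F ^~ y @` [set s | 0 < `|s| < m.+1%:R^-1]).
  have H0 : \forall s \near (0 : R)^',
      [set dquot j F s y | s in [set s | 0 < `|s| < m.+1%:R^-1]] (dquot j F s y).
    near=> s; exists s => //=; apply/andP; split.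
      by rewrite normr_gt0; near: s; exact: nbhs_dnbhs_neq.
    by near: s; exact: dnbhs0_lt.
  by split; exact: H0.
move=> [_ _] /= [[s sm <-] [t tm <-]].
have [p [pm sp]] := H _ sm; have [q [qm tq]] := H _ tm.
have := mP (p, q) I pm qm; rewrite /= => pq.
exact: dist_quarter sp tq pq ke.
Unshelve. all: by end_near. Qed.

Lemma dquot_continuous j F h : continuous F -> continuous (dquot j F h).
Proof.
move=> cF y; rewrite /dquot; apply: (@continuousM R Rn (fun=> h^-1) (fun y => F (h *: 'e_j + y) - F y) y); first exact: cst_continuous.
apply: continuousB; last exact: cF.
apply: (@continuous_comp _ _ _ (fun z => h *: 'e_j + z) F); last exact: cF.
by apply: (@continuousD R Rn Rn (cst (h *: 'e_j)) id y); [exact: cst_continuous|exact: cvg_id].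
Qed.

(** The map [g] is left general because three of them occur: the identity of R^n, a single line, and
    the family of all lines in direction [j], seen on the product with R. *)
Lemma measurable_cauchy_quot d (T : measurableType d) (g : T -> Rn) j F : continuous F ->
  (forall U : set Rn, open U -> measurable (g @^-1` U)) ->
  measurable (g @^-1` cauchy_quot j F).
Proof.
move=> cF mg; rewrite preimage_bigcap; apply: bigcapT_measurable => k.
rewrite preimage_bigcup; apply: bigcupT_measurable => m.
rewrite preimage_bigcap; rewrite -[X in measurable X]setCK setC_bigcap; apply: measurableC.
apply: countable_bigcupT_measurable => //.
move=> [p q]; apply: measurableC => /=.
have [pm|pm] := boolP (0 < `|ratr p : R| < m.+1%:R^-1); last first.
  by rewrite (_ : _ @^-1` _ = setT)//; apply/seteqP; split => // t _.
have [qm|qm] := boolP (0 < `|ratr q : R| < m.+1%:R^-1); last first.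
  by rewrite (_ : _ @^-1` _ = setT)//; apply/seteqP; split => // t _.
rewrite (_ : _ @^-1` _ = ~` (g @^-1` ((fun y => `|dquot j F (ratr p) y - dquot j F (ratr q) y|) @^-1` `]k.+1%:R^-1, +oo[%classic))).
  apply: measurableC; apply: mg; apply: open_comp => [y _|]; last exact: interval_open.
  apply: (@continuous_comp _ _ _ (fun y => dquot j F (ratr p) y - dquot j F (ratr q) y) Num.norm); last exact: norm_continuous.
  by apply: continuousB; exact: dquot_continuous.
apply/seteqP; split => t /=.
  by move=> /(_ isT isT) H; rewrite in_itv/= andbT; apply/negP; rewrite -leNgt.
by move=> H _ _; rewrite leNgt; apply/negP => H'; apply: H; rewrite in_itv/= H'.
Qed.

Lemma measurable_line_shift (j : 'I_n.+1) (U : set Rn) : open U ->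
  measurable ((fun xt : leb_space R n * measurableTypeR R => (xt.2 : R) *: 'e_j + (xt.1 : Rn)) @^-1` U).
Proof.
move=> /open_rational_boxes[a [b [-> _]]]; rewrite preimage_bigcup.
apply: bigcupT_measurable => k.
set g := (X in X @^-1` _).
rewrite (_ : _ @^-1` _ = \bigcap_(i in [set: 'I_n.+1])
    ((fun xt => g xt 0 i) @^-1` `]a k 0 i, b k 0 i[%classic)); last first.
  apply/seteqP; split => x /= H i; first by move=> _; rewrite /= in_itv/= H.
  by have := H i I; rewrite /= in_itv.
apply: fin_bigcap_measurable => // i _; rewrite -[X in measurable X]setTI.
suff mi : measurable_fun setT (fun xt => g xt 0 i) by exact: mi.
rewrite (_ : (fun _ => _) = fun xt : leb_space R n * measurableTypeR R =>
    (xt.2 : R) * ('e_j : Rn) 0 i + (xt.1 : Rn) 0 i); last first.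
  by apply/funext => xt; rewrite /g !mxE.
apply: measurable_funD.
  by apply: measurable_funM => //; exact: measurable_snd.
exact: (measurableT_comp (coord_measurable i) measurable_fst).
Qed.

(** Tonelli for the set of pairs [(x, t)] with [t e_j + x] in [N]. Integrating first in [t] gives 0;
    integrating first in [x] gives [leb N] for every [t], by translation invariance, hence
    [leb N * +oo]. No identification of R^n with a product is involved. *)
Lemma leb_null_lines (j : 'I_n.+1) (N : set Rn) :
  measurable ((fun xt : leb_space R n * measurableTypeR R => (xt.2 : R) *: 'e_j + (xt.1 : Rn)) @^-1` N) ->
  measurable (N : set (leb_space R n)) ->
  (forall x, lebesgue_measure [set t : R | N (t *: 'e_j + x)] = 0%E) ->
  leb N = 0%E.
Proof.
move=> mS mN N0.
set S := _ @^-1` N in mS.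
have mf : measurable_fun setT (EFin \o \1_S : _ -> \bar R).
  by apply/measurable_EFinP; exact: measurable_indic.
have f0 x : (0 <= (EFin \o \1_S : _ -> \bar R) x)%E by rewrite lee_fin.
have := @fubini_tonelli_sigma_finite _ _ (leb_space R n) (measurableTypeR R) R leb lebesgue_measure
  (EFin \o \1_S) leb_sigma_finite mf f0.
rewrite integral0_eq => [|x _]; last first.
  rewrite -[RHS](N0 x).
  rewrite (_ : [set t | _] = xsection S x); last first.
    by apply/seteqP; split => t; rewrite /xsection /= inE.
  rewrite -[in RHS](setIT (xsection S x)) -integral_indic//; last exact: measurable_xsection.
  apply: eq_integral => t _ /=; congr EFin; rewrite !indicE; by congr (_ %:R); rewrite mem_xsection.
under eq_integral => t _.
  rewrite (_ : (fun x => _) = fun x => (EFin \o \1_N : leb_space R n -> \bar R) (shift_leb (t *: 'e_j) x)); last first.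
    apply/funext => x; rewrite /= /S /shift_leb; congr EFin.
    by rewrite !indicE; congr (nat_of_bool _)%:R; apply/idP/idP; rewrite !inE /= addrC.
  rewrite integral_shift; last by apply/measurable_EFinP; exact: measurable_indic.
  rewrite integral_indic// setIT.
  over.
have lT : lebesgue_measure [set: measurableTypeR R] = +oo%E.
  by rewrite -set_itvNyy lebesgue_measure_itv.
have c0 : (0 <= leb N)%E by exact: measure_ge0.
move: (leb N) c0 => c c0.
have -> : (\int[lebesgue_measure]_(_ in [set: measurableTypeR R]) c = c * +oo)%E.
  by rewrite -lT; exact: (integral_cst _ measurableT).
move=> /esym; have [->//|lN] := eqVneq c 0%E.
by rewrite gt0_muley// lt0e lN.
Qed.

(** On every line in direction [j] the function is Lipschitz in one variable, so the set where the
    Cauchy criterion fails meets each such line in a null set. *)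
Lemma lip_partial_ae F L j : (forall x y, `|F x - F y| <= L * `|x - y|) ->
  {ae leb, forall x : leb_space R n, derivable F (x : Rn) 'e_j}.
Proof.
move=> FL; have cF : continuous F by exact: lip_continuous FL.
have mN : measurable (~` cauchy_quot j F : set (leb_space R n)).
  by apply: measurableC; apply: (@measurable_cauchy_quot _ (leb_space R n) id) => // U; exact: open_leb_measurable.
exists (~` cauchy_quot j F); split => //; last first.
  by move=> x /=; apply: contra_not => /cauchy_quot_derivable; exact.
apply: (leb_null_lines (j := j)) => //.
  apply: (@measurableC _ _ (_ @^-1` cauchy_quot j F)); apply: measurable_cauchy_quot => // U oU.
  exact: measurable_line_shift.
move=> x.
have ej : `|('e_j : Rn)| <= 1.
  by apply: norm_le_coord => // i; rewrite mxE; case: eqP => _; case: eqP => _; rewrite ?normr1 ?normr0.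
have L0 : 0 <= L.
  have e0 : 0 < `|('e_j : Rn) - 0|; last by rewrite -(pmulr_lge0 _ e0); apply: le_trans (FL _ _).
  rewrite subr0 normr_gt0; apply/eqP => /rowP/(_ j); rewrite !mxE !eqxx => /eqP.
  by rewrite oner_eq0.
have [|M [mM M0 HM]] := @lipschitz_derivable_ae R (fun t => F (t *: 'e_j + x)) L.
  move=> s t; apply: le_trans (FL _ _) _.
  rewrite opprD addrACA subrr addr0 -scalerBl normrZ.
  by rewrite ler_wpM2l// ler_piMr.
apply/eqP; rewrite eq_le measure_ge0 andbT -M0; apply: le_measure; rewrite ?inE//.
  rewrite (_ : [set t | _] = ~` ((fun t : measurableTypeR R => t *: 'e_j + x) @^-1` cauchy_quot j F))//.
  apply: measurableC; apply: measurable_cauchy_quot => // U oU.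
  apply: open_measurable; apply: open_comp => // t _.
  by apply: cvgD; [apply: cvgZr_tmp; exact: cvg_id|exact: cvg_cst].
move=> t /= Nt; apply: HM => /= dF; apply: Nt; apply: derivable_cauchy_quot.
move: dF; rewrite /derivable.
rewrite (_ : (fun h : R => h^-1 *: ((_ \o shift t) (h *: 1) - _)) =
   (fun h : R => h^-1 *: ((F \o shift (t *: 'e_j + x)) (h *: 'e_j) - F (t *: 'e_j + x))))//.
apply/funext => h /=; rewrite addrA -scalerDl; congr (_ *: (F (_ *: _ + _) - _)).
by rewrite /shift/= [_ *: 1]mulr1.
Qed.

End partial_ae.

(** * Lipschitz functions and their derivatives under the integral *)

Section lip_class.
Context {R : realType} {n : nat}.
Notation Rn := 'rV[R]_n.+1.
Implicit Types (F G : Rn -> R) (L : R) (j : 'I_n.+1) (Omega : set Rn).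

Definition lip F := exists L, forall x y, `|F x - F y| <= L * `|x - y|.

Lemma lip_ge0 F : lip F -> exists2 L, 0 <= L & forall x y, `|F x - F y| <= L * `|x - y|.
Proof.
move=> [L FL]; exists `|L| => // x y; apply: le_trans (FL x y) _.
by rewrite ler_wpM2r// ler_norm.
Qed.

Lemma lipschitz_cP Omega F :
  lipschitz_c Omega F <-> lip F /\ compact_support_in Omega F.
Proof.
split=> -[H cs]; split => //.
  move: H => [M [Mr H]]; exists (M + 1) => x y.
  by have := H (M + 1); rewrite ltrDl => /(_ ltr01 (x, y)); exact.
have [L L0 FL] := lip_ge0 H; exists L; split; first exact: num_real.
move=> M LM [x y] _ /=; apply: le_trans (FL x y) _.
by rewrite ler_wpM2r// ltW.
Qed.

Lemma lip_continuousW F : lip F -> continuous F.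
Proof. by move=> [L]; exact: lip_continuous. Qed.

Lemma lip_measurable F : lip F -> measurable_fun setT (F : leb_space R n -> R).
Proof. by move=> /lip_continuousW; exact: continuous_leb_measurable. Qed.

Lemma lip_cst c : lip (fun=> c).
Proof. by exists 0 => x y; rewrite subrr normr0 mul0r. Qed.

Lemma lipM F G M : lip F -> lip G -> (forall x, `|F x| <= M) -> (forall x, `|G x| <= M) ->
  lip (fun x => F x * G x).
Proof.
move=> [L FL] [L' GL] FM GM; exists (M * L' + M * L) => x y.
rewrite (_ : F x * G x - F y * G y = F x * (G x - G y) + G y * (F x - F y)); last by ring.
rewrite mulrDl -!mulrA; apply: le_trans (ler_normD _ _) _; rewrite !normrM.
by apply: lerD; apply: ler_pM.
Qed.

Lemma lip_shift F (a : Rn) : lip F -> lip (fun x => F (a + x)).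
Proof.
move=> [L FL]; exists L => x y; apply: le_trans (FL _ _) _.
by rewrite opprD addrACA subrr add0r.
Qed.

Lemma csupp_out Omega F x : compact_support_in Omega F -> ~ Omega x -> F x = 0.
Proof.
move=> [_ sO] Ox; apply/eqP/negPn/negP => Fx; apply: Ox; apply: sO.
exact: subset_closure.
Qed.

Lemma csuppM Omega F G : compact_support_in Omega G -> compact_support_in Omega (fun x => F x * G x).
Proof.
move=> [cG sG].
have sub : closure [set x | F x * G x != 0] `<=` closure [set x | G x != 0].
  apply: closure_subset => x /=; apply: contra_neq => ->; exact: mulr0.
by split; [apply: subclosed_compact cG sub; exact: closed_closure|exact: subset_trans sub sG].
Qed.

Lemma csupp_comp Omega F (T : R -> R) : T 0 = 0 -> compact_support_in Omega F ->
  compact_support_in Omega (fun x => T (F x)).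
Proof.
move=> T0 [cG sG].
have sub : closure [set x | T (F x) != 0] `<=` closure [set x | F x != 0].
  by apply: closure_subset => x /=; apply: contra_neq => ->.
by split; [apply: subclosed_compact cG sub; exact: closed_closure|exact: subset_trans sub sG].
Qed.

Lemma csupp_bounded Omega F : continuous F -> compact_support_in Omega F ->
  exists2 M, 0 <= M & forall x, `|F x| <= M.
Proof.
move=> cF [cS _].
have : compact (F @` closure [set x | F x != 0]).
  by apply: continuous_compact => //; exact: continuous_subspaceT.
move=> /compact_bounded[M [_ HM]]; exists (`|M| + 1) => // x.
have [->|Fx] := eqVneq (F x) 0; first by rewrite normr0.
apply: (HM (`|M| + 1)); first by rewrite ltr_pwDr// ler_norm.
by exists x => //; exact: subset_closure.
Qed.

Lemma csupp_box Omega F : compact_support_in Omega F ->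
  exists M, forall x, F x != 0 -> box (const_mx (- M), const_mx M) x.
Proof.
move=> [/compact_bounded/bounded_set_box[M HM] _]; exists M => x Fx.
by apply: HM; exact: subset_closure.
Qed.

Lemma csupp_near0 Omega F x : compact_support_in Omega F -> ~ Omega x ->
  \forall y \near x, F y = 0.
Proof.
move=> [_ sO] Ox; have : ~ closure [set x | F x != 0] x by move/sO.
move=> Cx; have : nbhs x (~` closure [set x | F x != 0]).
  by apply: open_nbhs_nbhs; split => //; apply: closed_openC; exact: closed_closure.
apply: filterS => y Cy; apply/eqP/negPn/negP => Fy; apply: Cy; exact: subset_closure.
Qed.

Lemma partial_out Omega F j x : compact_support_in Omega F -> ~ Omega x ->
  partial j F x = 0.
Proof.
move=> cF Ox; rewrite /partial (near_eq_derive (g := cst 0)) ?derive_cst//.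
exact: csupp_near0 cF Ox.
Qed.

Lemma harmonic_dnbhs0 : (k.+1%:R^-1 : R) @[k --> \oo] --> (0 : R)^'.
Proof.
move=> A; rewrite /dnbhs /= => /nbhs_ballP[e /= e0 eA].
have : (k.+1%:R^-1 : R) @[k --> \oo] --> (0 : R) by exact: cvg_harmonic.
move=> /cvgrPdist_lt/(_ _ e0); apply: filterS => k ke.
by apply: eA => //; rewrite invr_eq0.
Qed.

Lemma cvg_dquot_seq F j x : derivable F x 'e_j ->
  dquot j F k.+1%:R^-1 x @[k --> \oo] --> partial j F x.
Proof.
move=> dF.
have H : (h^-1 *: ((F \o shift x) (h *: 'e_j) - F x)) @[h --> 0^'] --> 'D_'e_j F x by exact: dF.
exact: (cvg_comp _ _ harmonic_dnbhs0 H).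
Qed.

Lemma dquot_bound F L j h x : 0 <= L -> (forall x y, `|F x - F y| <= L * `|x - y|) ->
  `|dquot j F h x| <= L.
Proof.
move=> L0 FL; rewrite /dquot normrM normfV.
have [->|h0] := eqVneq h 0; first by rewrite normr0 invr0 mul0r.
rewrite ler_pdivrMl ?normr_gt0//; apply: le_trans (FL _ _) _.
rewrite addrK normrZ mulrC; apply: ler_wpM2r => //; rewrite ler_piMr//.
by apply: norm_le_coord => // i; rewrite mxE; case: eqP => _; case: eqP => _; rewrite ?normr1 ?normr0.
Qed.

(* Where the limit of the difference quotients does not exist, [partial] has the default value 0. *)
Lemma partial_bound F L j x : 0 <= L -> (forall x y, `|F x - F y| <= L * `|x - y|) ->
  `|partial j F x| <= L.
Proof.
move=> L0 FL; have [dF|ndF] := pselect (derivable F x 'e_j); last first.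
  by rewrite /partial /derive dvgP// normr0.
have /cvg_norm c := cvg_dquot_seq dF.
rewrite -(cvg_lim (@Rhausdorff R) c); apply: limr_le; first by apply/cvg_ex; eexists; exact: c.
by near=> k; exact: dquot_bound.
Unshelve. all: by end_near. Qed.

(** Where the derivative exists it is the upper limit of the difference quotients with increments
    [1 / (k + 1)], which is measurable; completeness of the measure absorbs the null set where it
    does not. *)
Lemma partial_measurable F j : lip F -> measurable_fun setT (partial j F : leb_space R n -> R).
Proof.
move=> lF; apply/measurable_EFinP.
pose g (x : leb_space R n) := limn_esup (fun k => (dquot j F k.+1%:R^-1 x)%:E).
apply: (@ae_measurable_fun _ _ _ leb (@measure_is_complete_caratheodory _ _ (leb_outer R n)) _ g).
  have [L FL] := lF; apply: filterS (lip_partial_ae j FL) => x dF _.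
  have c : ((dquot j F k.+1%:R^-1 x)%:E @[k --> \oo] --> (partial j F x)%:E)%E.
    by apply/fine_cvgP; split; [exact: nearW|exact: cvg_dquot_seq dF].
  rewrite /g is_cvg_limn_esupE; first exact/cvg_lim.
  by apply/cvg_ex; eexists; exact: c.
apply: measurable_fun_limn_esup => k; apply/measurable_EFinP.
by apply: continuous_leb_measurable; apply: dquot_continuous; exact: lip_continuousW.
Qed.

Lemma shift_itv_slack (M t b y : R) : 0 <= t <= 1 -> 0 <= b <= 1 ->
  - M < t * b + y <= M -> - (M + 1) < y <= M + 1.
Proof.
move=> /andP[t0 t1] /andP[b0 b1] /andP[h1 h2].
have := mulr_ge0 t0 b0; have := mulr_ile1 t0 b0 t1 b1 => h3 h4.
by apply/andP; split; lra.
Qed.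

(** Translation invariance makes the integral of every difference quotient vanish; the quotients are
    bounded by the Lipschitz constant on a fixed box, so dominated convergence passes to the
    derivative. *)
Lemma integral_partial0 F j M : lip F -> (forall x, F x != 0 -> box (const_mx (- M), const_mx M) x) ->
  (\int[@leb R n]_x (partial j F x)%:E = 0)%E.
Proof.
move=> lF FM; have [L L0 FL] := lip_ge0 lF.
(* The increments [1 / (k + 1)] are at most 1, so this larger box contains the supports of all the
   difference quotients. *)
pose Bx := box (const_mx (- (M + 1)), const_mx (M + 1)) : set (leb_space R n).
have mB : measurable Bx by exact: box_measurable.
have Bfin : (leb Bx < +oo)%E by exact: leb_box_fin.
have BM (x : Rn) : box (const_mx (- M), const_mx M) x -> Bx x.
  move=> H i; have := H i; rewrite !mxE !in_itv/= => /andP[? ?]; apply/andP; split; lra.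
have out0 x : ~ Bx x -> F x = 0.
  by move=> Bxx; apply/eqP/negPn/negP => /FM/BM.
have out1 k x : ~ Bx x -> F (k.+1%:R^-1 *: 'e_j + x) = 0.
  move=> Bxx.
    apply/eqP/negPn/negP => /FM H; apply: Bxx => i; have := H i.
    rewrite !mxE eqxx/= !in_itv/=.
  apply: shift_itv_slack; first by rewrite invr_ge0 ler0n/= invf_le1// ler1n.
  by case: (i == j); rewrite lexx ler01.
have out k x : ~ Bx x -> dquot j F k.+1%:R^-1 x = 0.
  by move=> Bxx; rewrite /dquot (out1 _ _ Bxx) (out0 _ Bxx) subrr mulr0.
have intB (G : Rn -> R) : measurable_fun setT (G : leb_space R n -> R) -> (exists K, forall x, `|G x| <= K) ->
    (forall x, ~ Bx x -> G x = 0) -> leb.-integrable setT (EFin \o G : leb_space R n -> \bar R).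
  move=> mG [K GK] G0.
  have -> : EFin \o G = (EFin \o G) \_ Bx.
    apply/funext => x; rewrite /patch; case: ifPn => //; rewrite notin_setE => /G0 /= ->//.
  have iB : leb.-integrable Bx (EFin \o G : leb_space R n -> \bar R).
    apply: measurable_bounded_integrable => //; first exact: measurable_funTS.
    exists K; split; first exact: num_real.
    by move=> K' KK' x _; apply: le_trans (GK x) (ltW KK').
  exact: (iffLR (integrable_mkcond (mu := leb) (EFin \o G : leb_space R n -> \bar R) mB) iB).
have Fb : exists K, forall x, `|F x| <= K.
  exists (L * (`|M| + `|M|) + `|F 0|) => x.
  have [->|/FM xM] := eqVneq (F x) 0; first by rewrite normr0 addr_ge0// mulr_ge0.
  rewrite -[X in `|X|](subrK (F 0)) (le_trans (ler_normD _ _))// lerD2r.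
  apply: le_trans (FL _ _) _; rewrite ler_wpM2l// subr0; apply: norm_le_coord => // i.
  have := xM i; rewrite !mxE in_itv/= => /andP[h1 h2]; rewrite ler_norml.
  by have := ler_norm M; have := normr_ge0 M => h3 h4; apply/andP; split; lra.
have iF : leb.-integrable setT (EFin \o F : leb_space R n -> \bar R).
  apply: intB; [exact: lip_measurable|exact: Fb|].
  exact: out0.
have int0 k : (\int[@leb R n]_x (dquot j F k.+1%:R^-1 x)%:E = 0)%E.
  have iS : leb.-integrable setT (fun x : leb_space R n => (F (k.+1%:R^-1 *: 'e_j + x))%:E).
    apply: intB.
    - by apply: lip_measurable; exact: lip_shift.
    - by have [K HK] := Fb; exists K => x; exact: HK.
    - exact: out1.
  have E : (\int[@leb R n]_x (F (k.+1%:R^-1 *: 'e_j + x))%:E = \int[@leb R n]_x (F x)%:E)%E.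
    rewrite -[RHS](@integral_shift R n (k.+1%:R^-1 *: 'e_j) (EFin \o F)).
      by apply: eq_integral => x _; rewrite /shift_leb /= addrC.
    by apply/measurable_EFinP; exact: lip_measurable.
  have fF : (\int[@leb R n]_x (F x)%:E)%E \is a fin_num by exact: integrable_fin_num iF.
  rewrite /dquot; under eq_integral do rewrite EFinM EFinB.
  rewrite integralZl//; last exact: integrableB.
  by rewrite integralB// E subee// mule0.
have [|||||_ _] := @dominated_convergence _ _ _ leb setT measurableT
  (fun k x => (dquot j F k.+1%:R^-1 x)%:E) (EFin \o partial j F) (EFin \o (fun x => L * \1_Bx x)).
- move=> k; apply/measurable_EFinP; apply: continuous_leb_measurable.
  by apply: dquot_continuous; exact: lip_continuousW.
- by apply/measurable_EFinP; exact: partial_measurable.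
- apply: filterS (lip_partial_ae j FL) => x dF _.
  by apply/fine_cvgP; split; [exact: nearW|exact: cvg_dquot_seq dF].
- apply: intB; first by apply: measurable_funM => //; exact: measurable_indic.
    exists L => x; rewrite normrM ger0_norm// ler_piMr// indicE.
    by case: (_ \in _); rewrite ?normr1 ?normr0.
  by move=> x Bxx; rewrite indicE memNset// mulr0.
- apply: aeW => x k _ /=; rewrite lee_fin indicE.
  have [/set_mem xB|] := boolP (x \in Bx); first by rewrite mulr1 dquot_bound.
  by rewrite notin_setE => /out ->; rewrite normr0 mulr0.
under eq_fun do rewrite int0.
by move=> /cvg_lim <-//; rewrite lim_cst.
Qed.

End lip_class.

(** * Functions of class C^1 *)

(* [tau] is the derivative of [T], with a uniform second-order error term. *)
Definition quad_der {R : realType} (T tau : R -> R) (c : R) :=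
  forall a b, `|T b - T a - tau a * (b - a)| <= c * (b - a) ^+ 2.

Section C1_class.
Context {R : realType} {n : nat}.
Notation Rn := 'rV[R]_n.+1.
Implicit Types (F G : Rn -> R) (j : 'I_n.+1) (Omega : set Rn).

(** Divided by the increment, the error is at most [c] times the increment of [F] times its
    difference quotient; the first factor tends to 0 and the second converges. Derivability of [F]
    at the single point [x] therefore suffices. *)
Lemma quad_der_chain (T tau : R -> R) c F x j : quad_der T tau c ->
  derivable F x 'e_j -> is_derive x ('e_j : Rn) (fun y => T (F y)) (tau (F x) * partial j F x).
Proof.
move=> Tc dF; pose D := partial j F x.
have c0 : 0 <= c.
  by have := Tc 0 1; rewrite subr0 expr1n !mulr1 => /(le_trans (normr_ge0 _)).
have Fq : (h^-1 *: (F (h *: 'e_j + x) - F x)) @[h --> 0^'] --> D by exact: dF.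
have Fc : F (h *: 'e_j + x) - F x @[h --> (0 : R)^'] --> (0 : R).
  have H : (h * (h^-1 *: (F (h *: 'e_j + x) - F x))) @[h --> (0 : R)^'] --> 0 * D.
    by apply: cvgM => //; apply: cvg_within_filter; exact: cvg_id.
  rewrite mul0r in H; apply: cvg_trans H; apply: near_eq_cvg; near=> h.
  by rewrite /GRing.scale/= mulVKf//; near: h; exact: nbhs_dnbhs_neq.
have err : (h^-1 *: (T (F (h *: 'e_j + x)) - T (F x)) - tau (F x) * (h^-1 *: (F (h *: 'e_j + x) - F x)))
    @[h --> (0 : R)^'] --> (0 : R).
  apply/cvgr0Pnorm_le => e e0.
  have : (c * (`|F (h *: 'e_j + x) - F x| * `|h^-1 *: (F (h *: 'e_j + x) - F x)|)) @[h --> (0 : R)^'] --> c * (`|0 : R| * `|D|).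
    apply: cvgMl_tmp; apply: cvgM; exact: cvg_norm.
  rewrite normr0 mul0r mulr0 => /cvgr0Pnorm_le/(_ _ e0); apply: filterS => h.
  apply: le_trans; rewrite [in X in _ <= X]ger0_norm ?mulr_ge0//.
  set u := F (h *: 'e_j + x); rewrite /GRing.scale/=.
  have -> : c * (`|u - F x| * `|h^-1 * (u - F x)|) = `|h^-1| * (c * `|u - F x| ^+ 2).
    by rewrite normrM; ring.
  rewrite mulrCA -mulrBr normrM; apply: ler_wpM2l => //; apply: le_trans (Tc _ _) _.
  by rewrite real_normK// num_real.
have H : (h^-1 *: (T (F (h *: 'e_j + x)) - T (F x))) @[h --> (0 : R)^'] --> tau (F x) * D.
  rewrite -[X in _ --> X]add0r.
  rewrite (_ : (fun h => _) = fun h : R => (h^-1 *: (T (F (h *: 'e_j + x)) - T (F x))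
      - tau (F x) * (h^-1 *: (F (h *: 'e_j + x) - F x)))
      + tau (F x) * (h^-1 *: (F (h *: 'e_j + x) - F x))); last first.
    by apply/funext => h; rewrite subrK.
  by apply: cvgD => //; exact: cvgMl_tmp.
by split; [apply/cvg_ex; eexists; exact: H|exact/cvg_lim].
Unshelve. all: by end_near. Qed.

Definition C1 F := (forall j x, derivable F x 'e_j) /\ (forall j, continuous (partial j F)).

Lemma C1_cst c : C1 (fun=> c).
Proof.
split=> j; first by move=> x; exact: derivable_cst.
by rewrite (_ : partial j _ = cst 0); [exact: cst_continuous|apply/funext => x; exact: derive_cst].
Qed.

Lemma C1D F G : C1 F -> C1 G -> C1 (fun x => F x + G x).
Proof.
move=> [dF cF] [dG cG]; split=> j; first by move=> x; exact: derivableD.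
rewrite (_ : partial j _ = fun x => partial j F x + partial j G x); last first.
  by apply/funext => x; exact: deriveD.
exact: ctsD.
Qed.

Lemma C1M F G : continuous F -> continuous G -> C1 F -> C1 G -> C1 (fun x => F x * G x).
Proof.
move=> kF kG [dF cF] [dG cG]; split=> j; first by move=> x; exact: derivableM.
rewrite (_ : partial j _ = fun x => F x * partial j G x + G x * partial j F x); last first.
  by apply/funext => x; exact: deriveM.
by apply: ctsD; apply: ctsM.
Qed.

Lemma C1_comp (T tau : R -> R) c F : quad_der T tau c -> continuous tau -> continuous F ->
  C1 F -> C1 (fun x => T (F x)).
Proof.
move=> Tc ctau kF [dF cF]; split=> j.
  by move=> x; have [] := quad_der_chain Tc (dF j x).
rewrite (_ : partial j _ = fun x => tau (F x) * partial j F x); last first.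
  by apply/funext => x; rewrite /partial; have /@derive_val := quad_der_chain Tc (dF j x).
by apply: ctsM => //; exact: cts_comp.
Qed.

Lemma C1_coord (i : 'I_n.+1) : C1 (fun x => x 0 i).
Proof.
have D j x : is_derive x ('e_j : Rn) (fun x : Rn => x 0 i) ((i == j)%:R).
  have H : (h^-1 *: (((fun x : Rn => x 0 i) \o shift x) (h *: 'e_j) - x 0 i)) @[h --> (0 : R)^'] --> ((i == j)%:R : R).
    apply: cvg_near_cst; near=> h; rewrite /= !mxE eqxx/= addrK /GRing.scale/= mulrA mulVf ?mul1r//.
    by near: h; exact: nbhs_dnbhs_neq.
  by split; [apply/cvg_ex; eexists; exact: H|exact/cvg_lim].
split=> j; first by move=> x; have [] := D j x.
rewrite (_ : partial j _ = cst ((i == j)%:R)); first exact: cst_continuous.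
by apply/funext => x; rewrite /partial; have /@derive_val := D j x.
Unshelve. all: by end_near. Qed.

(** The square makes the positive part C^1 with a quadratic Taylor error; products of such factors
    give C^1 bumps that are positive exactly on an open box. *)
Definition sqpos (t : R) : R := Num.max 0 t ^+ 2.

Lemma quad_der_sqpos : quad_der sqpos (fun t => 2 * Num.max 0 t) 1.
Proof.
move=> a b; rewrite /sqpos mul1r ler_norml.
have ba := sqr_ge0 (b - a); have a2 := sqr_ge0 a; have b2 := sqr_ge0 b.
case: (leP 0 a) => a0; case: (leP 0 b) => b0.
- by apply/andP; split; nra.
- have ab : a * b <= 0 by rewrite mulr_ge0_le0// ltW.
  by rewrite expr0n/=; apply/andP; split; nra.
- have ab : b * a <= 0 by rewrite mulr_ge0_le0// ltW.
  by rewrite expr0n/=; apply/andP; split; nra.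
- by rewrite expr0n/=; apply/andP; split; nra.
Qed.

Lemma maxr0_continuous : continuous (fun t : R => Num.max 0 t).
Proof. by move=> t; apply: (@continuous_max R R (cst 0) id); [exact: cst_continuous|exact: cvg_id]. Qed.

Lemma sqpos_gt0 t : (0 < sqpos t) = (0 < t).
Proof.
rewrite /sqpos; case: (leP 0 t) => t0; last by rewrite expr0n/= ltxx; apply/esym/negbTE; rewrite -leNgt ltW.
by rewrite exprn_even_gt0//= lt_def t0 andbT.
Qed.

Lemma sqpos_ge0 t : 0 <= sqpos t. Proof. exact: sqr_ge0. Qed.

Definition bumpf (a b : Rn) (x : Rn) : R :=
  \prod_(i < n.+1) (sqpos (x 0 i - a 0 i) * sqpos (b 0 i - x 0 i)).

Lemma bumpf_ge0 a b x : 0 <= bumpf a b x.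
Proof. by apply: prodr_ge0 => i _; rewrite mulr_ge0// sqpos_ge0. Qed.

Lemma bumpf_gt0 a b x : 0 < bumpf a b x <-> obox a b x.
Proof.
split => [|H].
  move=> /lt0r_neq0/prodf_neq0 H i; have := H i isT.
  rewrite mulf_eq0 negb_or => /andP[h1 h2].
  rewrite -subr_gt0 -sqpos_gt0 lt0r h1 sqpos_ge0/=.
  by rewrite -subr_gt0 -sqpos_gt0 lt0r h2 sqpos_ge0.
by apply: prodr_gt0 => i _; have /andP[? ?] := H i; rewrite mulr_gt0// sqpos_gt0 subr_gt0.
Qed.

Lemma C1_continuous_prod (s : seq 'I_n.+1) (F_ : 'I_n.+1 -> Rn -> R) :
  (forall i, C1 (F_ i) /\ continuous (F_ i)) ->
  C1 (fun x => \prod_(i <- s) F_ i x) /\ continuous (fun x => \prod_(i <- s) F_ i x).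
Proof.
move=> H; elim: s => [|i s [IH1 IH2]].
  rewrite (_ : (fun _ => _) = cst 1); last by apply/funext => x; rewrite big_nil.
  by split; [exact: C1_cst|exact: cst_continuous].
rewrite (_ : (fun _ => _) = fun x => F_ i x * \prod_(i <- s) F_ i x); last first.
  by apply/funext => x; rewrite big_cons.
have [h1 h2] := H i; split; first exact: C1M.
exact: ctsM.
Qed.

Lemma C1_bumpf a b : C1 (bumpf a b) /\ continuous (bumpf a b).
Proof.
apply: C1_continuous_prod => i.
have cx : continuous (fun x : Rn => x 0 i) by exact: coord_continuous.
have cs : continuous sqpos.
  by move=> t; rewrite /sqpos; apply: (@continuous_comp _ _ _ _ (fun t : R => t ^+ 2)); [exact: maxr0_continuous|exact: exprn_continuous].
have c2 : continuous (fun t : R => 2 * Num.max 0 t).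
  by apply: ctsM; [exact: cts_cst|exact: maxr0_continuous].
have c1 : continuous (fun x : Rn => x 0 i - a 0 i) by apply: ctsB => //; exact: cts_cst.
have c3 : continuous (fun x : Rn => b 0 i - x 0 i) by apply: ctsB => //; exact: cts_cst.
have k1 : continuous (fun x : Rn => sqpos (x 0 i - a 0 i)) by exact: cts_comp.
have k2 : continuous (fun x : Rn => sqpos (b 0 i - x 0 i)) by exact: cts_comp.
split; last exact: ctsM.
apply: C1M => //.
  apply: (C1_comp quad_der_sqpos c2 c1).
  by apply: (C1D (C1_coord i)); exact: C1_cst.
apply: (C1_comp quad_der_sqpos c2 c3).
apply: (C1D (C1_cst _)).
rewrite (_ : (fun _ => _) = fun x : Rn => -1 * x 0 i); last by apply/funext => x; rewrite mulN1r.
by apply: C1M => //; [exact: cst_continuous|exact: C1_cst|exact: C1_coord].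
Qed.

(** A C^1 saturation that vanishes only at 0, with [1 - sat t = (1 + t^2)^-1]; it turns large
    multiples of a nonnegative function into approximations of the indicator of its positivity
    set. *)
Definition sat (t : R) : R := t ^+ 2 / (1 + t ^+ 2).

Lemma sat_den_gt0 (t : R) : 0 < 1 + t ^+ 2.
Proof. by rewrite ltr_pwDl// sqr_ge0. Qed.

Lemma quad_der_sat : quad_der sat (fun t => 2 * t / (1 + t ^+ 2) ^+ 2) 2.
Proof.
move=> a b; rewrite /sat.
have A := sat_den_gt0 a; have B := sat_den_gt0 b.
(* The Taylor remainder contains the factor [(b - a)^2] exactly; the cofactor is at most 2 in
   absolute value because [2 |a b| <= a^2 + b^2]. *)
rewrite (_ : _ - _ = (b - a) ^+ 2 * ((1 - a ^+ 2 - 2 * a * b) / ((1 + a ^+ 2) ^+ 2 * (1 + b ^+ 2)))); last first.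
  by field; rewrite !gt_eqF.
rewrite normrM ger0_norm ?sqr_ge0// mulrC ler_wpM2r ?sqr_ge0//.
have D0 : 0 < (1 + a ^+ 2) ^+ 2 * (1 + b ^+ 2) by rewrite mulr_gt0 ?exprn_gt0.
rewrite normrM normfV (gtr0_norm D0) ler_pdivrMr//.
have h : (1 + a ^+ 2) * (1 + b ^+ 2) <= (1 + a ^+ 2) ^+ 2 * (1 + b ^+ 2).
  by rewrite ler_pM2r// expr2 ler_peMl ?(ltW A)// lerDl sqr_ge0.
have h2 : 0 <= a ^+ 2 * b ^+ 2 by rewrite mulr_ge0 ?sqr_ge0.
rewrite ler_norml; apply/andP; split; nra.
Qed.

Lemma sat_bounds t : 0 <= sat t <= 1.
Proof.
have d0 := sat_den_gt0 t.
by rewrite /sat divr_ge0 ?sqr_ge0 ?(ltW d0)//= ler_pdivrMr// mul1r lerDr.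
Qed.

Lemma sat_continuous_der : continuous (fun t : R => 2 * t / (1 + t ^+ 2) ^+ 2).
Proof.
move=> t; apply: cvgM; first by apply: cvgMl_tmp; exact: cvg_id.
apply: cvgV; first by rewrite expf_neq0// gt_eqF ?sat_den_gt0.
apply: (@continuous_comp R R R (fun t => 1 + t ^+ 2) (fun t => t ^+ 2)); last exact: exprn_continuous.
by apply: cvgD; [exact: cvg_cst|exact: exprn_continuous].
Qed.

Lemma sat_continuous : continuous sat.
Proof.
move=> t; apply: cvgM; first exact: exprn_continuous.
apply: cvgV; first by rewrite gt_eqF ?sat_den_gt0.
by apply: cvgD; [exact: cvg_cst|exact: exprn_continuous].
Qed.

End C1_class.

(** * Density of test functions *)

Lemma fine_norm_le {R : realType} (x : \bar R) (e : R) :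
  x \is a fin_num -> `|fine x| <= e -> (x <= e%:E)%E.
Proof. by move=> fx /(le_trans (ler_norm _)); rewrite -lee_fin fineK. Qed.

Section density.
Import HBSimple.
Context {R : realType} {n : nat}.
Notation Rn := 'rV[R]_n.+1.
Notation Ln := (leb_space R n).
Notation mu := (@leb R n).
Variable Omega : set Rn.
Hypotheses (oO : open Omega) (bO : bounded_set Omega).
Implicit Types (F G : Rn -> R) (U : set Rn).

Let mO : measurable (Omega : set Ln).
Proof. exact: open_leb_measurable. Qed.

Let fO : (mu Omega < +oo)%E.
Proof. exact: leb_bounded_fin. Qed.

Lemma cbox_compact (a b : Rn) : compact (cbox a b).
Proof.
exact: (@rV_compact _ _ (fun i => `[a 0 i, b 0 i]%classic) (fun i => @segment_compact _ _ _)).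
Qed.

Lemma cbox_closed (a b : Rn) : closed (cbox a b).
Proof. by apply: compact_closed (@cbox_compact a b); exact: norm_hausdorff. Qed.

(* The indicator of an open set is a pointwise limit of compactly supported
   C^1 functions: [sat (N * S_N)] with [S_N] the sum of the first N bumps of a
   covering by rational boxes. *)
Lemma open_indicator_approx U : open U -> exists f : nat -> Rn -> R,
  [/\ forall N, C1_c U (f N), forall N, continuous (f N), forall N x, 0 <= f N x <= 1 &
      forall x, f N x @[N --> \oo] --> (\1_U x : R)].
Proof.
move=> oU; have [a [b [UE Ucb]]] := open_rational_boxes oU.
pose S N (x : Rn) := \sum_(k < N) bumpf (a k) (b k) x.
have S0 N x : 0 <= S N x by apply: sumr_ge0 => k _; exact: bumpf_ge0.
have SC N : C1 (S N) /\ continuous (S N).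
  elim: N => [|N [IH1 IH2]].
    rewrite (_ : S 0%N = cst 0); last by apply/funext => x; rewrite /S big_ord0.
    by split; [exact: C1_cst|exact: cst_continuous].
  rewrite (_ : S N.+1 = fun x => S N x + bumpf (a N) (b N) x); last first.
    by apply/funext => x; rewrite /S big_ord_recr.
  by have [h1 h2] := C1_bumpf (a N) (b N); split; [exact: C1D|exact: ctsD].
pose f N x := sat (N%:R * S N x).
have NC N : C1 (fun x => N%:R * S N x) /\ continuous (fun x => N%:R * S N x).
  have [h1 h2] := SC N.
  by split; [apply: C1M => //; [exact: cts_cst|exact: C1_cst]|apply: ctsM => //; exact: cts_cst].
have fs N : [set x | f N x != 0] `<=` \bigcup_(k < N) cbox (a k) (b k).
  move=> x /= fx; have : S N x != 0.
    by apply: contra_neq fx => Sx; rewrite /f /sat Sx mulr0 expr0n/= mul0r.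
  rewrite /S psumr_neq0; last by move=> k _; exact: bumpf_ge0.
  move=> /hasP[k _ /= bk]; exists (nat_of_ord k); first exact: ltn_ord.
  move=> i; by have /bumpf_gt0/(_ i)/andP[/ltW-> /ltW->] := bk.
have cb N : compact (\bigcup_(k < N) cbox (a k) (b k)).
  rewrite bigcup_mkord.
  by elim/big_ind : _ => //; [exact: compact0|exact: compactU|move=> k _; exact: cbox_compact].
have cl N : closed (\bigcup_(k < N) cbox (a k) (b k)).
  by rewrite bigcup_mkord; apply: closed_bigsetU => k _; exact: cbox_closed.
have cfs N : closure [set x | f N x != 0] `<=` \bigcup_(k < N) cbox (a k) (b k).
  by have /closure_id -> := cl N; apply: closure_subset; exact: fs.
exists f; split.
- move=> N; have [h1 h2] := NC N.
  have [d1 d2] := C1_comp quad_der_sat sat_continuous_der h2 h1.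
  split => //; split; first by apply: subclosed_compact (cb N) (cfs N); exact: closed_closure.
  by move=> x /cfs[k _ /Ucb].
- by move=> N; have [h1 h2] := NC N; apply: cts_comp => //; exact: sat_continuous.
- by move=> N x; exact: sat_bounds.
move=> x; have [Ux|Ux] := pselect (U x); last first.
  rewrite indicE memNset//=; apply: cvg_near_cst; apply: nearW => N.
  apply/eqP/negPn/negP => fx; apply: Ux; have /fs[k _ H] : [set x | f N x != 0] x by [].
  exact: Ucb H.
rewrite indicE mem_set//=.
move: (Ux); rewrite UE => -[k0 _ /bumpf_gt0 bk0].
set d := bumpf _ _ x in bk0.
have Sd N : (k0 < N)%N -> d <= S N x.
  move=> kN; rewrite /S (bigD1 (Ordinal kN))//= lerDl.
  by apply: sumr_ge0 => k _; exact: bumpf_ge0.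
apply/cvgrPdist_le => e e0; near=> N.
have kN : (k0 < N)%N by near: N; exact: nbhs_infty_gt.
(* Here [d > 0] is the value at [x] of one bump of the sum. The choice gives [t * e >= 1], hence
   [1 - sat t = (1 + t^2)^-1 <= t^-1 <= e]. *)
have Ne : (d * e)^-1 <= N%:R by near: N; exact: nbhs_infty_ger.
rewrite /f /sat; set t := N%:R * S N x.
have de0 : 0 < d * e by rewrite mulr_gt0.
have te : 1 <= t * e.
  have : (d * e)^-1 * (d * e) <= N%:R * (d * e) by rewrite ler_wpM2r// ltW.
  rewrite mulVf ?gt_eqF// => /le_trans; apply; rewrite /t -mulrA.
  by apply: ler_wpM2l => //; apply: ler_wpM2r; [exact: ltW|exact: Sd].
have t0 : 0 < t by rewrite -(pmulr_lgt0 _ e0) (lt_le_trans _ te).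
have D0 := sat_den_gt0 t.
have -> : 1 - t ^+ 2 / (1 + t ^+ 2) = (1 + t ^+ 2)^-1 by field; rewrite gt_eqF.
rewrite ger0_norm ?invr_ge0 ?(ltW D0)//.
rewrite invf_ple ?posrE//; apply: (@le_trans _ _ t); first by rewrite -[leLHS]mul1r ler_pdivrMr.
by have := sqr_ge0 (t - 1); nra.
Unshelve. all: by end_near. Qed.

Lemma C1_c_sub U V f : U `<=` V -> C1_c U f -> C1_c V f.
Proof. by move=> UV [h1 h2 [h3 h4]]; split => //; split => //; exact: subset_trans UV. Qed.

Lemma integrable_bounded_mul (f g : Ln -> R) M (D : set Ln) : measurable D ->
  mu.-integrable D (EFin \o f) -> measurable_fun D g -> (forall x, D x -> `|g x| <= M) ->
  mu.-integrable D (fun x => (f x * g x)%:E).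
Proof.
move=> mD fi mg gM.
have mf : measurable_fun D f by apply/measurable_EFinP; exact: measurable_int fi.
apply: (@le_integrable _ _ _ _ _ mD _ (fun x => (M%:E * (EFin \o f) x)%E)).
- by apply/measurable_EFinP; exact: measurable_funM.
- move=> x Dx /=; rewrite lee_fin !normrM mulrC ler_wpM2r//.
  exact: le_trans (gM _ Dx) (ler_norm _).
- exact: integrableZl.
Qed.

Lemma integral_open_eq0 (eta : Ln -> R) U : mu.-integrable Omega (EFin \o eta) ->
  (forall psi, C1_c Omega psi -> (\int[mu]_(x in Omega) (eta x * psi x)%:E = 0)%E) ->
  open U -> U `<=` Omega -> (\int[mu]_(x in U) (eta x)%:E = 0)%E.
Proof.
move=> ie H oU UO; have [f [fC fc f01 fcv]] := open_indicator_approx oU.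
have me : measurable_fun (Omega : set Ln) eta by apply/measurable_EFinP; exact: measurable_int ie.
have mU : measurable (U : set Ln) by exact: open_leb_measurable.
have [|||||_ _] := @dominated_convergence _ _ _ mu Omega mO
  (fun k x => (eta x * f k x)%:E) (fun x => (eta x * \1_U x)%:E) (abse \o EFin \o eta).
- move=> k; apply/measurable_EFinP; apply: measurable_funM => //.
  by apply: measurable_funTS; exact: continuous_leb_measurable.
- by apply/measurable_EFinP; exact: measurable_funM.
- apply: aeW => x _; apply/fine_cvgP; split; first exact: nearW.
  by apply: cvgMl_tmp; exact: fcv.
- exact: integrable_abse.
- apply: aeW => x k _ /=; rewrite lee_fin normrM ler_piMr//.
  by have /andP[h1 h2] := f01 k x; rewrite ger0_norm.
under eq_fun => k do rewrite (H _ (C1_c_sub UO (fC k))).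
move=> /cvg_lim; rewrite lim_cst// => -> //.
rewrite [RHS](_ : _ = \int[mu]_(x in Omega) ((EFin \o eta) \_ U) x)%E; last first.
  by apply: eq_integral => x _; rewrite /patch indicE; case: (x \in U); rewrite ?mulr1 ?mulr0.
by rewrite -integral_mkcondr setIidr.
Qed.

Lemma integral_small_set (eta : Ln -> R) (e : R) : mu.-integrable Omega (EFin \o eta) -> 0 < e ->
  exists2 d : R, 0 < d & forall A : set Ln, measurable A -> A `<=` Omega ->
   (mu A < d%:E)%E -> (`|\int[mu]_(x in A) (eta x)%:E| < e%:E)%E.
Proof.
move=> ie e0.
have ieO : mu.-integrable setT (EFin \o (eta \_ Omega)).
  by rewrite -restrict_EFin; exact: (iffLR (integrable_mkcond (mu := mu) _ mO) ie).
have [d [d0 dP]] := integral_normr_continuous ieO e0.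
exists d => // A mA AO Ad; have := dP A mA Ad; rewrite -lte_fin; apply: le_lt_trans.
have iA : mu.-integrable A (EFin \o eta) by exact: integrableS ie.
have -> : (\int[mu]_(x in A) `|(eta \_ Omega) x|)%R = (\int[mu]_(x in A) `|eta x|)%R.
  by apply: eq_Rintegral => x /set_mem/AO/mem_set xO; rewrite patchE xO.
rewrite /Rintegral fineK; last by apply: integrable_fin_num => //; exact: integrable_norm.
by apply: (@le_abse_integral _ _ _ mu A (EFin \o eta)) => //; exact: measurable_int iA.
Qed.

(** The integral of [eta] vanishes over open subsets of [Omega]. For measurable [E] inside an open
    [U] it is therefore minus the integral over [U \ E], which outer regularity and absolute
    continuity of the integral make arbitrarily small. *)
Lemma fundamental_lemma_of_variations (eta : Ln -> R) : mu.-integrable Omega (EFin \o eta) ->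
  (forall psi, C1_c Omega psi -> (\int[mu]_(x in Omega) (eta x * psi x)%:E = 0)%E) ->
  ae_in Omega (fun x => eta x = 0).
Proof.
move=> ie H.
have : ae_eq mu Omega (EFin \o eta) (cst 0%E).
  apply: integral_ae_eq => // E EO mE.
  rewrite integral0.
  have iE : mu.-integrable E (EFin \o eta) by exact: integrableS ie.
  apply/eqP; rewrite -abse_eq0 eq_le abse_ge0 andbT; apply/lee_addgt0Pr => e e0; rewrite add0e.
  have [d d0 dP] := integral_small_set ie e0.
  have Efin : (mu E < +oo)%E by apply: le_lt_trans fO; exact: le_lebesgue_outer.
  have [U [oU EU UO Ud]] := leb_outer_regular mE oO EO Efin d0.
  have mU : measurable U by exact: open_leb_measurable.
  have iU : mu.-integrable U (EFin \o eta) by exact: integrableS ie.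
  have := integral_open_eq0 ie H oU UO.
  have UE : U = E `|` (U `\` E) by rewrite setDUK.
  have mUE : measurable (U `\` E) by exact: measurableD.
  rewrite {1}UE integral_setU//; first last.
  - by apply/disj_set2P/seteqP; split => // x [Ex []].
  - by rewrite -UE; exact: measurable_int iU.
  have fE : (\int[mu]_(x in E) (eta x)%:E)%E \is a fin_num by exact: integrable_fin_num iE.
  have iUE : mu.-integrable (U `\` E) (EFin \o eta).
    by apply: integrableS iU => //; exact: subDsetl.
  have fUE : (\int[mu]_(x in U `\` E) (eta x)%:E)%E \is a fin_num by exact: integrable_fin_num iUE.
  move/eqP; rewrite -(fineK fE) -(fineK fUE) -EFinD eqe addr_eq0 => /eqP ->.
  rewrite EFinN abseN fineK//; apply/ltW/dP => //.
  by apply: subset_trans UO; exact: subDsetl.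
by apply: filterS => x /= + Ox => /(_ Ox)[].
Qed.

Section weak_null.
Variables (F_ : nat -> Ln -> R) (M : R).
Hypotheses (mF : forall k, measurable_fun (Omega : set Ln) (F_ k))
  (FM : forall k x, `|F_ k x| <= M).

(** For the bounded sequence [F_] this is weak-star convergence to 0 in L^infinity, tested on [eta].
    Boundedness makes the good [eta] a closed subspace of L^1; it is enlarged from C^1 functions to
    indicators of open sets, of measurable sets, then simple and integrable functions. *)
Definition weak_null (eta : Ln -> R) := mu.-integrable Omega (EFin \o eta) /\
  (\int[mu]_(x in Omega) (F_ k x * eta x))%R @[k --> \oo] --> (0 : R).

Let iM k eta : mu.-integrable Omega (EFin \o eta) -> mu.-integrable Omega (EFin \o (fun x => F_ k x * eta x)).
Proof.
move=> ie; have := integrable_bounded_mul (M := M) mO ie (mF k) (fun x _ => FM k x).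
by apply: eq_integrable => // x _ /=; rewrite mulrC.
Qed.

Lemma weak_null_closed eta : mu.-integrable Omega (EFin \o eta) ->
  (forall e, 0 < e -> exists2 eta', weak_null eta' & (\int[mu]_(x in Omega) `|(eta x - eta' x)%:E| <= e%:E)%E) ->
  weak_null eta.
Proof.
move=> ie H; split => //; apply/cvgr0Pnorm_le => e e0.
have M0 : 0 <= M by apply: le_trans (FM 0%N 0); exact: normr_ge0.
have M1 : 0 < M + 1 by rewrite ltr_wpDl.
have e2 : 0 < e / 2 / (M + 1) by rewrite !divr_gt0.
have [eta' [ie' We'] de] := H _ e2.
have e2' : 0 < e / 2 by rewrite divr_gt0.
move/cvgr0Pnorm_le : We' => /(_ _ e2'); apply: filterS => k hk.
have id : mu.-integrable Omega (EFin \o (fun x => eta x - eta' x)).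
  by have := integrableB mO ie ie'; apply: eq_integrable.
have -> : \int[mu]_(x in Omega) (F_ k x * eta x) =
    \int[mu]_(x in Omega) (F_ k x * eta' x) + \int[mu]_(x in Omega) (F_ k x * (eta x - eta' x)).
  rewrite -RintegralD//; try exact: iM.
  by apply: eq_Rintegral => x _; rewrite -mulrDr addrC subrK.
rewrite (splitr e); apply: le_trans (ler_normD _ _) _; apply: lerD => //.
apply: le_trans (le_normr_Rintegral mO (iM k id)) _.
apply: (@le_trans _ _ (\int[mu]_(x in Omega) (M * `|eta x - eta' x|))).
  apply: le_Rintegral => //.
  - by have := integrable_norm (iM k id).
  - by have := integrableZl mO M (integrable_norm id); apply: eq_integrable.
  - by move=> x _; rewrite normrM ler_wpM2r.
rewrite RintegralZl//; last exact: integrable_norm.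
have -> : e / 2 = (M + 1) * (e / 2 / (M + 1)) by field; rewrite gt_eqF.
apply: ler_pM => //; [by apply: Rintegral_ge0|by rewrite lerDl|].
rewrite -lee_fin /Rintegral fineK//; apply: integrable_fin_num => //; exact: integrable_norm.
Qed.

Lemma weak_nullD eta eta' : weak_null eta -> weak_null eta' -> weak_null (fun x => eta x + eta' x).
Proof.
move=> [ie We] [ie' We']; split.
  by have := integrableD mO ie ie'; apply: eq_integrable.
rewrite -[X in _ --> X]addr0.
rewrite (_ : (fun k => _) = fun k => (\int[mu]_(x in Omega) (F_ k x * eta x)) +
   (\int[mu]_(x in Omega) (F_ k x * eta' x))); first exact: cvgD.
apply/funext => k; rewrite -RintegralD//; try exact: iM.
by apply: eq_Rintegral => x _; rewrite mulrDr.
Qed.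

Lemma weak_nullZ r eta : weak_null eta -> weak_null (fun x => r * eta x).
Proof.
move=> [ie We]; split.
  by have := integrableZl mO r ie; apply: eq_integrable.
rewrite -[X in _ --> X](mulr0 r).
rewrite (_ : (fun k => _) = fun k => r * (\int[mu]_(x in Omega) (F_ k x * eta x))); first exact: cvgMl_tmp.
apply/funext => k; rewrite -RintegralZl//; try exact: iM.
by apply: eq_Rintegral => x _; rewrite mulrCA.
Qed.

Lemma weak_null0 : weak_null (fun=> 0).
Proof.
split; first exact: integrable0.
rewrite (_ : (fun k => _) = cst 0); first exact: cvg_cst.
by apply/funext => k; rewrite /Rintegral integral0_eq// => x _; rewrite mulr0.
Qed.

Hypothesis FC1 : forall psi, C1_c Omega psi ->
  (\int[mu]_(x in Omega) (F_ k x * psi x))%R @[k --> \oo] --> (0 : R).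

Let bint (f : Ln -> R) : measurable_fun setT f -> (forall x, 0 <= f x <= 1) -> mu.-integrable Omega (EFin \o f).
Proof.
move=> mf f01; apply: measurable_bounded_integrable => //; first exact: measurable_funTS.
exists 1; split; first exact: num_real.
by move=> K K1 x _; have /andP[h0 h1] := f01 x; rewrite /= ger0_norm// (le_trans h1)// ltW.
Qed.

Let indic01 (E : set Ln) x : 0 <= (\1_E x : R) <= 1.
Proof. by rewrite indicE; case: (_ \in _); rewrite ?lexx ?ler01. Qed.

Lemma weak_null_open U : open U -> U `<=` Omega -> weak_null (\1_U).
Proof.
move=> oU UO; have [f [fC fc f01 fcv]] := open_indicator_approx oU.
have mU : measurable (U : set Ln) by exact: open_leb_measurable.
have mi : measurable_fun setT (\1_U : Ln -> R) by exact: measurable_indic.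
have mf k : measurable_fun setT (f k : Ln -> R) by exact: continuous_leb_measurable.
apply: weak_null_closed => [|e e0]; first exact: bint.
have [|||||_ + _] := @dominated_convergence _ _ _ mu Omega mO
  (fun k x => (f k x)%:E) (fun x => (\1_U x)%:E) (fun=> 1%E).
- by move=> k; apply: measurable_funTS; exact/measurable_EFinP.
- by apply: measurable_funTS; exact/measurable_EFinP.
- apply: aeW => x _; apply/fine_cvgP; split; first exact: nearW.
  exact: fcv.
- by apply: (@bint (fun=> 1)) => // x; rewrite ler01 lexx.
- apply: aeW => x k _ /=; rewrite lee_fin.
  by have /andP[h1 h2] := f01 k x; rewrite ger0_norm.
move/fine_cvgP => [+ /cvgr0Pnorm_le/(_ _ e0)].
move=> h1 h2; have [k [fk ke]] := filter_ex (filterI h1 h2).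
exists (f k).
  split; first exact: bint.
  by apply: FC1; exact: C1_c_sub (fC k).
rewrite (_ : (\int[mu]_(x in Omega) `|(\1_U x - f k x)%:E|)%E =
  (\int[mu]_(x in Omega) `|(f k x)%:E - (\1_U x)%:E|)%E); last first.
  by apply: eq_integral => x _; rewrite -EFinB !abse_EFin distrC.
exact: fine_norm_le fk ke.
Qed.

Lemma weak_null_indic (E : set Ln) : measurable E -> E `<=` Omega -> weak_null (\1_E).
Proof.
move=> mE EO; apply: weak_null_closed => [|e e0]; first by apply: bint => //; exact: measurable_indic.
have Efin : (mu E < +oo)%E by apply: le_lt_trans fO; exact: le_lebesgue_outer.
have [U [oU EU UO Ud]] := leb_outer_regular mE oO EO Efin e0.
exists (\1_U); first exact: weak_null_open.
have mU : measurable U by exact: open_leb_measurable.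
have mUE : measurable (U `\` E) by exact: measurableD.
rewrite (_ : (\int[mu]_(x in Omega) _)%E = (\int[mu]_(x in Omega) (\1_(U `\` E) x)%:E)%E).
  by rewrite integral_indic// setIidl; [exact: ltW|apply: subset_trans UO; exact: subDsetl].
apply: eq_integral => x _; rewrite abse_EFin; congr EFin; rewrite !indicE in_setD.
have [/set_mem/EU/mem_set ->|] := boolP (x \in E); first by rewrite subrr normr0.
by case: (x \in U) => /=; rewrite sub0r normrN ?normr1 ?normr0.
Qed.

Lemma weak_null_integrable eta : mu.-integrable Omega (EFin \o eta) -> weak_null eta.
Proof.
move=> ie; apply: weak_null_closed => // e e0.
have [g [ig _]] := approximation_sfun_integrable mO ie.
move=> /fine_cvgP[h1 /cvgr0Pnorm_le/(_ _ e0) h2].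
have [k [fk ke]] := filter_ex (filterI h1 h2).
exists (g k); last exact: fine_norm_le fk ke.
split; first exact: ig.
have W (s : seq R) : weak_null (fun x => \sum_(r <- s) r * \1_(Omega `&` g k @^-1` [set r]) x).
  elim: s => [|r s IH].
    by rewrite (_ : (fun _ => _) = fun=> 0); [exact: weak_null0|apply/funext => x; rewrite big_nil].
  rewrite (_ : (fun _ => _) = fun x => r * \1_(Omega `&` g k @^-1` [set r]) x +
     \sum_(r <- s) r * \1_(Omega `&` g k @^-1` [set r]) x); last first.
    by apply/funext => x; rewrite big_cons.
  apply: weak_nullD => //; apply: weak_nullZ; apply: weak_null_indic; last by move=> x [].
  by apply: measurableI => //; exact: measurable_funPTI.
have [_] := W (finmap.enum_fset (fset_set (range (g k)))).
apply: cvg_trans; apply: near_eq_cvg; apply: nearW => i.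
apply: eq_Rintegral => x xO; congr (_ * _).
rewrite [RHS]fimfunE fsbig_finite//=; apply: eq_bigr => r _; congr (_ * _).
by rewrite !indicE in_setI xO.
Qed.

End weak_null.

End density.

(** * Mollification *)

Section mollification.
Context {R : realType} {n : nat}.
Notation Rn := 'rV[R]_n.+1.
Notation Ln := (leb_space R n).
Notation mu := (@leb R n).
Implicit Types (F G : Rn -> R) (U : set Rn) (j : 'I_n.+1).

Lemma line_quotE F j (x : Rn) (t : R) :
  (fun h : R => h^-1 *: (((fun s : R => F (s *: 'e_j + x)) \o shift t) (h *: 1) - F (t *: 'e_j + x))) =
  (fun h : R => h^-1 *: ((F \o shift (t *: 'e_j + x)) (h *: 'e_j) - F (t *: 'e_j + x))).
Proof.
apply/funext => h /=; rewrite addrA -scalerDl; congr (_ *: (F (_ *: _ + _) - _)).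
by rewrite [_ *: 1]mulr1.
Qed.

Lemma is_derive_line F j (x : Rn) (t : R) : derivable F (t *: 'e_j + x) 'e_j ->
  is_derive t 1 (fun s : R => F (s *: 'e_j + x)) (partial j F (t *: 'e_j + x)).
Proof.
move=> dF; split; first by rewrite /derivable line_quotE; exact: dF.
by rewrite /derive line_quotE.
Qed.

Lemma derive1_is_derive (g : R -> R) (x D : R) :
  derivable g x 1 -> g^`()%classic x = D -> is_derive x (1 : R) g D.
Proof. by move=> dg <-; split => //; rewrite derive1E. Qed.

Lemma is_derive_line0 F j (x : Rn) (D : R) :
  is_derive (0 : R) (1 : R) (fun s : R => F (s *: 'e_j + x)) D ->
  is_derive x ('e_j : Rn) F D.
Proof.
have E : (0 : R) *: 'e_j + x = x by rewrite scale0r add0r.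
move=> [d1 d2]; split.
  by move: d1; rewrite /derivable line_quotE E.
by move: d2; rewrite /derive line_quotE E.
Qed.

(** The points [z k] change [y] into [x] one coordinate at a time; each of the [n + 1] moves is a
    one-variable mean value estimate. *)
Lemma C1_lip F (M : R) : C1 F -> (forall j x, `|partial j F x| <= M) -> lip F.
Proof.
move=> [dF _] FM; exists (M *+ n.+1) => x y.
pose z k : Rn := \row_i (if (i < k)%N then x 0 i else y 0 i).
have zx : z n.+1 = x by apply/rowP => i; rewrite mxE ltn_ord.
have zy : z 0%N = y by apply/rowP => i; rewrite mxE.
have step (k : 'I_n.+1) : `|F (z k.+1) - F (z k)| <= M * `|x - y|.
  have zk : z k.+1 = (x 0 k - y 0 k) *: 'e_k + z k.
    apply/rowP => i; rewrite !mxE eqxx/= ltnS leq_eqVlt.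
    have [->|ik] := eqVneq i k; first by rewrite eqxx ltnn/= mulr1 subrK.
    by rewrite (inj_eq val_inj) (negbTE ik)/= mulr0 add0r.
  pose g (s : R) := F (s *: 'e_k + z k).
  have dg (s : R) : is_derive s 1 g (partial k F (s *: 'e_k + z k)) by exact: is_derive_line.
  have cg : continuous g by move=> s; apply: differentiable_continuous; apply/derivable1_diffP; have [] := dg s.
  have M0 : 0 <= M by apply: le_trans (FM 0 0).
  have bound a b : a <= b -> `|g b - g a| <= M * (b - a).
    move=> ab; have [c _ ->] := MVT_segment ab (fun s _ => dg s) (continuous_subspaceT cg).
    by rewrite normrM [X in _ * X <= _]ger0_norm ?subr_ge0// ler_wpM2r ?subr_ge0.
  have -> : F (z k) = g 0 by rewrite /g scale0r add0r.
  rewrite zk -/(g _); set d := x 0 k - y 0 k.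
  have xyd : `|d| <= `|x - y| by have := coord_le_norm (x - y) k; rewrite !mxE.
  apply: (@le_trans _ _ (M * `|d|)); last by rewrite ler_wpM2l.
  have [d0|/ltW d0] := leP 0 d; first by rewrite (ger0_norm d0); have := bound _ _ d0; rewrite subr0.
  by rewrite (ler0_norm d0) distrC; have := bound _ _ d0; rewrite sub0r.
rewrite -{1}zx -{1}zy.
have -> : F (z n.+1) - F (z 0%N) = \sum_(k < n.+1) (F (z k.+1) - F (z k)).
  by rewrite -(telescope_sumr (fun k => F (z k)) (leq0n n.+1)) big_mkord.
apply: le_trans (ler_norm_sum _ _ _) _; rewrite mulrnAl.
apply: le_trans (ler_sum _ (fun k _ => step k)) _.
by rewrite sumr_const card_ord.
Qed.

Lemma continuous_csupp_bounded Omega F G : continuous G -> compact_support_in Omega F ->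
  (forall x, ~ closure [set x | F x != 0] x -> G x = 0) -> exists2 M, 0 <= M & forall x, `|G x| <= M.
Proof.
move=> cG [cS _] G0; have : compact (G @` closure [set x | F x != 0]).
  by apply: continuous_compact => //; exact: continuous_subspaceT.
move=> /compact_bounded[M [_ HM]]; exists (`|M| + 1) => // x.
have [Sx|/G0 ->] := pselect (closure [set x | F x != 0] x); last by rewrite normr0.
by apply: (HM (`|M| + 1)); [rewrite ltr_pwDr// ler_norm|exists x].
Qed.

Lemma partial_out_supp F j x : ~ closure [set x | F x != 0] x -> partial j F x = 0.
Proof.
move=> Sx; rewrite /partial (near_eq_derive (g := cst 0)) ?derive_cst//.
have : nbhs x (~` closure [set x | F x != 0]).
  by apply: open_nbhs_nbhs; split => //; apply: closed_openC; exact: closed_closure.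
by apply: filterS => y Sy; apply/eqP/negPn/negP => Fy; apply: Sy; exact: subset_closure.
Qed.

Lemma C1_c_partial_bounded Omega F : C1_c Omega F -> exists2 M, 0 <= M & forall j x, `|partial j F x| <= M.
Proof.
move=> [dF cF sF].
have H j : {M | 0 <= M /\ forall x, `|partial j F x| <= M}.
  apply: cid; have [M M0 HM] := continuous_csupp_bounded (cF j) sF (fun x => @partial_out_supp F j x).
  by exists M.
exists (\sum_j sval (H j)); first by apply: sumr_ge0 => j _; case: (H j) => M [].
move=> j x; apply: (@le_trans _ _ (sval (H j))); first by case: (H j) => M [_] /=.
rewrite (bigD1 j)//= lerDl; apply: sumr_ge0 => i _; by case: (H i) => M [].
Qed.

Lemma C1_c_lipschitz Omega F : C1_c Omega F -> lipschitz_c Omega F.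
Proof.
move=> CF; have [M _ FM] := C1_c_partial_bounded CF.
have [dF cF sF] := CF; apply/lipschitz_cP; split => //.
by apply: (@C1_lip F M) => //; split.
Qed.

Lemma box_integrable (G : Ln -> R) (M K : R) : measurable_fun setT G -> (forall x, `|G x| <= K) ->
  (forall x, G x != 0 -> box (const_mx (- M), const_mx M) x) -> mu.-integrable setT (EFin \o G).
Proof.
move=> mG GK G0; pose Bx := box (const_mx (- M), const_mx M) : set Ln.
have mB : measurable Bx by exact: box_measurable.
have -> : EFin \o G = (EFin \o G) \_ Bx.
  apply/funext => x; rewrite /patch; case: ifPn => //; rewrite notin_setE => H /=.
  by congr EFin; apply/eqP/negPn/negP => /G0.
have iB : mu.-integrable Bx (EFin \o G).
  apply: measurable_bounded_integrable => //; [exact: leb_box_fin|exact: measurable_funTS|].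
  exists K; split; first exact: num_real.
  by move=> K' KK' x _; apply: le_trans (GK x) (ltW KK').
exact: (iffLR (integrable_mkcond (mu := mu) (EFin \o G) mB) iB).
Qed.

(** Countably many rational translates of the box cover the space. Read backwards, it gives the
    mollification kernel a positive integral as soon as the whole space is not null. *)
Lemma obox_null (e : R) : 0 < e -> mu (obox (const_mx (- e)) (const_mx e)) = 0%E -> mu setT = 0%E.
Proof.
move=> e0 O0; pose O := obox (const_mx (- e)) (const_mx e) : set Ln.
pose a k : Rn := if @unpickle 'rV[rat]_n.+1 k is Some q then map_mx ratr q else 0.
apply/eqP; rewrite eq_le measure_ge0 andbT.
apply: (@le_trans _ _ (\sum_(k <oo) mu (shift_leb (a k) @^-1` O))%E).
  apply: measure_sigma_subadditive => //.
    move=> k; rewrite -[X in measurable X]setTI; apply: measurable_shift_leb => //.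
    exact: open_box_measurable.
  move=> x _; have H i : {q : rat | `|(x : Rn) 0 i + ratr q| < e}.
    apply: cid; have [|q] := @rat_in_itvoo R (- (x : Rn) 0 i - e) (- (x : Rn) 0 i + e).
      by rewrite ltrD2l; lra.
    by rewrite in_itv/= => /andP[h1 h2]; exists q; rewrite ltr_norml; apply/andP; split; lra.
  exists (pickle (\row_i sval (H i))) => // i.
  rewrite /shift_leb /a pickleK !mxE; case: (H i) => q /=.
  by rewrite ltr_norml.
by rewrite eseries0// => k _ _; rewrite leb_shift.
Qed.

Lemma compact_open_dist (K U : set Rn) : compact K -> open U -> K `<=` U ->
  exists2 e : R, 0 < e & forall x y, K x -> `|x - y| < e -> U y.
Proof.
move=> /compact_near_coveringP cK oU KU.
have H x : K x -> \forall x' \near x & e \near (0 : R)^'+, forall y : Rn, `|x' - y| < e -> U y.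
  move=> /KU Ux; have /nbhs_ballP[d /= d0 dU] := oU _ Ux.
  exists (ball x (d / 2), [set e | 0 < e < d / 2]) => /=.
    split; first by apply: nbhsx_ballx; rewrite divr_gt0.
    by near=> e; apply/andP; split => //; near: e; apply: nbhs_right_lt; rewrite divr_gt0.
  move=> [x' e] /= [+ /andP[e0 ed]] y xy; rewrite -ball_normE /ball_/= => xx'.
  apply: dU; rewrite -ball_normE /ball_/= -(subrK x' x) -addrA (le_lt_trans (ler_normD _ _))//.
  by rewrite (splitr d) ltrD// (lt_trans xy).
have h : \forall e \near (0 : R)^'+, K `<=` (fun x => forall y : Rn, `|x - y| < e -> U y).
  by apply: cK.
have h0 : \forall e \near (0 : R)^'+, 0 < e by exact: nbhs_right_gt.
have /filter_ex[e [e0 eP]] : \forall e \near (0 : R)^'+, 0 < e /\ K `<=` (fun x => forall y : Rn, `|x - y| < e -> U y).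
  exact: filterI h0 h.
by exists e => // x y Kx; apply: eP.
Unshelve. all: by end_near. Qed.

Section mollifier.
Variable e : R.
Hypotheses (e0 : 0 < e) (muT : mu setT != 0%E).

Let K := bumpf (const_mx (- e)) (const_mx e) : Rn -> R.

Let CK : C1 K. Proof. by have [] := C1_bumpf (const_mx (- e) : Rn) (const_mx e). Qed.
Let kK : continuous K. Proof. by have [] := C1_bumpf (const_mx (- e) : Rn) (const_mx e). Qed.
Let K0 x : 0 <= K x. Proof. exact: bumpf_ge0. Qed.

Let K_supp x : K x != 0 -> `|x| <= e.
Proof.
move=> Kx; have /bumpf_gt0 H : 0 < K x by rewrite lt0r Kx K0.
apply: norm_le_coord; first exact: ltW.
by move=> i; have := H i; rewrite !mxE ler_norml => /andP[/ltW-> /ltW->].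
Qed.

Let norm_box (x : Rn) d : `|x| <= d -> box (const_mx (- (d + 1)), const_mx (d + 1)) x.
Proof.
move=> xe i; rewrite in_itv/= !mxE.
have := le_trans (coord_le_norm x i) xe; rewrite ler_norml => /andP[h1 h2].
by apply/andP; split; [rewrite (lt_le_trans _ h1)// ltrN2 ltrDl|rewrite (le_trans h2)// lerDl].
Qed.

Let K_cl : closure [set x | K x != 0] `<=` [set x : Rn | `|x| <= e].
Proof.
have cl : closed [set x : Rn | `|x| <= e].
  by rewrite -[X in closed X]/(Num.norm @^-1` [set r | r <= e]); apply: closed_comp => [x _|];
    [exact: norm_continuous|exact: closed_le].
by move=> x /(closure_subset K_supp); rewrite -((closure_id _).1 cl).
Qed.

Let K_cs : compact_support_in setT K.
Proof.
split => //; apply: bounded_closed_compact; last exact: closed_closure.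
by exists e; split; [exact: num_real|move=> M /ltW eM x /K_cl/= /le_trans; apply].
Qed.

Let CKc : C1_c setT K. Proof. by have [d c] := CK; split. Qed.

Let mK : measurable_fun setT (K : Ln -> R). Proof. exact: continuous_leb_measurable. Qed.

Let ker_int (G H : Rn -> R) (M M' : R) y : continuous G -> continuous H ->
  (forall x, `|G x| <= M) -> (forall x, `|H x| <= M') -> (forall x, H x != 0 -> `|x| <= e) ->
  mu.-integrable setT (EFin \o (fun x : Ln => G x * H ((x : Rn) - y))).
Proof.
move=> cG cH GM HM Hs.
apply: (@box_integrable _ (e + `|y| + 1) (M * M')).
- apply: continuous_leb_measurable; apply: ctsM => // x.
  apply: (@continuous_comp _ _ _ (fun x : Rn => x - y) H); last exact: cH.
  by apply: (@continuousB R Rn Rn id (cst y)); [exact: cvg_id|exact: cst_continuous].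
- by move=> x; rewrite normrM; apply: ler_pM.
- move=> x; rewrite mulf_eq0 negb_or => /andP[_ /Hs xy]; apply: norm_box.
  by rewrite -[X in `|X|](subrK y) (le_trans (ler_normD _ _))// lerD2r.
Qed.

Let c := \int[mu]_z K z.

Let iK : mu.-integrable setT (EFin \o (K : Ln -> R)).
Proof.
have [M _ KM] := csupp_bounded kK K_cs.
have := @ker_int (fun=> 1) K 1 M 0 (@cts_cst _ _ _) kK _ KM K_supp.
rewrite (_ : (fun x : Ln => _) = K); last by apply/funext => x; rewrite mul1r subr0.
by apply => x; rewrite normr1.
Qed.

(** Otherwise the kernel vanishes almost everywhere, so the open box where it is positive is null,
    and with it the whole space, against [muT]. *)
Let c_gt0 : 0 < c.
Proof.
rewrite lt0r; apply/andP; split; last by apply: Rintegral_ge0.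
apply: contra muT => /eqP c0; apply/eqP; apply: (obox_null e0).
have Kint : (\int[mu]_z `|(K z)%:E| = 0)%E.
  rewrite -[RHS]/(0%:E) -c0 /c /Rintegral fineK; last exact: integrable_fin_num iK.
  by apply: eq_integral => x _; rewrite abse_EFin ger0_norm.
have /(ae_eq_integral_abs _ measurableT) : measurable_fun setT (EFin \o (K : Ln -> R)).
  exact/measurable_EFinP.
move=> /(_ mu) [+ _] => /(_ Kint)[N [mN N0 HN]].
apply/eqP; rewrite eq_le measure_ge0 andbT -N0; apply: le_measure; rewrite ?inE//.
  exact: open_box_measurable.
move=> x /bumpf_gt0 Kx; apply: HN => /= /(_ I) [] /eqP; apply/negP.
exact: lt0r_neq0.
Qed.

(** Convolution with the bump on []-e, e[^n], divided by its integral. With the shift on [F], the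
    Lipschitz constant of [F] is inherited at once; for derivatives the shift is moved onto the
    kernel. *)
Definition mollify (F : Rn -> R) (x : Rn) : R := c^-1 * \int[mu]_z (F (z + x) * K z).

Variables (F : Rn -> R) (L M : R).
Hypotheses (L0 : 0 <= L) (FL : forall x y, `|F x - F y| <= L * `|x - y|) (FM : forall x, `|F x| <= M).

Let cF : continuous F. Proof. exact: lip_continuous FL. Qed.

Let shift_int (G H : Rn -> R) (B B' : R) y : continuous G -> continuous H ->
  (forall x, `|G x| <= B) -> (forall x, `|H x| <= B') -> (forall x, H x != 0 -> `|x| <= e) ->
  mu.-integrable setT (EFin \o (fun z : Ln => G (z + y) * H z)) /\
  \int[mu]_z (G (z + y) * H z) = \int[mu]_x (G x * H ((x : Rn) - y)).
Proof.
move=> cG cH GB HB Hs; split.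
  have cG' : continuous (fun z : Rn => G (z + y)).
    move=> x; apply: (@continuous_comp _ _ _ (fun x : Rn => x + y) G); last exact: cG.
    by apply: (@continuousD R Rn Rn id (cst y)); [exact: cvg_id|exact: cst_continuous].
  have := @ker_int (fun z => G (z + y)) H B B' 0 cG' cH (fun x => GB _) HB Hs.
  by rewrite (_ : (fun x : Ln => _) = (fun z : Ln => G (z + y) * H z))//; apply/funext => x; rewrite subr0.
rewrite /Rintegral; congr fine.
rewrite -[RHS](@integral_shift _ _ y (EFin \o (fun x : Ln => G x * H ((x : Rn) - y)))).
  by apply: eq_integral => x _; rewrite /shift_leb /= addrK.
by have := @ker_int G H B B' y cG cH GB HB Hs; exact: measurable_int.
Qed.

Let KB : exists B, forall x, `|K x| <= B.
Proof. by have [B _ HB] := csupp_bounded kK K_cs; exists B. Qed.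

Let iFK x : mu.-integrable setT (EFin \o (fun z : Ln => F (z + x) * K z)).
Proof. by have [B HB] := KB; have [] := shift_int x cF kK FM HB K_supp. Qed.

Lemma mollify_lip x y : `|mollify F x - mollify F y| <= L * `|x - y|.
Proof.
rewrite /mollify -mulrBr -RintegralB// normrM gtr0_norm ?invr_gt0//.
rewrite ler_pdivrMl// -mulrC.
have iB : mu.-integrable setT (EFin \o (fun z : Ln => F (z + x) * K z - F (z + y) * K z)).
  by have := integrableB measurableT (iFK x) (iFK y); apply: eq_integrable.
apply: le_trans (le_normr_Rintegral measurableT iB) _.
rewrite /c -RintegralZl//; apply: le_Rintegral => //.
- exact: integrable_norm.
- exact: integrableZl iK.
- move=> z _; rewrite -mulrBl normrM [X in _ * X]ger0_norm//.
  apply: ler_wpM2r => //; apply: le_trans (FL _ _) _.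
  by rewrite opprD addrACA subrr add0r.
Qed.

Lemma mollify_dist x : `|mollify F x - F x| <= L * e.
Proof.
have -> : F x = c^-1 * \int[mu]_z (F x * K z).
  by rewrite RintegralZl// mulrCA -/c mulVf ?mulr1// gt_eqF.
have iZ : mu.-integrable setT (EFin \o (fun z : Ln => F x * K z)) by exact: integrableZl iK.
rewrite /mollify -mulrBr -RintegralB// normrM gtr0_norm ?invr_gt0//.
rewrite ler_pdivrMl// -mulrC.
have iB : mu.-integrable setT (EFin \o (fun z : Ln => F (z + x) * K z - F x * K z)).
  by have := integrableB measurableT (iFK x) iZ; apply: eq_integrable.
apply: le_trans (le_normr_Rintegral measurableT iB) _.
rewrite /c -RintegralZl//; apply: le_Rintegral => //.
- exact: integrable_norm.
- exact: integrableZl iK.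
- move=> z _; rewrite -mulrBl normrM [X in _ * X]ger0_norm//.
  have [->|/K_supp ze] := eqVneq (K z) 0; first by rewrite !mulr0.
  apply: ler_wpM2r => //; apply: le_trans (FL _ _) _.
  by rewrite addrK ler_wpM2l.
Qed.

Lemma mollify_supp x : mollify F x != 0 -> exists2 z, F z != 0 & `|z - x| <= e.
Proof.
move=> mx; apply: contrapT => /forall2NP H; move/eqP: mx; apply.
rewrite /mollify /Rintegral integral0_eq ?mulr0// => z _.
have [->|/K_supp ze] := eqVneq (K z) 0; first by rewrite mulr0.
have [/negP|] := H ((z : Rn) + x); last by rewrite addrK.
by rewrite negbK => /eqP ->; rewrite mul0r.
Qed.

Let dK j : forall x, partial j K x != 0 -> `|x| <= e.
Proof.
move=> x; apply: contra_neqP => /negP; rewrite -ltNge => xe.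
have := @partial_out_supp K j x; apply => /K_cl.
by rewrite /= leNgt xe.
Qed.

(** A translation of the variable moves [x] into the C^1 factor [K (y - x)], and the integral is
    differentiated along the line in direction [j]. The minus sign comes from the minus in
    [y - x]. *)
Lemma mollify_derive j x :
  is_derive x ('e_j : Rn) (mollify F) (- c^-1 * \int[mu]_z (F (z + x) * partial j K z)).
Proof.
apply: is_derive_line0.
have [B B0 HB] := C1_c_partial_bounded CKc.
have [BK HBK] := KB.
pose f (s : R) (y : Ln) : R := F y * K ((y : Rn) - (s *: 'e_j + x)).
have fE s : mollify F (s *: 'e_j + x) = c^-1 * \int[mu]_y f s y.
  by rewrite /mollify; have [_ ->] := shift_int (s *: 'e_j + x) cF kK FM HBK K_supp.
have df (s : R) (y : Ln) : is_derive s (1 : R) (f ^~ y) (F y * - partial j K ((y : Rn) - (s *: 'e_j + x))).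
  have lineE (t : R) : (y : Rn) - (t *: 'e_j + x) = (- t) *: 'e_j + ((y : Rn) - x).
    by rewrite scaleNr opprD addrCA.
  have dK' : is_derive (- s) (1 : R) (fun t : R => K (t *: 'e_j + ((y : Rn) - x)))
      (partial j K ((- s) *: 'e_j + ((y : Rn) - x))).
    by apply: is_derive_line; have [h _] := CK; exact: h.
  have dN : is_derive s (1 : R) (-%R : R -> R) (-1) by apply: is_derive_eq.
  have dc := @is_derive1_comp _ _ _ _ _ _ dK' dN.
  have -> : f ^~ y = F y \*o ((fun t : R => K (t *: 'e_j + ((y : Rn) - x))) \o -%R).
    by apply/funext => t; rewrite /f /= lineE.
  by apply: is_derive_eq; rewrite lineE mulrN1.
have If s : mu.-integrable setT (EFin \o f s).
  by exact: (ker_int _ cF kK FM HBK K_supp).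
(* For [|s| < 1] the kernel centred at [s e_j + x] lives in the ball of radius [D], so one bounded
   box dominates all the derivatives. *)
pose D := e + `|x| + 1.
have D0 : 0 <= D by rewrite !addr_ge0// ltW.
pose BD := box (const_mx (- (D + 1)), const_mx (D + 1)) : set Ln.
have mBD : measurable BD by exact: box_measurable.
have M0 : 0 <= M by apply: le_trans (FM 0).
have iG : mu.-integrable setT (EFin \o (fun y : Ln => M * B * \1_BD y)).
  apply: (@box_integrable _ (D + 1) (M * B)).
  - by apply: measurable_funM => //; exact: measurable_indic.
  - by move=> y; rewrite ger0_norm ?mulr_ge0// ler_piMr ?mulr_ge0// indicE; case: (_ \in _).
  - by move=> y; rewrite mulf_eq0 negb_or indicE => /andP[_]; case: (boolP (y \in BD)) => [/set_mem//|]; rewrite eqxx.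
have d1f (s : R) (y : Ln) : partial1of2 f s y = F y * - partial j K ((y : Rn) - (s *: 'e_j + x)).
  by rewrite partial1of2E; have /@derive_val := df s y.
have Gub (s : R) (y : Ln) : [set` `](-1 : R), 1[] s -> setT y -> `|partial1of2 f s y| <= M * B * \1_BD y.
  rewrite /= in_itv/= => /andP[s1 s2] _; rewrite d1f.
  have [->|/dK yK] := eqVneq (partial j K ((y : Rn) - (s *: 'e_j + x))) 0.
    by rewrite oppr0 mulr0 normr0 !mulr_ge0// indicE; case: (_ \in _).
  rewrite normrM normrN indicE mem_set ?mulr1; first exact: ler_pM.
  apply: norm_box; rewrite -[X in `|X|](subrK (s *: 'e_j + x) y).
  apply: le_trans (ler_normD _ _) _; rewrite /D -addrA; apply: lerD => //.
  apply: le_trans (ler_normD _ _) _; rewrite [leLHS]addrC lerD2l normrZ.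
  apply: mulr_ile1 => //; first by rewrite ler_norml (ltW s1) (ltW s2).
  by apply: norm_le_coord => // i; rewrite mxE; case: eqP => _; case: eqP => _; rewrite ?normr1 ?normr0.
have I0 : [set` `](-1 : R), 1[] (0 : R) by rewrite /= in_itv/=; apply/andP; split; lra.
have G0 (y : Ln) : 0 <= M * B * \1_BD y by rewrite !mulr_ge0// indicE; case: (_ \in _).
have dd (s : R) (y : Ln) : [set` `](-1 : R), 1[] s -> setT y -> derivable (f ^~ y) s 1.
  by move=> _ _; have [] := df s y.
have E1 := @derivable_under_integral R _ Ln mu f setT measurableT 0 (-1) 1 I0
  (fun s _ => If s) dd (fun y => M * B * \1_BD y) G0 iG Gub.
have E2 := @differentiation_under_integral R _ Ln mu f setT measurableT 0 (-1) 1 I0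
  (fun s _ => If s) dd (fun y => M * B * \1_BD y) G0 iG Gub.
have E3 : is_derive (0 : R) (1 : R) (fun s => \int[mu]_y f s y) (\int[mu]_y partial1of2 f 0 y).
  exact: derive1_is_derive E1 E2.
have -> : (fun s : R => mollify F (s *: 'e_j + x)) = c^-1 \*o (fun s => \int[mu]_y f s y).
  by apply/funext => s; rewrite fE.
apply: is_derive_eq; rewrite mulNr -mulrN; congr (_ * _).
have [h1 ->] := shift_int x cF (CK.2 j) FM (HB j) (@dK j).
rewrite -mulN1r -RintegralZl//; last exact: (ker_int x cF (CK.2 j) FM (HB j) (@dK j)).
by apply: eq_Rintegral => y _; rewrite d1f scale0r add0r mulN1r mulrN.
Qed.

Lemma mollify_C1 : C1 (mollify F).
Proof.
have [B B0 HB] := C1_c_partial_bounded CKc.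
split=> j; first by move=> x; have [] := mollify_derive j x.
have E x : partial j (mollify F) x = - c^-1 * \int[mu]_z (F (z + x) * partial j K z).
  by rewrite /partial; have /@derive_val := mollify_derive j x.
have idK : mu.-integrable setT (EFin \o (partial j K : Ln -> R)).
  have := @ker_int (fun=> 1) (partial j K) 1 B 0 (@cts_cst _ _ _) (CK.2 j) _ (HB j) (@dK j).
  rewrite (_ : (fun x : Ln => _) = partial j K); last by apply/funext => x; rewrite mul1r subr0.
  by apply => x; rewrite normr1.
have iFdK x : mu.-integrable setT (EFin \o (fun z : Ln => F (z + x) * partial j K z)).
  by have [] := shift_int x cF (CK.2 j) FM (HB j) (@dK j).
apply: (@lip_continuous _ _ _ (c^-1 * (L * \int[mu]_z `|partial j K z|))) => x y.
have H : `|\int[mu]_z (F (z + x) * partial j K z) - \int[mu]_z (F (z + y) * partial j K z)| <=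
    L * `|x - y| * \int[mu]_z `|partial j K z|.
  have iB : mu.-integrable setT (EFin \o (fun z : Ln => F (z + x) * partial j K z - F (z + y) * partial j K z)).
    by have := integrableB measurableT (iFdK x) (iFdK y); apply: eq_integrable.
  rewrite -RintegralB//; apply: le_trans (le_normr_Rintegral measurableT iB) _.
  rewrite -RintegralZl//; last exact: integrable_norm.
  apply: le_Rintegral => //; first exact: integrable_norm.
    by have := integrableZl measurableT (L * `|x - y|) (integrable_norm idK); apply: eq_integrable.
  move=> z _; rewrite -mulrBl normrM; apply: ler_wpM2r => //; apply: le_trans (FL _ _) _.
  by rewrite opprD addrACA subrr add0r.
have cg : 0 < c^-1 by rewrite invr_gt0.
rewrite !E -mulrBr normrM normrN (gtr0_norm cg).
apply: (le_trans (ler_wpM2l _ H)); first exact: ltW.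
by rewrite -!mulrA [`|x - y| * _]mulrC.
Qed.

End mollifier.

(** What matters is the uniformity: mollification keeps the Lipschitz constant of [F] and moves it
    by at most [L] times the radius. Radii below a third of the distance [e0] keep the supports in
    [Omega]. *)
Lemma lipschitz_c_approx (Omega : set Rn) F : mu setT != 0%E -> open Omega -> lipschitz_c Omega F ->
  exists2 L : R, 0 <= L & exists f : nat -> Rn -> R, forall k,
    [/\ C1_c Omega (f k), forall x y, `|f k x - f k y| <= L * `|x - y| &
        forall x, `|f k x - F x| <= L * k.+1%:R^-1].
Proof.
move=> muT oO /lipschitz_cP[lipF csF]; have [L0' FL] := lipF.
have [L L0 FL'] : exists2 L : R, 0 <= L & forall x y, `|F x - F y| <= L * `|x - y|.
  exists `|L0'| => // x y; apply: le_trans (FL x y) _; by rewrite ler_wpM2r// ler_norm.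
have [M _ FM] := csupp_bounded (lip_continuousW lipF) csF.
have [cS SO] := csF; have [e0 e00 He0] := compact_open_dist cS oO SO.
exists L => //.
suff H (d : R) : 0 < d -> d <= e0 / 3 -> C1_c Omega (mollify d F) .
  pose d (k : nat) := Num.min (e0 / 3) k.+1%:R^-1.
  have d0 k : 0 < d k by rewrite lt_min divr_gt0//= invr_gt0.
  exists (fun k => mollify (d k) F) => k; split.
  - by apply: H => //; rewrite ge_min lexx.
  - by move=> x y; exact: (mollify_lip (d0 k) muT FL' FM).
  - move=> x; apply: le_trans (mollify_dist (d0 k) muT L0 FL' FM x) _.
    by rewrite ler_wpM2l// ge_min lexx orbT.
move=> d0 de; have [dm cm] := mollify_C1 d0 muT FL' FM.
(* Passing from the closure to a point of nonvanishing costs less than [e0 / 3], the kernel at most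
   another [e0 / 3]; the sum stays below [e0]. *)
have near_supp x : closure [set x | mollify d F x != 0] x -> exists2 z, closure [set x | F x != 0] z & `|z - x| < e0.
  move=> /(_ (ball x (e0 / 3))) [|y [/= my]]; first by apply: nbhsx_ballx; rewrite divr_gt0.
  rewrite -ball_normE /= => xy; have [z Fz zy] := mollify_supp d0 my.
  exists z; first exact: subset_closure.
  rewrite -(subrK y z) -addrA (le_lt_trans (ler_normD _ _))// -[ltRHS](@subrK _ (e0 / 3)) (le_lt_trans (lerD zy (lexx _)))//.
  by rewrite distrC ler_ltD//; lra.
split => //; split; last by move=> x /near_supp[z Sz]; apply: He0.
apply: bounded_closed_compact; last exact: closed_closure.
have /compact_bounded[A [Ar HA]] := cS.
exists (`|A| + 1 + e0); split; first exact: num_real.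
move=> A' AA' x /near_supp[z Sz zx].
have := HA (`|A| + 1) _ z Sz; rewrite ltr_pwDr ?ler_norm// => /(_ isT) zA.
rewrite /= -(subrKC z x) (le_trans (ler_normD _ _))// (le_trans _ (ltW AA'))// lerD// distrC; exact: ltW.
Qed.

End mollification.

(** * A-gradients of integrable functions *)

Section agrad.
Context {R : realType} {n : nat}.
Notation Rn := 'rV[R]_n.+1.
Notation Ln := (leb_space R n).
Notation mu := (@leb R n).
Notation vec := 'cV[R]_n.+1.
Notation mat := 'M[R]_n.+1.
Variable Omega : set Rn.
Hypotheses (oO : open Omega) (bO : bounded_set Omega).
Notation L1 f := (mu.-integrable (Omega : set Ln) (EFin \o (f : Ln -> R))).
Implicit Types (F G f v : Rn -> R) (j : 'I_n.+1).

Let mO : measurable (Omega : set Ln). Proof. exact: open_leb_measurable. Qed.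
Let fO : (mu Omega < +oo)%E. Proof. exact: leb_bounded_fin. Qed.

Lemma ae_inP (P : Rn -> Prop) : (forall x, Omega x -> P x) -> ae_in Omega P.
Proof. by move=> H; apply: aeW => x /H. Qed.

Lemma ae_inS (P Q : Rn -> Prop) : (forall x, Omega x -> P x -> Q x) -> ae_in Omega P -> ae_in Omega Q.
Proof. by move=> H; rewrite /ae_in => HP; apply: filterS HP => x Px Ox; exact: H (Px Ox). Qed.

Lemma ae_inS2 (P Q S : Rn -> Prop) : (forall x, Omega x -> P x -> Q x -> S x) ->
  ae_in Omega P -> ae_in Omega Q -> ae_in Omega S.
Proof. by move=> H; rewrite /ae_in => HP HQ; apply: filterS2 HP HQ => x Px Qx Ox; exact: H (Px Ox) (Qx Ox). Qed.

Lemma ae_in_forall (I : finType) (P : I -> Rn -> Prop) : (forall i, ae_in Omega (P i)) ->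
  ae_in Omega (fun x => forall i, P i x).
Proof.
move=> H; suff S (s : seq I) : ae_in Omega (fun x => forall i, i \in s -> P i x).
  by apply: ae_inS (S (enum I)) => x _ Hx i; apply: Hx; rewrite mem_enum.
elim: s => [|i s IH]; first exact: ae_inP.
apply: ae_inS2 IH (H i) => x _ Hx Px k; rewrite in_cons => /orP[/eqP ->//|]; exact: Hx.
Qed.

Lemma ae_in_nat (P : nat -> Rn -> Prop) : (forall i, ae_in Omega (P i)) ->
  ae_in Omega (fun x => forall i, P i x).
Proof.
move=> H; have := ae_foralln H.
by apply: filterS => x Hx Ox i; exact: Hx.
Qed.

Lemma Rintegral_ae_eq (f g : Ln -> R) : L1 f -> L1 g -> ae_in Omega (fun x => f x = g x) ->
  \int[mu]_(x in Omega) f x = \int[mu]_(x in Omega) g x.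
Proof.
move=> fi gi fg; rewrite /Rintegral; congr fine; apply: ae_eq_integral => //.
- exact: measurable_int fi.
- exact: measurable_int gi.
- by move: fg; rewrite /ae_in; apply: filterS => x H /H /= ->.
Qed.

Lemma L1_meas f : L1 f -> measurable_in Omega f.
Proof. by move=> /measurable_int/measurable_EFinP. Qed.

Lemma L1_bounded f (M : R) : measurable_in Omega f -> (forall x, Omega x -> `|f x| <= M) -> L1 f.
Proof.
move=> mf fM; apply: measurable_bounded_integrable => //.
exists M; split; first exact: num_real.
by move=> K MK x Ox; apply: le_trans (fM _ Ox) (ltW MK).
Qed.

Lemma L1_mul f g (M : R) : L1 f -> measurable_in Omega g -> (forall x, Omega x -> `|g x| <= M) ->
  L1 (fun x => f x * g x).
Proof. by move=> fi mg gM; exact: (integrable_bounded_mul mO fi mg gM). Qed.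

Lemma L1D f g : L1 f -> L1 g -> L1 (fun x => f x + g x).
Proof. by move=> fi gi; have := integrableD mO fi gi; apply: eq_integrable. Qed.

Lemma L1B f g : L1 f -> L1 g -> L1 (fun x => f x - g x).
Proof. by move=> fi gi; have := integrableB mO fi gi; apply: eq_integrable. Qed.

Lemma L1Z (c : R) f : L1 f -> L1 (fun x => c * f x).
Proof. by move=> fi; have := integrableZl mO c fi; apply: eq_integrable. Qed.

Lemma L1_sum (I : finType) (f : I -> Rn -> R) : (forall i, L1 (f i)) -> L1 (fun x => \sum_i f i x).
Proof.
move=> H; have := integrable_sum mO (index_enum I) (P := predT) (fun i _ => H i).
by apply: eq_integrable => // x _; rewrite sumEFin.
Qed.

Lemma L1_norm f : L1 f -> L1 (fun x => `|f x|).
Proof. by move=> fi; have := integrable_norm fi. Qed.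

Lemma L1_cst (c : R) : L1 (fun=> c).
Proof. by apply: (@L1_bounded _ `|c|) => //; exact: measurable_cst. Qed.

Lemma norm_Rintegral_le f (h : Rn -> R) : L1 f -> L1 h -> (forall x, Omega x -> `|f x| <= h x) ->
  `|\int[mu]_(x in Omega) f x| <= \int[mu]_(x in Omega) h x.
Proof.
move=> fi hi H; apply: le_trans (le_normr_Rintegral mO fi) _.
by apply: le_Rintegral => //; exact: L1_norm.
Qed.

Lemma lipcW F : lipschitz_c Omega F -> lip F.
Proof. by move=> /lipschitz_cP[]. Qed.

Lemma lipc_bounded F : lipschitz_c Omega F -> exists2 M : R, 0 <= M & forall x, `|F x| <= M.
Proof.
by move=> /lipschitz_cP[lF cF]; have [M M0 H] := csupp_bounded (lip_continuousW lF) cF; exists M.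
Qed.

Lemma lipc_meas F : lipschitz_c Omega F -> measurable_in Omega F.
Proof. by move=> /lipcW/lip_measurable; exact: measurable_funTS. Qed.

Lemma lipc_out F x : lipschitz_c Omega F -> ~ Omega x -> F x = 0.
Proof. by move=> /lipschitz_cP[_]; exact: csupp_out. Qed.

Lemma lipc_L1 F : lipschitz_c Omega F -> L1 F.
Proof.
by move=> lF; have [M _ FM] := lipc_bounded lF; apply: (L1_bounded (lipc_meas lF)).
Qed.

Lemma lip_partial_bounded F : lip F -> exists2 M : R, 0 <= M & forall j x, `|partial j F x| <= M.
Proof. by move=> /lip_ge0[L L0 FL]; exists L => // j x; exact: partial_bound FL. Qed.

Lemma partial_meas F j : lip F -> measurable_in Omega (partial j F).
Proof. by move=> lF; apply: measurable_funTS; exact: partial_measurable. Qed.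

Lemma partial_L1 F j : lip F -> L1 (partial j F).
Proof.
by move=> lF; have [M _ FM] := lip_partial_bounded lF; apply: (L1_bounded (partial_meas j lF)).
Qed.

Lemma lipcM F G : lipschitz_c Omega F -> lipschitz_c Omega G -> lipschitz_c Omega (fun x => F x * G x).
Proof.
move=> lF lG; have [M M0 FM] := lipc_bounded lF; have [N N0 GN] := lipc_bounded lG.
move: lF lG => /lipschitz_cP[lF cF] /lipschitz_cP[lG cG]; apply/lipschitz_cP; split; last exact: csuppM.
apply: (@lipM _ _ _ _ (M + N)) => // x; first by rewrite (le_trans (FM x))// lerDl.
by rewrite (le_trans (GN x))// lerDr.
Qed.

Lemma lipcZ (c : R) F : lipschitz_c Omega F -> lipschitz_c Omega (fun x => c * F x).
Proof.
move=> /lipschitz_cP[[L FL] cF]; apply/lipschitz_cP; split; last exact: csuppM.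
by exists (`|c| * L) => x y; rewrite -mulrBr normrM -mulrA ler_wpM2l.
Qed.

Lemma lip_derivable_ae F j : lip F -> {ae mu, forall x : Ln, derivable F (x : Rn) 'e_j}.
Proof. by move=> [L FL]; exact: lip_partial_ae FL. Qed.

Lemma partialM_ae F G j : lip F -> lip G ->
  ae_in Omega (fun x => partial j (fun y => F y * G y) x = F x * partial j G x + G x * partial j F x).
Proof.
move=> lF lG; apply: filterS2 (lip_derivable_ae j lF) (lip_derivable_ae j lG) => x dF dG _.
by rewrite /partial deriveM.
Qed.

Lemma Rintegral_partial0 F j : lipschitz_c Omega F -> \int[mu]_(x in Omega) partial j F x = 0.
Proof.
move=> /lipschitz_cP[lF cF]; have [M HM] := csupp_box cF.
have := integral_partial0 j lF HM; rewrite /Rintegral integral_mkcond.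
rewrite -[X in _ -> fine X = _](_ : (\int[mu]_x (partial j F x)%:E)%E = _) => [->//|].
apply: eq_integral => x _; rewrite /patch; case: ifPn => //; rewrite notin_setE => Ox.
by rewrite (partial_out _ cF Ox).
Qed.

Lemma ibp F G j : lipschitz_c Omega F -> lipschitz_c Omega G ->
  \int[mu]_(x in Omega) (partial j F x * G x) = - \int[mu]_(x in Omega) (F x * partial j G x).
Proof.
move=> lF lG; have [M _ FM] := lipc_bounded lF; have [N _ GN] := lipc_bounded lG.
have i1 : L1 (fun x => partial j F x * G x).
  by apply: (L1_mul (M := N)) => //; [exact/partial_L1/lipcW|exact: lipc_meas].
have i2 : L1 (fun x => F x * partial j G x).
  have [N' _ GN'] := lip_partial_bounded (lipcW lG).
  by apply: (L1_mul (M := N')) => //; [exact: lipc_L1|exact/partial_meas/lipcW].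
apply/eqP; rewrite -addr_eq0 -RintegralD//.
rewrite -(Rintegral_partial0 j (lipcM lF lG)); apply/eqP; apply: Rintegral_ae_eq.
- exact: L1D.
- exact/partial_L1/lipcW/lipcM.
- by apply: ae_inS (partialM_ae j (lipcW lF) (lipcW lG)) => x _ ->; rewrite addrC (mulrC (G x)).
Qed.

Lemma lipschitz_on_measurable (f : Rn -> R) (M : R) : (forall x y, Omega x -> Omega y -> `|f x - f y| <= M * `|x - y|) ->
  measurable_in Omega f.
Proof.
move=> fM; apply: (measurability _ (RGenOpens.measurableE R)) => //.
move=> _ [_ [a [b ->]] <-]; apply: open_leb_measurable; rewrite openE => x [Ox fx].
have : nbhs (f x) [set` `]a, b[] by apply: open_nbhs_nbhs; split => //; exact: interval_open.
move=> /nbhs_ballP[e /= e0 He]; have := oO Ox => /nbhs_ballP[d /= d0 Hd].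
have M1 : 0 < `|M| + 1 by rewrite ltr_wpDl.
apply/nbhs_ballP; exists (Num.min d (e / (`|M| + 1))) => /=; first by rewrite lt_min d0 divr_gt0.
move=> y /= xy; have Oy : Omega y by apply: Hd; apply: le_ball xy; rewrite ge_min lexx.
split => //; apply: He; rewrite /ball/=; apply: le_lt_trans (fM _ _ Ox Oy) _.
have : `|x - y| < e / (`|M| + 1).
  by move: xy; rewrite -ball_normE /= lt_min => /andP[].
rewrite ltr_pdivlMr// => H; apply: le_lt_trans H.
by rewrite mulrC ler_wpM2l// (le_trans (ler_norm M))// lerDl.
Qed.

End agrad.

Lemma mx_coord_le_norm {R : realType} {m n : nat} (A : 'M[R]_(m.+1, n.+1)) i j : `|A i j| <= `|A|.
Proof.
rewrite [leRHS]/Num.norm /= mx_normrE.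
have /mapP[k Hk ->] : `|A i j| \in [seq `|A y.1 y.2| | y : 'I_m.+1 * 'I_n.+1].
  by apply/mapP; exists (i, j) => //=; rewrite mem_enum.
by apply/bigmax_geP; right => /=; exists k.
Qed.

(** * A-gradients tested against Lipschitz functions *)

Section agrad2.
Context {R : realType} {n : nat}.
Notation Rn := 'rV[R]_n.+1.
Notation Ln := (leb_space R n).
Notation mu := (@leb R n).
Notation vec := 'cV[R]_n.+1.
Notation mat := 'M[R]_n.+1.
Variable Omega : set Rn.
Hypotheses (oO : open Omega) (bO : bounded_set Omega).
Variable B : Rn -> mat.
Hypothesis hB : [lipschitz B x | x in Omega].
Notation L1 f := (mu.-integrable (Omega : set Ln) (EFin \o (f : Ln -> R))).
Implicit Types (F G f v : Rn -> R) (j : 'I_n.+1) (q : Rn -> vec).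

Let mO : measurable (Omega : set Ln). Proof. exact: open_leb_measurable. Qed.

Lemma B_bounds : exists2 M : R, 0 <= M &
  forall i j, (forall x y, Omega x -> Omega y -> `|B x i j - B y i j| <= M * `|x - y|) /\
    forall x, Omega x -> `|B x i j| <= M.
Proof.
have [M M0 HM] : exists2 M : R, 0 <= M & forall x y, Omega x -> Omega y -> `|B x - B y| <= M * `|x - y|.
  move: hB => [M [Mr HM]]; exists (`|M| + 1) => // x y Ox Oy.
  by have := HM (`|M| + 1); rewrite ltr_pwDr ?ler_norm// => /(_ isT (x, y)); apply.
have [[x0 Ox0]|O0] := pselect (Omega !=set0); last first.
  by exists 0 => // i j; split => [x y Ox|x Ox]; exfalso; apply: O0; exists x.
move: bO => [A [Ar HA]]; set A' := `|A| + 1.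
have OA x : Omega x -> `|x| <= A' by apply: HA; rewrite /A' ltr_pwDr ?ler_norm.
have A0 : 0 <= A' by rewrite /A' addr_ge0.
have c0 : 0 <= M * (A' + A') + `|B x0| by apply: addr_ge0 => //; apply: mulr_ge0 => //; exact: addr_ge0.
exists (M + (M * (A' + A') + `|B x0|)); first exact: addr_ge0.
move=> i j; split=> [x y Ox Oy|x Ox].
  have := mx_coord_le_norm (B x - B y) i j; rewrite !mxE => /le_trans; apply.
  by apply: le_trans (HM _ _ Ox Oy) _; rewrite ler_wpM2r// lerDl.
apply: le_trans (mx_coord_le_norm _ _ _) _.
rewrite -(subrK (B x0) (B x)) (le_trans (ler_normD _ _))//.
apply: (@le_trans _ _ (M * (A' + A') + `|B x0|)); last by rewrite lerDr.
rewrite lerD2r; apply: le_trans (HM _ _ Ox Ox0) _; rewrite ler_wpM2l//.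
by apply: le_trans (ler_normB _ _) _; apply: lerD; exact: OA.
Qed.

(** [B] is controlled on [Omega] only. If one point lies outside, [F] vanishes there and the
    coefficient may be taken at the inner point. The constant is explicit so that it can be used
    uniformly along approximating sequences. *)
Lemma BF_lip (M L N : R) F i j : 
  (forall x y, Omega x -> Omega y -> `|B x i j - B y i j| <= M * `|x - y|) ->
  (forall x, Omega x -> `|B x i j| <= M) -> 0 <= M ->
  (forall x y, `|F x - F y| <= L * `|x - y|) -> (forall x, `|F x| <= N) -> (forall x, ~ Omega x -> F x = 0) ->
  forall x y, `|B x i j * F x - B y i j * F y| <= (M * N + M * L) * `|x - y|.
Proof.
move=> BM MB M0 FL FN F0.
have N0 : 0 <= N by apply: le_trans (FN 0).
have one x y : Omega x -> ~ Omega y -> `|B x i j * F x - B y i j * F y| <= (M * N + M * L) * `|x - y|.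
  move=> Ox Oy; rewrite (F0 _ Oy) mulr0 -(mulr0 (B x i j)) -mulrBr -(F0 _ Oy) normrM mulrDl.
  apply: (@le_trans _ _ (M * L * `|x - y|)); last by rewrite lerDr !mulr_ge0.
  by rewrite -mulrA; apply: ler_pM => //; exact: MB.
move=> x y; have [Ox|Ox] := pselect (Omega x); have [Oy|Oy] := pselect (Omega y).
- rewrite (_ : _ - _ = (B x i j - B y i j) * F x + B y i j * (F x - F y)); last by ring.
  rewrite [leRHS]mulrDl; apply: le_trans (ler_normD _ _) _; rewrite !normrM; apply: lerD.
    by rewrite mulrAC; apply: ler_pM => //; exact: BM.
  by rewrite -mulrA; apply: ler_pM => //; exact: MB.
- exact: one.
- by rewrite distrC [`|x - y|]distrC; exact: one.
- rewrite (F0 _ Ox) (F0 _ Oy) !mulr0 subrr normr0.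
  have [->|xy] := eqVneq `|x - y| 0; first by rewrite mulr0.
  have L0 : 0 <= L.
    have := le_trans (normr_ge0 _) (FL x y).
    by rewrite pmulr_lge0// lt0r xy /=.
  by rewrite mulr_ge0// addr_ge0// mulr_ge0.
Qed.

(** Minus the formal adjoint of the i-th component of [B nabla], which is [gradB] for Lipschitz
    functions. *)
Definition divB i F (x : Rn) : R := \sum_j partial j (fun y => B y i j * F y) x.
Definition gradB F (x : Rn) : vec := \col_i \sum_j B x i j * partial j F x.

Lemma lipcB F i j : lipschitz_c Omega F -> lipschitz_c Omega (fun y => B y i j * F y).
Proof.
move=> lF; have [M M0 HM] := B_bounds; have [L L0 FL] := lip_ge0 (lipcW lF).
have [N N0 FN] := lipc_bounded lF; have [B1 B2] := HM i j.
have H := BF_lip B1 B2 M0 FL FN (fun x => lipc_out lF).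
by apply/lipschitz_cP; split; [eexists; exact: H|apply: csuppM; have /lipschitz_cP[] := lF].
Qed.

Lemma B_meas i j : measurable_in Omega (fun x => B x i j).
Proof. by have [M _ /(_ i j)[H _]] := B_bounds; exact: (lipschitz_on_measurable oO H). Qed.

Lemma meas_sum (I : finType) (f : I -> Rn -> R) : (forall i, measurable_in Omega (f i)) ->
  measurable_in Omega (fun x => \sum_i f i x).
Proof. by move=> H; apply: measurable_sum. Qed.

Lemma Rintegral_fsum (I : finType) (f : I -> Rn -> R) : (forall i, L1 (f i)) ->
  \int[mu]_(x in Omega) (\sum_i f i x) = \sum_i \int[mu]_(x in Omega) f i x.
Proof.
move=> H; have E : (\int[mu]_(x in Omega) (\sum_i f i x)%:E = \sum_i (\int[mu]_(x in Omega) f i x)%R%:E)%E.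
  transitivity (\int[mu]_(x in Omega) (\sum_i (f i x)%:E))%E.
    by apply: eq_integral => x _; rewrite sumEFin.
  rewrite (integral_sum mO H); apply: eq_bigr => i _.
  by rewrite /Rintegral fineK//; exact: integrable_fin_num (H i).
by rewrite {1}/Rintegral E sumEFin.
Qed.

Lemma divB_meas i F : lipschitz_c Omega F -> measurable_in Omega (divB i F).
Proof. by move=> lF; apply: meas_sum => j; exact/partial_meas/lipcW/lipcB. Qed.

Lemma divB_bounded i F : lipschitz_c Omega F -> exists2 M : R, 0 <= M & forall x, `|divB i F x| <= M.
Proof.
move=> lF; have H j : {M : R | 0 <= M /\ forall x, `|partial j (fun y => B y i j * F y) x| <= M}.
  by apply: cid; have [M M0 HM] := lip_partial_bounded (lipcW (lipcB i j lF)); exists M.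
exists (\sum_j sval (H j)); first by apply: sumr_ge0 => j _; case: (H j) => ? [].
move=> x; apply: le_trans (ler_norm_sum _ _ _) _; apply: ler_sum => j _.
by case: (H j) => ? [_] /=.
Qed.

Lemma gradB_meas i F : lip F -> measurable_in Omega (fun x => gradB F x i 0).
Proof.
move=> lF; rewrite (_ : (fun x => _) = fun x => \sum_j B x i j * partial j F x); last first.
  by apply/funext => x; rewrite mxE.
by apply: meas_sum => j; apply: measurable_funM; [exact: B_meas|exact: partial_meas].
Qed.

Lemma gradB_bounded F : lip F -> exists2 M : R, 0 <= M & forall i x, Omega x -> `|gradB F x i 0| <= M.
Proof.
move=> lF; have [M M0 HM] := B_bounds; have [N N0 HN] := lip_partial_bounded lF.
exists (\sum_(j < n.+1) M * N); first by apply: sumr_ge0 => j _; exact: mulr_ge0.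
move=> i x Ox; rewrite mxE; apply: le_trans (ler_norm_sum _ _ _) _; apply: ler_sum => j _.
by rewrite normrM; apply: ler_pM => //; have [_] := HM i j; apply.
Qed.

Lemma gradB_L1 F i : lip F -> L1 (fun x => gradB F x i 0).
Proof.
by move=> lF; have [M _ HM] := gradB_bounded lF; apply: (L1_bounded oO bO (gradB_meas i lF)) => x; exact: HM.
Qed.

Lemma divB_L1 i F : lipschitz_c Omega F -> L1 (divB i F).
Proof.
by move=> lF; have [M _ HM] := divB_bounded i lF; apply: (L1_bounded oO bO (divB_meas i lF)) => x _; exact: HM.
Qed.

Lemma Rintegral_divB i F : lipschitz_c Omega F -> \int[mu]_(x in Omega) divB i F x = 0.
Proof.
move=> lF; have lB j := lipcB i j lF.
rewrite (@Rintegral_fsum _ (fun j => partial j (fun y => B y i j * F y))); last first.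
  by move=> j; exact: (partial_L1 oO bO j (lipcW (lB j))).
by apply: big1 => j _; exact: Rintegral_partial0.
Qed.

Lemma divBM_ae i F G : lipschitz_c Omega F -> lipschitz_c Omega G ->
  ae_in Omega (fun x => divB i (fun y => F y * G y) x = F x * divB i G x + G x * gradB F x i 0).
Proof.
move=> lF lG; have H j := partialM_ae Omega j (lipcW lF) (lipcW (lipcB i j lG)).
apply: ae_inS (ae_in_forall H) => x Ox E.
rewrite /divB mxE !mulr_sumr -big_split; apply: eq_bigr => j _ /=.
transitivity (partial j (fun y => F y * (B y i j * G y)) x).
  by congr (partial j _ x); apply/funext => y; ring.
by rewrite E; ring.
Qed.

Lemma gradB_comp_ae (T tau : R -> R) c F : quad_der T tau c -> lip F ->
  ae_in Omega (fun x => gradB (fun y => T (F y)) x = tau (F x) *: gradB F x).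
Proof.
move=> qT lF; have H j : ae_in Omega (fun x => partial j (fun y => T (F y)) x = tau (F x) * partial j F x).
  apply: filterS (lip_derivable_ae j lF) => x dF _.
  by have /@derive_val := quad_der_chain qT dF.
apply: ae_inS (ae_in_forall H) => x Ox E; apply/colP => i; rewrite !mxE mulr_sumr.
by apply: eq_bigr => j _; rewrite E mulrCA.
Qed.

(* The distributional A-gradient, tested against Lipschitz functions and not
   only against C^1 ones: products of [C1_c] functions with [B] or with the
   approximants of [W_0] functions are only Lipschitz. *)
Definition wgrad v q := [/\ L1 v, forall i, L1 (fun x => q x i 0) &
  forall F, lipschitz_c Omega F -> forall i,
    \int[mu]_(x in Omega) (q x i 0 * F x) = - \int[mu]_(x in Omega) (v x * divB i F x)].

Lemma L1_lipc f F : L1 f -> lipschitz_c Omega F -> L1 (fun x => f x * F x).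
Proof. by move=> fi lF; have [M _ FM] := lipc_bounded lF; apply: (L1_mul oO fi (lipc_meas lF) (M := M)). Qed.

Lemma L1_divB f F i : L1 f -> lipschitz_c Omega F -> L1 (fun x => f x * divB i F x).
Proof. by move=> fi lF; have [M _ FM] := divB_bounded i lF; apply: (L1_mul oO fi (divB_meas i lF) (M := M)). Qed.

Lemma L1_Lp_loc f : L1 f -> Lp_loc 1 Omega f.
Proof.
move=> fi; split; first exact: L1_meas fi.
move=> D cD DO; have mD : measurable (D : set Ln) by apply: closed_leb_measurable; apply: compact_closed => //; exact: norm_hausdorff.
have := integrableS mO mD DO fi; move=> /integrableP[_]; congr (_ < _)%E.
Qed.

Lemma wgrad_is_gradA v q : wgrad v q -> is_gradA Omega B v q.
Proof.
move=> [vi qi H]; split; [exact: L1_Lp_loc|by move=> i; exact: L1_Lp_loc|].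
move=> psi Cpsi i; have lp := C1_c_lipschitz Cpsi.
have i1 := L1_lipc (qi i) lp; have i2 := L1_divB i vi lp.
have f1 := integrable_fin_num mO i1; have f2 := integrable_fin_num mO i2.
have := H _ lp i; rewrite /Rintegral => E.
rewrite -(fineK f1) -[in RHS](fineK f2) -EFinN; congr EFin; exact: E.
Qed.

(** Almost everywhere [divB (F G) = F divB G + G gradB F], and the integral of [divB] of a compactly
    supported Lipschitz function is 0. *)
Lemma wgrad_lip F : lipschitz_c Omega F -> wgrad F (gradB F).
Proof.
move=> lF; split; [exact: lipc_L1|by move=> i; exact: gradB_L1 (lipcW lF)|].
move=> G lG i; apply/eqP; rewrite -addr_eq0 -RintegralD//; first last.
- by apply: L1_divB => //; exact: lipc_L1.
- by apply: L1_lipc => //; exact: gradB_L1 (lipcW lF).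
have lFG := lipcM lF lG.
rewrite (@Rintegral_ae_eq _ _ _ oO _ (divB i (fun y => F y * G y))); first last.
- by apply: ae_inS (divBM_ae i lF lG) => x _ ->; rewrite addrC [G x * _]mulrC.
- exact: divB_L1.
- apply: L1D => //; first by apply: L1_lipc => //; exact: gradB_L1 (lipcW lF).
  by apply: L1_divB => //; exact: lipc_L1.
by rewrite Rintegral_divB.
Qed.

Lemma wgrad_cst (c : R) : wgrad (fun=> c) (fun=> 0).
Proof.
split; [exact: L1_cst|by move=> i; rewrite (_ : (fun x => _) = fun=> 0);[exact: L1_cst|apply/funext => x; rewrite mxE]|].
move=> F lF i; rewrite [X in - X]RintegralZl//; last exact: divB_L1.
rewrite Rintegral_divB// mulr0 oppr0.
by rewrite /Rintegral integral0_eq// => x _; rewrite mxE mul0r.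
Qed.

Lemma wgradB v q v' q' : wgrad v q -> wgrad v' q' -> wgrad (fun x => v x - v' x) (fun x => q x - q' x).
Proof.
move=> [vi qi H] [vi' qi' H']; split; first exact: L1B.
  move=> i; rewrite (_ : (fun x => _) = fun x => q x i 0 - q' x i 0); first exact: L1B.
  by apply/funext => x; rewrite !mxE.
move=> F lF i.
have -> : \int[mu]_(x in Omega) ((q x - q' x) i 0 * F x) =
   \int[mu]_(x in Omega) (q x i 0 * F x) - \int[mu]_(x in Omega) (q' x i 0 * F x).
  rewrite -RintegralB//; [|exact: L1_lipc..].
  by apply: eq_Rintegral => x _; rewrite !mxE mulrBl.
rewrite H// H'// -opprD; congr (- _); rewrite -RintegralB//; [|exact: L1_divB..].
by apply: eq_Rintegral => x _; rewrite mulrBl.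
Qed.

(** The function [F * G] is again an admissible test function because Lipschitz functions of compact
    support are closed under products; testing [q] against it and expanding [divB] gives the Leibniz
    rule. *)
Lemma wgrad_mul_lip v q F : wgrad v q -> lipschitz_c Omega F ->
  wgrad (fun x => v x * F x) (fun x => F x *: q x + v x *: gradB F x).
Proof.
move=> [vi qi H] lF; have [M _ HM] := gradB_bounded (lipcW lF).
have vg i : L1 (fun x => v x * gradB F x i 0).
  by apply: (L1_mul oO vi (gradB_meas i (lipcW lF)) (M := M)) => x; exact: HM.
split; first exact: L1_lipc.
  move=> i; rewrite (_ : (fun x => _) = fun x => q x i 0 * F x + v x * gradB F x i 0).
    by apply: L1D => //; exact: L1_lipc.
  by apply/funext => x; rewrite [LHS]mxE [X in X + _]mxE [X in _ + X]mxE mulrC.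
move=> G lG i; have lFG := lipcM lF lG.
have E1 : \int[mu]_(x in Omega) ((F x *: q x + v x *: gradB F x) i 0 * G x) =
   \int[mu]_(x in Omega) (q x i 0 * (F x * G x)) + \int[mu]_(x in Omega) (v x * gradB F x i 0 * G x).
  rewrite -RintegralD//; [|exact: L1_lipc..].
  by apply: eq_Rintegral => x _; rewrite [X in X * _]mxE [X in (X + _) * _]mxE [X in (_ + X) * _]mxE; ring.
rewrite E1 H//.
apply/eqP; rewrite addrC -subr_eq0 opprK -addrA addrCA addrC subr_eq0 -RintegralD//; [|exact: L1_lipc|by apply: L1_divB => //; exact: L1_lipc].
apply/eqP; apply: Rintegral_ae_eq => //.
- by apply: L1D => //; [exact: L1_lipc|by apply: L1_divB => //; exact: L1_lipc].
- exact: L1_divB.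
- by apply: ae_inS (divBM_ae i lF lG) => x _ ->; ring.
Qed.

(** The difference of the two is an A-gradient of 0, to which the fundamental lemma applies
    coordinate by coordinate. *)
Lemma wgrad_uniq v q q' : wgrad v q -> wgrad v q' -> ae_in Omega (fun x => q x = q' x).
Proof.
move=> H H'; have [_ di D] := wgradB H H'.
have E i : ae_in Omega (fun x => (q x - q' x) i 0 = 0).
  apply: (fundamental_lemma_of_variations oO bO (di i)) => psi Cpsi; have lp := C1_c_lipschitz Cpsi.
  have i1 := L1_lipc (di i) lp.
  have := D _ lp i; rewrite [X in _ = - X](_ : _ = 0); last first.
    by rewrite /Rintegral integral0_eq// => x _; rewrite subrr mul0r.
  rewrite oppr0 /Rintegral => E; have f1 := integrable_fin_num mO i1.
  by rewrite -(fineK f1); congr EFin.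
apply: ae_inS (ae_in_forall E) => x _ Hx; apply/eqP; rewrite -subr_eq0; apply/eqP/colP => i.
by rewrite Hx mxE.
Qed.

End agrad2.

Lemma cvg0_harmonic {R : realType} (a : nat -> R) (c : R) : (forall k, `|a k| <= c / k.+1%:R) -> a k @[k --> \oo] --> (0 : R).
Proof.
move=> H; apply/cvgr0Pnorm_le => e e0.
have /cvgr0Pnorm_le/(_ _ e0) : (c * k.+1%:R^-1 : R) @[k --> \oo] --> (0 : R).
  by rewrite -[X in _ --> X](mulr0 c); apply: cvgMl_tmp; exact: cvg_harmonic.
apply: filterS => k; apply: le_trans; apply: le_trans (H k) _; exact: ler_norm.
Qed.

Lemma young_eps {R : realType} (a b e : R) : 0 < e -> `|a * b| <= e * b ^+ 2 + e^-1 * a ^+ 2.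
Proof.
move=> e0; rewrite normrM -(real_normK (num_real a)) -(real_normK (num_real b)).
set x := `|a|; set y := `|b|.
have x0 : 0 <= x by exact: normr_ge0. have y0 : 0 <= y by exact: normr_ge0.
have -> : e * y ^+ 2 + e^-1 * x ^+ 2 = e^-1 * ((e * y - x) ^+ 2) + 2 * (x * y).
  by field; rewrite gt_eqF.
have h1 : 0 <= e^-1 * (e * y - x) ^+ 2 by rewrite mulr_ge0 ?sqr_ge0// invr_ge0 ltW.
have h2 : 0 <= x * y by rewrite mulr_ge0.
lra.
Qed.

(** * L^1 and L^2 convergence, and stability of A-gradients under limits *)

Section agrad3.
Context {R : realType} {n : nat}.
Notation Rn := 'rV[R]_n.+1.
Notation Ln := (leb_space R n).
Notation mu := (@leb R n).
Notation vec := 'cV[R]_n.+1.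
Notation mat := 'M[R]_n.+1.
Variable Omega : set Rn.
Hypotheses (oO : open Omega) (bO : bounded_set Omega).
Notation L1 f := (mu.-integrable (Omega : set Ln) (EFin \o (f : Ln -> R))).
Implicit Types (F G f v w : Rn -> R) (j : 'I_n.+1) (q : Rn -> vec).

Let mO : measurable (Omega : set Ln). Proof. exact: open_leb_measurable. Qed.

Definition L2 f := measurable_in Omega f /\ L1 (fun x => f x ^+ 2).

Lemma L2_mul f v : L2 f -> L2 v -> L1 (fun x => f x * v x).
Proof.
move=> [mf fi] [mv vi]; apply: (@le_integrable _ _ _ _ _ mO _ (fun x => (v x ^+ 2 + f x ^+ 2)%:E)).
- by apply/measurable_EFinP; exact: measurable_funM.
- move=> x _ /=; rewrite lee_fin; apply: le_trans (young_eps (f x) (v x) ltr01) _.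
  by rewrite invr1 !mul1r ler_norm.
- exact: L1D.
Qed.

Lemma L2_bounded f (M : R) : measurable_in Omega f -> (forall x, Omega x -> `|f x| <= M) -> L2 f.
Proof.
move=> mf fM; split => //; apply: (@L1_bounded _ _ _ oO bO _ (M ^+ 2)); first exact: measurable_funX.
move=> x Ox; rewrite normrX; have := fM x Ox => H; rewrite ler_sqr ?nnegrE//.
exact: le_trans (normr_ge0 _) H.
Qed.

Lemma L2_L1 f : L2 f -> L1 f.
Proof.
move=> fi; have c1 : L2 (fun=> 1) by apply: (@L2_bounded _ 1) => [|x _]; [exact: measurable_cst|rewrite normr1].
by have := L2_mul fi c1; apply: eq_integrable => // x _ /=; rewrite mulr1.
Qed.

Lemma L2D f v : L2 f -> L2 v -> L2 (fun x => f x + v x).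
Proof.
move=> fi vi; have fv := L2_mul fi vi; move: fi vi => [mf fi] [mv vi]; split; first exact: measurable_funD.
have := L1D oO (L1Z oO 2 fv) (L1D oO fi vi); apply: eq_integrable => // x _ /=; congr EFin; ring.
Qed.

Lemma L2M f v (M : R) : L2 f -> measurable_in Omega v -> (forall x, Omega x -> `|v x| <= M) -> L2 (fun x => f x * v x).
Proof.
move=> [mf fi] mv vM; split; first exact: measurable_funM.
have := @L1_mul _ _ _ oO _ (fun x => v x ^+ 2) (M ^+ 2) fi.
rewrite (_ : (fun x => (f x * v x) ^+ 2) = fun x => f x ^+ 2 * v x ^+ 2); last by apply/funext => x; rewrite exprMn.
apply; first exact: measurable_funX.
move=> x Ox; rewrite normrX; have := vM x Ox => H; rewrite ler_sqr ?nnegrE//.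
exact: le_trans (normr_ge0 _) H.
Qed.

Lemma L2Z (c : R) f : L2 f -> L2 (fun x => c * f x).
Proof.
move=> fi; rewrite (_ : (fun x => _) = fun x => f x * c); last by apply/funext => x; rewrite mulrC.
by apply: (L2M (M := `|c|)) => //; exact: measurable_cst.
Qed.

Lemma L2B f v : L2 f -> L2 v -> L2 (fun x => f x - v x).
Proof.
move=> fi vi; rewrite (_ : (fun x => _) = fun x => f x + -1 * v x); last by apply/funext => x; rewrite mulN1r.
by apply: L2D => //; exact: L2Z.
Qed.

Definition L1cvg (f_ : nat -> Rn -> R) f := [/\ forall k, L1 (f_ k), L1 f &
  \int[mu]_(x in Omega) `|f_ k x - f x| @[k --> \oo] --> (0 : R)].

Definition L2cvg (f_ : nat -> Rn -> R) f := [/\ forall k, L2 (f_ k), L2 f &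
  \int[mu]_(x in Omega) (f_ k x - f x) ^+ 2 @[k --> \oo] --> (0 : R)].

Lemma L1cvg_le (f_ : nat -> Rn -> R) f (b : nat -> R) : (forall k, L1 (f_ k)) -> L1 f ->
  (forall k, \int[mu]_(x in Omega) `|f_ k x - f x| <= b k) -> b k @[k --> \oo] --> (0 : R) -> L1cvg f_ f.
Proof.
move=> h1 h2 H b0; split => //; apply: (squeeze_cvgr _ (cvg_cst 0) b0).
by apply: nearW => k; rewrite H andbT; exact: Rintegral_ge0.
Qed.

Lemma L1cvg_mul (f_ : nat -> Rn -> R) f v (M : R) : L1cvg f_ f -> measurable_in Omega v -> (forall x, Omega x -> `|v x| <= M) ->
  L1cvg (fun k x => f_ k x * v x) (fun x => f x * v x).
Proof.
move=> [fk fi H] mv vM; apply: (@L1cvg_le _ _ (fun k => M * \int[mu]_(x in Omega) `|f_ k x - f x|)).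
- by move=> k; exact: (L1_mul oO (fk k) mv vM).
- exact: (L1_mul oO fi mv vM).
- move=> k; have i := L1B oO (fk k) fi.
  rewrite -RintegralZl//; last exact: L1_norm.
  apply: le_Rintegral => //.
  + by apply: L1_norm; apply: L1B => //; exact: (L1_mul oO _ mv vM).
  + exact/(L1Z oO)/L1_norm.
  + by move=> x Ox; rewrite -mulrBl normrM mulrC ler_wpM2r// vM.
- by rewrite -[X in _ --> X](mulr0 M); exact: cvgMl_tmp.
Qed.

Lemma L1cvg_Rintegral (f_ : nat -> Rn -> R) f : L1cvg f_ f -> \int[mu]_(x in Omega) f_ k x @[k --> \oo] --> \int[mu]_(x in Omega) f x.
Proof.
move=> [fk fi H]; apply/cvgrPdist_le => e e0; move/cvgr0Pnorm_le: H => /(_ _ e0).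
apply: filterS => k; apply: le_trans; rewrite -RintegralB// [leRHS]ger0_norm; last exact: Rintegral_ge0.
apply: norm_Rintegral_le => //; first exact: L1B.
  by apply: L1_norm; exact: L1B.
by move=> x _; rewrite distrC.
Qed.

Lemma L1cvgD (f_ : nat -> Rn -> R) f (g_ : nat -> Rn -> R) (g : Rn -> R) : L1cvg f_ f -> L1cvg g_ g -> L1cvg (fun k x => f_ k x + g_ k x) (fun x => f x + g x).
Proof.
move=> [fk fi H] [gk gi H']; apply: (L1cvg_le _ _ _ (b := fun k => (\int[mu]_(x in Omega) `|f_ k x - f x|) + \int[mu]_(x in Omega) `|g_ k x - g x|)).
- by move=> k; exact: L1D.
- exact: L1D.
- move=> k; have i1 := L1_norm (L1B oO (fk k) fi); have i2 := L1_norm (L1B oO (gk k) gi).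
  rewrite -RintegralD//; apply: le_Rintegral => //.
  + by apply: L1_norm; apply: L1B => //; exact: L1D.
  + exact: L1D.
  + by move=> x _; rewrite opprD addrACA ler_normD.
- by rewrite -[X in _ --> X]addr0; exact: cvgD.
Qed.

(** Young's inequality with a weight [d] stands in for Cauchy-Schwarz: [d] is so small that [d]
    times the integral of [v^2] is below [e / 2], and then [k] so large that the other term is
    too. *)
Lemma L2cvg_mul (f_ : nat -> Rn -> R) f v : L2cvg f_ f -> L2 v -> L1cvg (fun k x => f_ k x * v x) (fun x => f x * v x).
Proof.
move=> [fk fi H] vi; split; [by move=> k; exact: L2_mul|exact: L2_mul|].
apply/cvgr0Pnorm_le => e e0; set V := \int[mu]_(x in Omega) v x ^+ 2.
have V0 : 0 <= V by apply: Rintegral_ge0 => x _; exact: sqr_ge0.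
have V1 : 0 < V + 1 by rewrite ltr_wpDl.
pose d := e / 2 / (V + 1); have d0 : 0 < d by rewrite !divr_gt0.
have ed : 0 < e / 2 * d by rewrite mulr_gt0// divr_gt0.
move/cvgr0Pnorm_le: H => /(_ _ ed); apply: filterS => k.
rewrite ger0_norm; last by apply: Rintegral_ge0 => x _; exact: sqr_ge0.
move=> Hk; rewrite ger0_norm; last exact: Rintegral_ge0.
have [_ si] := L2B (fk k) fi; have [_ v2] := vi.
apply: (@le_trans _ _ (\int[mu]_(x in Omega) (d * v x ^+ 2 + d^-1 * (f_ k x - f x) ^+ 2))).
  apply: le_Rintegral => //.
  - by apply: L1_norm; apply: L1B => //; exact: L2_mul.
  - by apply: L1D => //; exact: L1Z.
  - by move=> x _; rewrite -mulrBl; exact: young_eps.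
rewrite RintegralD//; [|exact: L1Z..]; rewrite !RintegralZl// -/V (splitr e); apply: lerD.
  have e2 : 0 <= e / 2 by rewrite divr_ge0// ltW.
  by rewrite /d -(mulrA (e / 2)); apply: ler_piMr => //; rewrite mulrC ler_pdivrMr// mul1r lerDl.
by rewrite mulrC ler_pdivrMr.
Qed.

Lemma L2cvg_L1cvg (f_ : nat -> Rn -> R) f : L2cvg f_ f -> L1cvg f_ f.
Proof.
move=> H; have c1 : L2 (fun=> 1) by apply: (@L2_bounded _ 1) => [|x _]; [exact: measurable_cst|rewrite normr1].
have := L2cvg_mul H c1; congr L1cvg; last by apply/funext => x; rewrite mulr1.
by apply/funext => k; apply/funext => x; rewrite mulr1.
Qed.

Variable B : Rn -> mat.
Hypothesis hB : [lipschitz B x | x in Omega].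
Notation wgrad := (wgrad Omega B).
Notation gradB := (gradB B).
Notation divB := (divB B).

(** A Lipschitz test function is approximated by C^1 ones with a common Lipschitz constant. Uniform
    convergence handles the side with [q]; on the side with [v] the derivatives converge only
    weakly, which is enough against a fixed integrable [v]. *)
Lemma is_gradA_wgrad v q : L1 v -> (forall i, L1 (fun x => q x i 0)) -> is_gradA Omega B v q -> wgrad v q.
Proof.
move=> vi qi [_ _ H]; split => // F lF i.
have iq := L1_lipc oO (qi i) lF; have iv := L1_divB oO bO hB i vi lF.
have [muT|muT] := eqVneq (mu setT) 0%E.
  have O0 : mu Omega = 0%E by apply/eqP; rewrite eq_le measure_ge0 andbT -muT; exact: le_lebesgue_outer.
  have ae0 (P : Rn -> Prop) : ae_in Omega P.
    by exists (Omega : set Ln); split => // x /= Hx; apply: contrapT => Ox; apply: Hx.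
  have z (f : Rn -> R) : L1 f -> \int[mu]_(x in Omega) f x = 0.
    move=> fi; have := Rintegral_ae_eq oO fi (L1_cst oO bO 0) (ae0 _) => ->.
    by rewrite /Rintegral integral0_eq.
  by rewrite !z// oppr0.
have [L L0 [f Hf]] := lipschitz_c_approx muT oO lF.
have lf k : lipschitz_c Omega (f k) by have [/C1_c_lipschitz] := Hf k.
have E k : \int[mu]_(x in Omega) (q x i 0 * f k x) = - \int[mu]_(x in Omega) (v x * divB i (f k) x).
  by have [/H/(_ i) + _ _] := Hf k; rewrite /Rintegral => ->; rewrite fineN.
have c1 : (\int[mu]_(x in Omega) (q x i 0 * (f k x - F x))) @[k --> \oo] --> (0 : R).
  apply: (@cvg0_harmonic _ _ (L * \int[mu]_(x in Omega) `|q x i 0|)) => k.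
  have m : measurable_in Omega (fun x => f k x - F x) by apply: measurable_funB; exact: lipc_meas.
  have [_ _ Hk] := Hf k.
  rewrite mulrAC -RintegralZl//; last exact: (L1_norm (qi i)).
  apply: norm_Rintegral_le => //.
  - exact: (L1_mul oO (qi i) m (fun x _ => Hk x)).
  - exact/(L1Z oO)/L1_norm.
  - by move=> x _; rewrite normrM mulrC ler_wpM2r.
(* The derivatives are bounded uniformly in [k]. Against a C^1 function, integration by parts turns
   their difference into [B] times the uniformly small [F - f k]; weak nullity extends this to
   [v]. *)
have c2 j : (\int[mu]_(x in Omega) ((partial j (fun y => B y i j * f k y) x - partial j (fun y => B y i j * F y) x) * v x))
    @[k --> \oo] --> (0 : R).
  have [M M0 HM] := B_bounds bO hB; have [B1 B2] := HM i j.
  have [L' L'0 FL] := lip_ge0 (lipcW lF); have [N N0 FN] := lipc_bounded lF.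
  have fN k x : `|f k x| <= N + L.
    have [_ _ /(_ x) Hk] := Hf k.
    rewrite -(subrK (F x) (f k x)) addrC; apply: le_trans (ler_normD _ _) _; apply: lerD => //.
    by apply: le_trans Hk _; rewrite ler_piMr// invf_le1// ler1n.
  have b1 k := BF_lip B1 B2 M0 (let: And3 _ h _ := Hf k in h) (fN k) (fun x => lipc_out (lf k)).
  have b2 := BF_lip B1 B2 M0 FL FN (fun x => lipc_out lF).
  have c1' : 0 <= M * (N + L) + M * L by rewrite addr_ge0// mulr_ge0// addr_ge0.
  have c2' : 0 <= M * N + M * L' by rewrite addr_ge0// mulr_ge0.
  have lB k : lipschitz_c Omega (fun y => B y i j * f k y) by exact: lipcB.
  have lBF : lipschitz_c Omega (fun y => B y i j * F y) by exact: lipcB.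
  apply: (weak_null_integrable oO bO (M := (M * (N + L) + M * L) + (M * N + M * L')) _ _ _ vi).2.
  - by move=> k; apply: measurable_funB; [exact: partial_meas (lipcW (lB k))|exact: partial_meas (lipcW lBF)].
  - move=> k x; apply: le_trans (ler_normB _ _) _; apply: lerD; [exact: partial_bound (b1 k)|exact: partial_bound b2].
  move=> psi /C1_c_lipschitz lp; have [P P0 HP] := lip_partial_bounded (lipcW lp).
  apply: (@cvg0_harmonic _ _ (\int[mu]_(x in Omega) (M * L * P))) => k.
  have [_ _ Hk] := Hf k.
  have mp : measurable_in Omega (partial j psi) by exact: partial_meas (lipcW lp).
  have E1 : \int[mu]_(x in Omega) ((partial j (fun y => B y i j * f k y) x - partial j (fun y => B y i j * F y) x) * psi x) =
     \int[mu]_(x in Omega) ((B x i j * F x - B x i j * f k x) * partial j psi x).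
    transitivity (\int[mu]_(x in Omega) (partial j (fun y => B y i j * f k y) x * psi x) -
      \int[mu]_(x in Omega) (partial j (fun y => B y i j * F y) x * psi x)).
      rewrite -RintegralB//; first by apply: eq_Rintegral => x _; rewrite mulrBl.
      - by apply: L1_lipc => //; exact: partial_L1 (lipcW (lB k)).
      - by apply: L1_lipc => //; exact: partial_L1 (lipcW lBF).
    rewrite !(ibp oO bO)// opprK addrC -RintegralB//; first by apply: eq_Rintegral => x _; rewrite mulrBl.
    - by apply: (L1_mul oO (lipc_L1 oO bO lBF) mp (M := P)).
    - by apply: (L1_mul oO (lipc_L1 oO bO (lB k)) mp (M := P)).
  rewrite E1 mulrC -RintegralZl//; last exact: L1_cst.
  apply: norm_Rintegral_le => //.
  - by apply: (L1_mul oO _ mp (M := P)) => //; apply: L1B => //; exact: lipc_L1.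
  - by apply: (L1Z oO); exact: L1_cst.
  - move=> x Ox; rewrite -mulrBr !normrM distrC.
    rewrite (_ : _^-1 * _ = M * (L / k.+1%:R) * P); last by ring.
    by apply: ler_pM => //; apply: ler_pM => //; exact: B2.
(* This tends to 0 term by term, while the identity [E] for the C^1 function [f k] shows that it
   does not depend on [k]. Its value, up to sign the defect of the identity for [F], is therefore
   0. *)
pose a k := \int[mu]_(x in Omega) (q x i 0 * (f k x - F x)) + \sum_j
  \int[mu]_(x in Omega) ((partial j (fun y => B y i j * f k y) x - partial j (fun y => B y i j * F y) x) * v x).
have a0 : a k @[k --> \oo] --> (0 : R).
  rewrite -[X in _ --> X]addr0; apply: cvgD => //.
  have : (\sum_(j < n.+1) \int[mu]_(x in Omega) ((partial j (fun y => B y i j * f k y) x -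
      partial j (fun y => B y i j * F y) x) * v x)) @[k --> \oo] --> \sum_(j < n.+1) (0 : R).
    by apply: cvg_big; [exact: add_continuous|move=> j _; exact: c2].
  by rewrite big1.
have aE k : a k = - (\int[mu]_(x in Omega) (q x i 0 * F x) + \int[mu]_(x in Omega) (v x * divB i F x)).
  have E1 : \int[mu]_(x in Omega) (q x i 0 * (f k x - F x)) =
      \int[mu]_(x in Omega) (q x i 0 * f k x) - \int[mu]_(x in Omega) (q x i 0 * F x).
    rewrite -RintegralB//; last exact: L1_lipc.
    by apply: eq_Rintegral => x _; rewrite mulrBr.
  have ivk := L1_divB oO bO hB i vi (lf k).
  have E2 : \sum_j \int[mu]_(x in Omega) ((partial j (fun y => B y i j * f k y) x -
      partial j (fun y => B y i j * F y) x) * v x) =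
      \int[mu]_(x in Omega) (v x * divB i (f k) x) - \int[mu]_(x in Omega) (v x * divB i F x).
    rewrite -RintegralB//.
    rewrite -(@Rintegral_fsum _ _ _ oO _ (fun j x => (partial j (fun y => B y i j * f k y) x -
      partial j (fun y => B y i j * F y) x) * v x)).
      by apply: eq_Rintegral => x _; rewrite /divB -mulrBr -sumrB mulrC mulr_suml.
    move=> j; have lk := lipcW (lipcB bO hB i j (lf k)); have lF' := lipcW (lipcB bO hB i j lF).
    have [M1 _ H1] := lip_partial_bounded lk; have [M2 _ H2] := lip_partial_bounded lF'.
    have := @L1_mul _ _ _ oO v (fun x => partial j (fun y => B y i j * f k y) x - partial j (fun y => B y i j * F y) x) (M1 + M2) vi.
    rewrite (_ : (fun x => v x * _) = fun x => (partial j (fun y => B y i j * f k y) x -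
      partial j (fun y => B y i j * F y) x) * v x); last by apply/funext => x; rewrite mulrC.
    apply; first by apply: measurable_funB; exact: partial_meas.
    by move=> x _; apply: le_trans (ler_normB _ _) _; apply: lerD.
  rewrite /a E1 E2 E opprD addrACA addNr add0r; reflexivity.
have a1 : a k @[k --> \oo] -->
    - (\int[mu]_(x in Omega) (q x i 0 * F x) + \int[mu]_(x in Omega) (v x * divB i F x)).
  by rewrite (funext aE); exact: cvg_cst.
have /esym/eqP : (0 : R) = - (\int[mu]_(x in Omega) (q x i 0 * F x) + \int[mu]_(x in Omega) (v x * divB i F x)).
  exact: (cvg_unique (@Rhausdorff R) a0).
by rewrite oppr_eq0 addr_eq0 => /eqP.
Qed.

Lemma wgrad_lim (f_ : nat -> Rn -> R) (h_ : nat -> Rn -> vec) v q : (forall k, wgrad (f_ k) (h_ k)) ->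
  L1cvg f_ v -> (forall i, L1cvg (fun k x => h_ k x i 0) (fun x => q x i 0)) -> wgrad v q.
Proof.
move=> Hf fv hq; split; [by case: fv|by move=> i; case: (hq i)|move=> F lF i].
have [M _ FM] := lipc_bounded lF; have [N _ FN] := divB_bounded bO hB i lF.
have c1 := L1cvg_Rintegral (L1cvg_mul (hq i) (lipc_meas lF) (fun x _ => FM x)).
have c2 := L1cvg_Rintegral (L1cvg_mul fv (divB_meas bO hB i lF) (fun x _ => FN x)).
apply: (cvg_unique (@Rhausdorff R) c1).
rewrite (_ : (fun k => _) = fun k => - \int[mu]_(x in Omega) (f_ k x * divB i F x)); first exact: cvgN.
by apply/funext => k; have [_ _ ->] := Hf k.
Qed.

(* The product [v * w] vanishes, hence so does its gradient, given by the Leibniz rule. *)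
Lemma wgrad_disjoint (f_ : nat -> Rn -> R) v q w (g : Rn -> vec) : (forall k, lipschitz_c Omega (f_ k)) ->
  L2cvg f_ w -> (forall i, L2cvg (fun k x => gradB (f_ k) x i 0) (fun x => g x i 0)) ->
  wgrad v q -> L2 v -> (forall i, L2 (fun x => q x i 0)) -> (forall x, Omega x -> v x * w x = 0) ->
  ae_in Omega (fun x => w x *: q x + v x *: g x = 0).
Proof.
move=> lf fw hg wv v2 q2 vw0.
(* The Leibniz rule is available when one factor is Lipschitz, so it is used for [v * f_ k]; with
   both factors in L^2 every product converges in L^1. *)
have H : wgrad (fun x => v x * w x) (fun x => w x *: q x + v x *: g x).
  apply: (wgrad_lim (f_ := fun k x => v x * f_ k x) (h_ := fun k x => f_ k x *: q x + v x *: gradB (f_ k) x)).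
  - by move=> k; exact: wgrad_mul_lip.
  - have := L2cvg_mul fw v2; congr L1cvg; last by apply/funext => x; rewrite mulrC.
    by apply/funext => k; apply/funext => x; rewrite mulrC.
  - move=> i; have := L1cvgD (L2cvg_mul fw (q2 i)) (L2cvg_mul (hg i) v2); congr L1cvg.
      apply/funext => k; apply/funext => x.
      by rewrite [RHS]mxE [X in _ = X + _]mxE [X in _ = _ + X]mxE (mulrC (v x)).
    by apply/funext => x; rewrite [RHS]mxE [X in _ = X + _]mxE [X in _ = _ + X]mxE (mulrC (v x)).
have [hi _ _] := H; have Z := wgrad_cst oO bO hB 0.
apply: (wgrad_uniq oO bO hB (q' := fun=> 0) H).
have [zi zq z3] := Z; split => // F lF i; rewrite z3//; congr (- _); apply: eq_Rintegral => x /set_mem Ox.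
by rewrite vw0.
Qed.

End agrad3.

(** * The spaces W_0 *)

Lemma cvg0_sum {R : realType} (I : finType) (a : I -> nat -> R) :
  (forall i, a i k @[k --> \oo] --> (0 : R)) -> (\sum_i a i k) @[k --> \oo] --> (0 : R).
Proof.
move=> H; have : (\sum_i a i k) @[k --> \oo] --> \sum_(i : I) (0 : R).
  by apply: cvg_big; [exact: add_continuous|move=> i _; exact: H].
by rewrite big1.
Qed.

Section sobolev.
Context {R : realType} {n : nat}.
Notation Rn := 'rV[R]_n.+1.
Notation Ln := (leb_space R n).
Notation mu := (@leb R n).
Notation vec := 'cV[R]_n.+1.
Notation mat := 'M[R]_n.+1.
Variable Omega : set Rn.
Hypotheses (oO : open Omega) (bO : bounded_set Omega).
Notation L1 f := (mu.-integrable (Omega : set Ln) (EFin \o (f : Ln -> R))).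
Notation L2 := (L2 Omega).
Notation L1cvg := (L1cvg Omega).
Notation L2cvg := (L2cvg Omega).
Variable B : Rn -> mat.
Hypothesis hB : [lipschitz B x | x in Omega].
Notation wgrad := (wgrad Omega B).
Notation gradB := (gradB B).
Notation divB := (divB B).
Implicit Types (u v w : Rn -> R) (i j : 'I_n.+1) (g q : Rn -> vec).

Let mO : measurable (Omega : set Ln). Proof. exact: open_leb_measurable. Qed.

Lemma coord_le_enorm (a : vec) i : `|a i 0| <= enorm a.
Proof.
rewrite -sqrtr_sqr; apply: ler_wsqrtr; rewrite (bigD1 i)//= lerDl.
by apply: sumr_ge0 => j _; exact: sqr_ge0.
Qed.

Lemma enorm_ge0 (a : vec) : 0 <= enorm a. Proof. exact: sqrtr_ge0. Qed.

Lemma enorm_sqr (a : vec) : enorm a ^+ 2 = \sum_i a i 0 ^+ 2.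
Proof. by rewrite sqr_sqrtr//; apply: sumr_ge0 => j _; exact: sqr_ge0. Qed.

Lemma enormZ (c : R) (a : vec) : enorm (c *: a) = `|c| * enorm a.
Proof.
rewrite /enorm -sqrtr_sqr -sqrtrM ?sqr_ge0//; congr Num.sqrt.
by rewrite mulr_sumr; apply: eq_bigr => i _; rewrite mxE exprMn.
Qed.

Lemma enorm_le_sum (a : vec) : enorm a <= \sum_i `|a i 0|.
Proof.
have S0 : 0 <= \sum_i `|a i 0| by apply: sumr_ge0.
rewrite -(ler_sqr (enorm_ge0 a) S0) enorm_sqr expr2 mulr_suml; apply: ler_sum => i _.
rewrite -(real_normK (num_real (a i 0))) expr2 ler_wpM2l// (bigD1 i)//= lerDl.
exact: sumr_ge0.
Qed.

(** Multiplied by [enorm a + enorm b], the left side becomes a difference of sums of squares,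
    factored coordinatewise; each [|a_i + b_i|] is at most [enorm a + enorm b]. *)
Lemma enorm_dist (a b : vec) : `|enorm a - enorm b| <= \sum_i `|a i 0 - b i 0|.
Proof.
have S0 : 0 <= \sum_i `|a i 0 - b i 0| by apply: sumr_ge0.
have [ab|ab] := eqVneq (enorm a + enorm b) 0.
  have /andP[/eqP -> /eqP ->] : (enorm a == 0) && (enorm b == 0) by rewrite -paddr_eq0 ?enorm_ge0// ab.
  by rewrite subrr normr0.
have ab0 : 0 < enorm a + enorm b by rewrite lt0r ab addr_ge0 ?enorm_ge0.
rewrite -(ler_pM2r ab0) -[X in _ * X <= _](gtr0_norm ab0) -normrM -subr_sqr !enorm_sqr -sumrB.
apply: le_trans (ler_norm_sum _ _ _) _; rewrite mulr_suml; apply: ler_sum => i _.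
rewrite subr_sqr normrM ler_wpM2l//; apply: le_trans (ler_normD _ _) _.
by apply: lerD; exact: coord_le_enorm.
Qed.

Lemma enorm_meas g : (forall i, measurable_in Omega (fun x => g x i 0)) -> measurable_in Omega (fun x => enorm (g x)).
Proof.
move=> H; rewrite /measurable_in (_ : (fun x => _) = Num.sqrt \o (fun x => \sum_i g x i 0 ^+ 2))//.
apply: measurableT_comp; first by apply: continuous_measurable_fun; exact: sqrt_continuous.
by apply: meas_sum => i; exact: measurable_funX (H i).
Qed.

Lemma L1_enorm g : (forall i, L1 (fun x => g x i 0)) -> L1 (fun x => enorm (g x)).
Proof.
move=> H; apply: (@le_integrable _ _ _ _ _ mO _ (fun x => (\sum_i `|g x i 0|)%:E)).
- by apply/measurable_EFinP; apply: enorm_meas => i; exact: L1_meas (H i).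
- move=> x _ /=; rewrite lee_fin ger0_norm ?enorm_ge0// ger0_norm; first exact: enorm_le_sum.
  exact: sumr_ge0.
- by apply: (L1_sum oO) => i; exact: L1_norm (H i).
Qed.

Lemma in_WA_meas p v g : in_WA p Omega B v g -> measurable_in Omega v /\ forall i, measurable_in Omega (fun x => g x i 0).
Proof. by move=> [[[mv _] mg _] _]; split => // i; have [] := mg i. Qed.

Lemma in_WA_integrable p v g : in_WA p Omega B v g -> L1 (fun x => `|v x| ^+ p + enorm (g x) ^+ p).
Proof.
move=> H; have [mv mg] := in_WA_meas H; have [_ En] := H.
apply/integrableP; split.
  apply/measurable_EFinP; apply: measurable_funD; apply: measurable_funX.
    exact: measurableT_comp.
  exact: enorm_meas.
move: En; rewrite /WA_energy; congr (_ < _)%E; apply: eq_integral => x _.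
by rewrite abse_EFin ger0_norm// addr_ge0// exprn_ge0// enorm_ge0.
Qed.

Lemma in_WA2 v g : in_WA 2 Omega B v g -> L2 v /\ forall i, L2 (fun x => g x i 0).
Proof.
move=> H; have [mv mg] := in_WA_meas H; have iE := in_WA_integrable H.
split; [split => //|move=> i; split; first exact: mg].
  apply: le_integrable iE => //; first by apply/measurable_EFinP; exact: measurable_funX.
  move=> x _ /=; rewrite lee_fin normrX real_normK ?num_real// ger0_norm; first by rewrite lerDl exprn_ge0// enorm_ge0.
  by rewrite addr_ge0 ?sqr_ge0.
apply: le_integrable iE => //; first by apply/measurable_EFinP; apply: measurable_funX; exact: mg.
move=> x _ /=; rewrite lee_fin normrX [leRHS]ger0_norm; last by rewrite addr_ge0 ?sqr_ge0.
apply: (@le_trans _ _ (enorm (g x) ^+ 2)); last by rewrite lerDr exprn_ge0.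
by rewrite ler_sqr ?nnegrE ?enorm_ge0//; exact: coord_le_enorm.
Qed.

Lemma in_WA2_wgrad v g : in_WA 2 Omega B v g -> wgrad v g.
Proof.
move=> H; have [v2 g2] := in_WA2 H; have [isg _] := H.
by apply: is_gradA_wgrad => //; [exact: L2_L1|move=> i; exact: L2_L1].
Qed.

Lemma energy_fin p v g : L1 (fun x => `|v x| ^+ p + enorm (g x) ^+ p) ->
  WA_energy p Omega v g = (\int[mu]_(x in Omega) (`|v x| ^+ p + enorm (g x) ^+ p))%:E.
Proof. by move=> H; rewrite /WA_energy /Rintegral fineK//; exact: integrable_fin_num H. Qed.

Lemma energy_int1 v g : L1 v -> (forall i, L1 (fun x => g x i 0)) -> L1 (fun x => `|v x| ^+ 1 + enorm (g x) ^+ 1).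
Proof. by move=> vi gi; apply: (L1D oO); [exact: L1_norm|exact: L1_enorm]. Qed.

Lemma energy_int2 v g : L2 v -> (forall i, L2 (fun x => g x i 0)) -> L1 (fun x => `|v x| ^+ 2 + enorm (g x) ^+ 2).
Proof.
move=> [mv vi] gi; apply: (L1D oO).
  by rewrite (_ : (fun x => _) = fun x => v x ^+ 2)//; apply/funext => x; rewrite real_normK ?num_real.
rewrite (_ : (fun x => _) = fun x => \sum_i g x i 0 ^+ 2); last by apply/funext => x; rewrite enorm_sqr.
by apply: (L1_sum oO) => i; have [] := gi i.
Qed.

Lemma in_WA1I v g : wgrad v g -> in_WA 1 Omega B v g.
Proof.
move=> H; have [vi gi _] := H; split; first exact: wgrad_is_gradA.
by rewrite energy_fin ?ltry//; exact: energy_int1.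
Qed.

Lemma in_WA2I v g : wgrad v g -> L2 v -> (forall i, L2 (fun x => g x i 0)) -> in_WA 2 Omega B v g.
Proof.
move=> H v2 g2; split; first exact: wgrad_is_gradA.
by rewrite energy_fin ?ltry//; exact: energy_int2.
Qed.

Lemma lipc_L2 v : lipschitz_c Omega v -> L2 v.
Proof. by move=> lv; have [M _ H] := lipc_bounded lv; apply: (L2_bounded oO bO (lipc_meas lv) (M := M)). Qed.

Lemma gradB_L2 v i : lipschitz_c Omega v -> L2 (fun x => gradB v x i 0).
Proof.
move=> lv; have [M _ H] := gradB_bounded bO hB (lipcW lv).
by apply: (L2_bounded oO bO (gradB_meas oO bO hB i (lipcW lv)) (M := M)) => x; exact: H.
Qed.

Lemma in_WA0_1I (f : nat -> Rn -> R) v g : (forall k, lipschitz_c Omega (f k)) ->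
  L1cvg f v -> (forall i, L1cvg (fun k x => gradB (f k) x i 0) (fun x => g x i 0)) -> in_WA0 1 Omega B v g.
Proof.
move=> lf fv fg; have wf k := wgrad_lip oO bO hB (lf k).
have wv : wgrad v g by exact: (wgrad_lim oO bO hB wf fv fg).
split; first exact: in_WA1I.
exists f, (fun k => gradB (f k)); split => [k|]; first by split => //; exact: in_WA1I.
have vi : L1 v by case: fv. have gi i : L1 (fun x => g x i 0) by case: (fg i).
have di k : L1 (fun x => f k x - v x) by apply: L1B => //; exact: lipc_L1.
have dg k i : L1 (fun x => (gradB (f k) x - g x) i 0).
  rewrite (_ : (fun x => _) = fun x => gradB (f k) x i 0 - g x i 0); last by apply/funext => x; rewrite mxE [X in _ + X]mxE.
  by apply: L1B => //; exact: gradB_L1 (lipcW (lf k)).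
have E k : WA_norm 1 Omega (fun x => f k x - v x) (fun x => gradB (f k) x - g x) =
   (\int[mu]_(x in Omega) (`|f k x - v x| ^+ 1 + enorm (gradB (f k) x - g x) ^+ 1))%:E.
  rewrite /WA_norm (energy_fin (energy_int1 (di k) (dg k))) invr1 poweRe1//.
  by rewrite lee_fin; apply: Rintegral_ge0 => x _; rewrite addr_ge0// expr1 enorm_ge0.
rewrite (funext E); apply/fine_cvgP; split; first exact: nearW.
have H : (\int[mu]_(x in Omega) `|f k x - v x| + \sum_i \int[mu]_(x in Omega) `|gradB (f k) x i 0 - g x i 0|)
    @[k --> \oo] --> (0 : R).
  rewrite -[X in _ --> X]addr0; apply: cvgD; first by case: fv.
  by apply: cvg0_sum => i; case: (fg i).
apply: (squeeze_cvgr _ (cvg_cst 0) H); apply: nearW => k; apply/andP; split.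
  by apply: Rintegral_ge0 => x _; rewrite addr_ge0// expr1 enorm_ge0.
rewrite /= RintegralD//; [|exact: L1_norm|exact: L1_enorm].
rewrite lerD2l -(@Rintegral_fsum _ _ _ oO _ (fun i x => `|gradB (f k) x i 0 - g x i 0|)); last first.
  by move=> i; apply: L1_norm; apply: L1B => //; exact: gradB_L1 (lipcW (lf k)).
apply: le_Rintegral => //; first exact: L1_enorm.
  by apply: (L1_sum oO) => i; apply: L1_norm; apply: L1B => //; exact: gradB_L1 (lipcW (lf k)).
move=> x _; rewrite expr1; apply: le_trans (enorm_le_sum _) _.
by apply: ler_sum => i _; rewrite !mxE.
Qed.

Lemma cvg_poweR_half (a : nat -> R) : (forall k, 0 <= a k) ->
  (poweR (a k)%:E 2%:R^-1 @[k --> \oo] --> 0%E) <-> a k @[k --> \oo] --> (0 : R).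
Proof.
move=> a0; have E k : poweR (a k)%:E 2%:R^-1 = (Num.sqrt (a k))%:E by rewrite poweR_EFin powR12_sqrt.
rewrite (funext E); split => [/fine_cvgP[_ H]|H].
  have : Num.sqrt (a k) * Num.sqrt (a k) @[k --> \oo] --> (0 : R) * 0 by apply: cvgM; exact: H.
  by rewrite mulr0 (_ : (fun k => _) = a)//; apply/funext => k; rewrite -expr2 sqr_sqrtr.
apply/fine_cvgP; split; first exact: nearW.
rewrite -(sqrtr0 R); apply: (@cvg_comp _ _ _ a Num.sqrt _ _ _ H); exact: sqrt_continuous.
Qed.

Lemma in_WA0_2I (f : nat -> Rn -> R) v g : (forall k, lipschitz_c Omega (f k)) ->
  L2cvg f v -> (forall i, L2cvg (fun k x => gradB (f k) x i 0) (fun x => g x i 0)) -> in_WA0 2 Omega B v g.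
Proof.
move=> lf fv fg; have wf k := wgrad_lip oO bO hB (lf k).
have wv : wgrad v g by apply: (wgrad_lim oO bO hB wf); [exact: L2cvg_L1cvg|move=> i; exact: L2cvg_L1cvg].
have vi : L2 v by case: fv. have gi i : L2 (fun x => g x i 0) by case: (fg i).
split; first exact: in_WA2I.
exists f, (fun k => gradB (f k)); split => [k|].
  by split => //; apply: in_WA2I => //; [exact: lipc_L2|move=> i; exact: gradB_L2].
have di k : L2 (fun x => f k x - v x) by apply: L2B => //; exact: lipc_L2.
have dg k i : L2 (fun x => (gradB (f k) x - g x) i 0).
  rewrite (_ : (fun x => _) = fun x => gradB (f k) x i 0 - g x i 0); last by apply/funext => x; rewrite mxE [X in _ + X]mxE.
  by apply: L2B => //; exact: gradB_L2.
have E k : WA_norm 2 Omega (fun x => f k x - v x) (fun x => gradB (f k) x - g x) =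
   poweR (\int[mu]_(x in Omega) (`|f k x - v x| ^+ 2 + enorm (gradB (f k) x - g x) ^+ 2))%:E 2%:R^-1.
  by rewrite /WA_norm energy_fin//; exact: energy_int2.
rewrite (funext E); apply/cvg_poweR_half.
  by move=> k; apply: Rintegral_ge0 => x _; rewrite addr_ge0 ?sqr_ge0.
have H : (\int[mu]_(x in Omega) (f k x - v x) ^+ 2 + \sum_i \int[mu]_(x in Omega) (gradB (f k) x i 0 - g x i 0) ^+ 2)
    @[k --> \oo] --> (0 : R).
  rewrite -[X in _ --> X]addr0; apply: cvgD; first by case: fv.
  by apply: cvg0_sum => i; case: (fg i).
move: H; rewrite (_ : (fun k => _) = fun k => \int[mu]_(x in Omega) (`|f k x - v x| ^+ 2 + enorm (gradB (f k) x - g x) ^+ 2))//.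
apply/funext => k.
have gdi i : L2 (fun x => gradB (f k) x i 0 - g x i 0) by apply: L2B => //; exact: gradB_L2.
rewrite -(@Rintegral_fsum _ _ _ oO _ (fun i x => (gradB (f k) x i 0 - g x i 0) ^+ 2)); last by move=> i; have [] := gdi i.
rewrite -RintegralD//; first last.
- by apply: (L1_sum oO) => i; have [] := gdi i.
- by have [] := di k.
apply: eq_Rintegral => x _; rewrite real_normK ?num_real// enorm_sqr; congr (_ + _).
by apply: eq_bigr => i _; rewrite !mxE.
Qed.

(** The approximating functions come with A-gradients of their own; by uniqueness these agree almost
    everywhere with the classical [gradB (f k)], and the convergence of the norm is read off
    coordinate by coordinate. *)
Lemma in_WA0_2E v g : in_WA0 2 Omega B v g -> exists f : nat -> Rn -> R,
  [/\ forall k, lipschitz_c Omega (f k), L2cvg f v &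
      forall i, L2cvg (fun k x => gradB (f k) x i 0) (fun x => g x i 0)].
Proof.
move=> [wv [f [h [Hf Hc]]]]; exists f; have [vi gi] := in_WA2 wv.
have lf k : lipschitz_c Omega (f k) by case: (Hf k).
have wfh k : in_WA 2 Omega B (f k) (h k) by case: (Hf k).
have hi k i : L2 (fun x => h k x i 0) by have [_] := in_WA2 (wfh k).
have eh k : ae_in Omega (fun x => gradB (f k) x = h k x).
  by apply: (wgrad_uniq oO bO hB); [exact: wgrad_lip|exact: in_WA2_wgrad].
have di k : L2 (fun x => f k x - v x) by apply: L2B => //; exact: lipc_L2.
have hdi k i : L2 (fun x => (h k x - g x) i 0).
  rewrite (_ : (fun x => _) = fun x => h k x i 0 - g x i 0); last by apply/funext => x; rewrite mxE [X in _ + X]mxE.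
  exact: L2B.
pose a k := \int[mu]_(x in Omega) (`|f k x - v x| ^+ 2 + enorm (h k x - g x) ^+ 2).
have a0 : a k @[k --> \oo] --> (0 : R).
  apply/cvg_poweR_half; first by move=> k; apply: Rintegral_ge0 => x _; rewrite addr_ge0 ?sqr_ge0.
  move: Hc; rewrite (_ : (fun k => _) = fun k => poweR (a k)%:E 2%:R^-1)//.
  by apply/funext => k; rewrite /WA_norm energy_fin//; exact: energy_int2.
split => //.
  split => //; first by move=> k; exact: lipc_L2.
  apply: (squeeze_cvgr _ (cvg_cst 0) a0); apply: nearW => k; apply/andP; split.
    by apply: Rintegral_ge0 => x _; exact: sqr_ge0.
  apply: le_Rintegral => //; [by have [] := di k|exact: energy_int2|].
  by move=> x _; rewrite real_normK ?num_real// lerDl sqr_ge0.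
move=> i; split => //; first by move=> k; exact: gradB_L2.
apply: (squeeze_cvgr _ (cvg_cst 0) a0); apply: nearW => k; apply/andP; split.
  by apply: Rintegral_ge0 => x _; exact: sqr_ge0.
have [_ s1] : L2 (fun x => gradB (f k) x i 0 - g x i 0) by apply: L2B => //; exact: gradB_L2.
have [_ s2] := hdi k i.
rewrite (Rintegral_ae_eq oO s1 s2); last by apply: ae_inS (eh k) => x _ ->; rewrite !mxE.
apply: le_Rintegral => //; first exact: energy_int2.
move=> x _; apply: (@le_trans _ _ (enorm (h k x - g x) ^+ 2)); last by rewrite lerDr sqr_ge0.
by rewrite -real_normK ?num_real// ler_sqr ?nnegrE ?enorm_ge0//; exact: coord_le_enorm.
Qed.

End sobolev.

(** * Truncations *)

Section truncation.
Context {R : realType}.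
Variables (s h : R).
Hypotheses (s0 : 0 <= s) (h0 : 0 < h).
Implicit Types a b t : R.

Let X t := Num.max 0 (t - s) + h.

(* [strunc] is p^2 / (p + h) with p the positive part of t - s. *)
Definition strunc t := X t - 2 * h + h ^+ 2 / X t.
Definition dstrunc t := 1 - h ^+ 2 / X t ^+ 2.

Let Xh t : h <= X t. Proof. by rewrite lerDr le_max lexx. Qed.
Let X0 t : 0 < X t. Proof. exact: lt_le_trans h0 (Xh t). Qed.

Let X_lip a b : `|X a - X b| <= `|a - b|.
Proof.
rewrite /X opprD addrACA subrr addr0.
have [as_|as_] := leP 0 (a - s); have [bs|bs] := leP 0 (b - s).
- by rewrite opprB addrA subrK.
- rewrite subr0 ger0_norm// ger0_norm; lra.
- rewrite sub0r normrN ger0_norm// ler0_norm; lra.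
- by rewrite subrr normr0.
Qed.

Lemma strunc0 : strunc 0 = 0.
Proof.
by rewrite /strunc /X sub0r max_l ?oppr_le0// add0r; field; rewrite gt_eqF.
Qed.

Lemma struncE t : strunc t = (X t - h) ^+ 2 / X t.
Proof. by rewrite /strunc; field; rewrite gt_eqF. Qed.

Lemma strunc_ge0 t : 0 <= strunc t.
Proof. by rewrite struncE divr_ge0 ?sqr_ge0// ltW. Qed.

Lemma dstrunc_itv t : 0 <= dstrunc t <= 1.
Proof.
rewrite /dstrunc subr_ge0 lerBlDr lerDl divr_ge0 ?sqr_ge0// andbT.
by rewrite ler_pdivrMr ?exprn_gt0// mul1r ler_sqr ?nnegrE ?Xh// ltW.
Qed.

Lemma dstrunc_le_ind t : dstrunc t <= (s < t)%R%:R.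
Proof.
have [st|ts] := ltP s t; first by case/andP: (dstrunc_itv t).
by rewrite /dstrunc /X max_l ?subr_le0// add0r divff ?subrr// expf_neq0// gt_eqF.
Qed.

Lemma strunc_ge_half t : s + h <= t -> h / 2 <= strunc t.
Proof.
move=> st; have X2 : 2 * h <= X t.
  rewrite /X; have : t - s <= Num.max 0 (t - s) by rewrite le_max lexx orbT.
  lra.
have key x : 2 * h <= x -> h / 2 * x <= (x - h) ^+ 2.
  move=> hx; have h00 := h0; have A1 : 0 <= x - 2 * h by rewrite subr_ge0.
  have A2 : 0 <= x - h / 2 by lra.
  have := mulr_ge0 A1 A2.
  nra.
by rewrite struncE ler_pdivlMr// key.
Qed.

Let expand x y : 0 < x -> 0 < y ->
  (y - 2 * h + h ^+ 2 / y) - (x - 2 * h + h ^+ 2 / x) - (1 - h ^+ 2 / x ^+ 2) * (y - x) =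
  h ^+ 2 * (y - x) ^+ 2 / (x ^+ 2 * y).
Proof. by move=> x0 y0; field; rewrite !gt_eqF. Qed.

Let cube_le x y : h <= x -> h <= y -> 0 <= h ^+ 2 / (x ^+ 2 * y) <= h^-1.
Proof.
move=> hx hy; have x0 : 0 < x by exact: lt_le_trans hx. have y0 : 0 < y by exact: lt_le_trans hy.
have xy0 : 0 < x ^+ 2 * y by rewrite mulr_gt0// exprn_gt0.
rewrite divr_ge0 ?sqr_ge0 ?(ltW xy0)//= ler_pdivrMr// ler_pdivlMl// mulrC.
by apply: ler_pM => //; rewrite ?sqr_ge0 ?(ltW h0)// ler_sqr// nnegrE ltW.
Qed.

Let expand_le x y : h <= x -> h <= y -> 0 <= h ^+ 2 * (y - x) ^+ 2 / (x ^+ 2 * y) <= h^-1 * (y - x) ^+ 2.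
Proof.
move=> hx hy; have /andP[c1 c2] := cube_le hx hy; rewrite mulrAC.
by rewrite mulr_ge0 ?sqr_ge0//= ler_wpM2r ?sqr_ge0.
Qed.

(** The kink of [X] at [s] is harmless because the derivative vanishes there. With both points above
    [s], the remainder is that of the smooth function [X - 2 h + h^2 / X]; for [a <= s] there is no
    linear term. Only [b < s < a] adds a term. *)
Lemma quad_der_strunc : quad_der strunc dstrunc h^-1.
Proof.
move=> a b; have h1 : 0 < h^-1 by rewrite invr_gt0.
have E := expand (X0 a) (X0 b); have /andP[e1 e2] := expand_le (Xh a) (Xh b).
have -> : strunc b - strunc a - dstrunc a * (b - a) =
   h ^+ 2 * (X b - X a) ^+ 2 / (X a ^+ 2 * X b) + dstrunc a * ((X b - X a) - (b - a)).
  by rewrite -E /strunc /dstrunc; ring.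
have [sa|sa] := leP a s.
  have -> : dstrunc a = 0.
    apply/eqP; rewrite eq_le; have /andP[-> _] := dstrunc_itv a; rewrite andbT.
    by have := dstrunc_le_ind a; rewrite ltNge sa.
  rewrite mul0r addr0 ger0_norm//; apply: le_trans e2 _; rewrite ler_pM2l//.
  by rewrite -(real_normK (num_real (X b - X a))) -(real_normK (num_real (b - a))) ler_sqr ?nnegrE// X_lip.
have Xa : X a = a - s + h by rewrite /X max_r// subr_ge0 ltW.
have Xb : X b - X a - (b - a) = Num.max 0 (s - b).
  rewrite Xa /X; have [bs|bs] := leP 0 (b - s).
    by rewrite max_l; lra.
  by rewrite max_r; lra.
rewrite Xb; set d := Num.max 0 (s - b); have d0 : 0 <= d by rewrite le_max lexx.
have /andP[t0 _] := dstrunc_itv a.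
rewrite ger0_norm; last by rewrite addr_ge0// mulr_ge0.
have [dd|dd] : d = 0 \/ X b = h /\ b = s - d.
  have [bs|bs] := leP (s - b) 0; first by left; rewrite /d max_l.
  by right; split; [rewrite /X max_l ?add0r//; lra|rewrite /d max_r ?(ltW bs)//; lra].
  rewrite dd mulr0 addr0; apply: le_trans e2 _; rewrite ler_pM2l//.
  by rewrite -(real_normK (num_real (X b - X a))) -(real_normK (num_real (b - a))) ler_sqr ?nnegrE// X_lip.
(* Here [b = s - d] and [a = s + p], and the additional term is [dstrunc a * d <= (2 p / h) * d].
   Together with [p^2 / h] it stays below [(p + d)^2 / h]. *)
case: dd => Xbh bE; pose p := a - s; have p0 : 0 < p by rewrite subr_gt0.
have td : dstrunc a <= 2 * p / h.
  rewrite /dstrunc Xa -/p lerBlDr -lerBlDl.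
  have ph : 0 < p + h by exact: addr_gt0.
  rewrite ler_pdivlMr ?exprn_gt0//.
  have -> : (1 - 2 * p / h) * (p + h) ^+ 2 = h ^+ 2 - (3 * p ^+ 2 + 2 * p ^+ 3 / h).
    by field; rewrite gt_eqF.
  by rewrite lerBlDr lerDl addr_ge0 ?mulr_ge0 ?invr_ge0 ?exprn_ge0 ?(ltW p0) ?(ltW h0).
apply: (@le_trans _ _ (h^-1 * p ^+ 2 + 2 * p / h * d)).
  apply: lerD; last by rewrite ler_wpM2r.
  by apply: le_trans e2 _; rewrite Xbh Xa opprD addrCA subrr addr0 sqrrN.
have -> : b - a = - (p + d) by rewrite bE /p; lra.
have -> : h^-1 * (- (p + d)) ^+ 2 = h^-1 * p ^+ 2 + 2 * p / h * d + h^-1 * d ^+ 2 by field; rewrite gt_eqF.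
by rewrite lerDl mulr_ge0 ?sqr_ge0// ltW.
Qed.

Lemma strunc_lip a b : `|strunc a - strunc b| <= `|a - b|.
Proof.
have -> : strunc a - strunc b = (X a - X b) * (1 - h ^+ 2 / (X a * X b)).
  by rewrite /strunc; field; rewrite !gt_eqF.
rewrite normrM -[leRHS]mulr1; apply: ler_pM => //.
have H : h ^+ 2 / (X a * X b) <= 1.
  by rewrite ler_pdivrMr ?mulr_gt0// mul1r expr2; apply: ler_pM => //; exact: (ltW h0).
have H0 : 0 <= h ^+ 2 / (X a * X b) by rewrite divr_ge0 ?sqr_ge0// mulr_ge0// ltW.
rewrite ger0_norm; lra.
Qed.

Lemma dstrunc_lip a b : `|dstrunc a - dstrunc b| <= 2 / h * `|a - b|.
Proof.
have -> : dstrunc a - dstrunc b = (X a - X b) * (h ^+ 2 / (X a * X b ^+ 2) + h ^+ 2 / (X a ^+ 2 * X b)).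
  by rewrite /dstrunc; field; rewrite !gt_eqF.
rewrite [leLHS]normrM mulrC; apply: ler_pM => //.
have /andP[u1 u2] := cube_le (Xh a) (Xh b); have /andP[v1 v2] := cube_le (Xh b) (Xh a).
rewrite (mulrC (X a) (X b ^+ 2)) ger0_norm; last exact: addr_ge0.
have -> : 2 / h = h^-1 + h^-1 by field; rewrite gt_eqF.
exact: lerD.
Qed.

End truncation.

(** * Truncations of limits of Lipschitz functions *)

Section truncation_sobolev.
Context {R : realType} {n : nat}.
Notation Rn := 'rV[R]_n.+1.
Notation Ln := (leb_space R n).
Notation mu := (@leb R n).
Notation vec := 'cV[R]_n.+1.
Notation mat := 'M[R]_n.+1.
Variable Omega : set Rn.
Hypotheses (oO : open Omega) (bO : bounded_set Omega).
Notation L1 f := (mu.-integrable (Omega : set Ln) (EFin \o (f : Ln -> R))).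
Notation L2 := (L2 Omega).
Notation L1cvg := (L1cvg Omega).
Notation L2cvg := (L2cvg Omega).
Variable B : Rn -> mat.
Hypothesis hB : [lipschitz B x | x in Omega].
Notation wgrad := (wgrad Omega B).
Notation gradB := (gradB B).
Implicit Types (u v w : Rn -> R) (i j : 'I_n.+1) (g q : Rn -> vec).

Let mO : measurable (Omega : set Ln). Proof. exact: open_leb_measurable. Qed.

Lemma lip1_measurable (T : R -> R) (L : R) : (forall a b, `|T a - T b| <= L * `|a - b|) -> measurable_fun setT T.
Proof.
move=> TL; apply: continuous_measurable_fun => x; apply/cvgrPdist_le => e e0.
have L1 : 0 < `|L| + 1 by rewrite ltr_wpDl.
near=> y; apply: le_trans (TL _ _) _; apply: (@le_trans _ _ ((`|L| + 1) * `|x - y|)).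
  by rewrite ler_wpM2r// (le_trans (ler_norm L))// lerDl.
rewrite mulrC -ler_pdivlMr//; near: y; apply: cvgr_dist_le => //; exact: divr_gt0.
Unshelve. all: by end_near. Qed.

Lemma L2cvg_comp (T : R -> R) (f : nat -> Rn -> R) w : (forall a b, `|T a - T b| <= `|a - b|) -> T 0 = 0 ->
  L2cvg f w -> L2cvg (fun k x => T (f k x)) (fun x => T (w x)).
Proof.
move=> TL T0 [fk wi H].
have mT : measurable_fun setT T by apply: (@lip1_measurable _ 1) => a b; rewrite mul1r.
have TL2 v : L2 v -> L2 (fun x => T (v x)).
  move=> [mv vi]; have mTv : measurable_in Omega (fun x => T (v x)) by exact: (measurableT_comp mT).
  split => //; apply: le_integrable vi => //; first by apply/measurable_EFinP; exact: measurable_funX.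
  move=> x _ /=; rewrite lee_fin !ger0_norm ?sqr_ge0//.
  rewrite -(real_normK (num_real (T _))) -(real_normK (num_real (v x))) ler_sqr ?nnegrE//.
  by have := TL (v x) 0; rewrite T0 !subr0.
split; [by move=> k; exact: TL2|exact: TL2|].
apply: (squeeze_cvgr _ (cvg_cst 0) H); apply: nearW => k; apply/andP; split.
  by apply: Rintegral_ge0 => x _; exact: sqr_ge0.
apply: le_Rintegral => //.
- by have [] := L2B oO (TL2 _ (fk k)) (TL2 _ wi).
- by have [] := L2B oO (fk k) wi.
- move=> x _; rewrite -(real_normK (num_real (T _ - _))) -(real_normK (num_real (f k x - _))).
  by rewrite ler_sqr ?nnegrE// TL.
Qed.

Lemma lipc_comp (T : R -> R) v : (forall a b, `|T a - T b| <= `|a - b|) -> T 0 = 0 ->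
  lipschitz_c Omega v -> lipschitz_c Omega (fun x => T (v x)).
Proof.
move=> TL T0 /lipschitz_cP[[L vL] cv]; apply/lipschitz_cP; split; last exact: csupp_comp.
by exists L => x y; exact: le_trans (TL _ _) (vL _ _).
Qed.

(** The error splits as [tau (f k) (grad f k - g) + (tau (f k) - tau w) g]. In the second term
    [d k], the square of [tau (f k) - tau w], is bounded by 1, and its integral against a bounded
    function tends to 0; so [d k] is weakly null and can be tested against [g_i^2], which is only
    integrable. No almost everywhere convergent subsequence is extracted. *)
Lemma L2cvg_grad_comp (T tau : R -> R) (c L : R) (f : nat -> Rn -> R) w g :
  (forall a b, `|T a - T b| <= `|a - b|) -> T 0 = 0 ->
  quad_der T tau c -> (forall a, 0 <= tau a <= 1) -> (forall a b, `|tau a - tau b| <= L * `|a - b|) ->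
  (forall k, lipschitz_c Omega (f k)) -> L2cvg f w ->
  (forall i, L2cvg (fun k x => gradB (f k) x i 0) (fun x => g x i 0)) ->
  forall i, L2cvg (fun k x => gradB (fun y => T (f k y)) x i 0) (fun x => (tau (w x) *: g x) i 0).
Proof.
move=> TL T0 qT t01 tL lf fw fg i; have [fk wi H] := fw; have [hk gi Hg] := fg i.
have mt : measurable_fun setT tau by exact: lip1_measurable tL.
have lTf k : lipschitz_c Omega (fun x => T (f k x)) by exact: lipc_comp.
have mtw v : L2 v -> measurable_in Omega (fun x => tau (v x)).
  by move=> [mv _]; exact: (measurableT_comp mt).
have tb a : `|tau a| <= 1 by have /andP[? ?] := t01 a; rewrite ger0_norm.
have tgE : (fun x => (tau (w x) *: g x) i 0) = fun x => g x i 0 * tau (w x).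
  by apply/funext => x; rewrite mxE mulrC.
have tg : L2 (fun x => (tau (w x) *: g x) i 0).
  by rewrite tgE; apply: (L2M oO gi (mtw _ wi) (M := 1)).
split => //; first by move=> k; exact: gradB_L2.
pose d k x := (tau (f k x) - tau (w x)) ^+ 2.
have d01 k x : 0 <= d k x <= 1.
  rewrite /d sqr_ge0/= -(real_normK (num_real (_ - _))) expr_le1//.
  have /andP[? ?] := t01 (f k x); have /andP[? ?] := t01 (w x).
  by rewrite ler_norml; apply/andP; split; lra.
have md k : measurable_in Omega (d k).
  by apply: measurable_funX; apply: measurable_funB; exact: mtw.
have dg0 : \int[mu]_(x in Omega) (d k x * g x i 0 ^+ 2) @[k --> \oo] --> (0 : R).
  apply: (weak_null_integrable oO bO (M := 1) md _ _ (proj2 gi)).2.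
    by move=> k x; have /andP[? ?] := d01 k x; rewrite ger0_norm.
  move=> psi /C1_c_lipschitz lp; have [M M0 pM] := lipc_bounded lp.
  apply/norm_cvg0P.
  have Hb : M * (L ^+ 2 * \int[mu]_(x in Omega) (f k x - w x) ^+ 2) @[k --> \oo] --> (0 : R).
    by rewrite -(mulr0 M) -(mulr0 (L ^+ 2)); apply: cvgMl_tmp; exact: cvgMl_tmp.
  apply: (squeeze_cvgr _ (cvg_cst 0) Hb); apply: nearW => k; rewrite normr_ge0/=.
  have [_ fwi] := L2B oO (fk k) wi.
  rewrite -RintegralZl// -RintegralZl//; last exact: (L1Z oO).
  have di : L1 (d k) by apply: (L1_bounded oO bO (md k) (M := 1)) => x _; have /andP[? ?] := d01 k x; rewrite ger0_norm.
  apply: norm_Rintegral_le => //.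
  - exact: L1_lipc.
  - by apply: (L1Z oO); exact: (L1Z oO).
  - move=> x _; rewrite normrM mulrC; apply: ler_pM => //.
    have /andP[? _] := d01 k x; rewrite ger0_norm// /d -(real_normK (num_real (_ - tau _))).
    rewrite -[X in _ <= _ * X](real_normK (num_real (_ - _))) -exprMn.
    by rewrite ler_sqr ?nnegrE//; exact: le_trans (tL _ _).
have Hb : 2 * (\int[mu]_(x in Omega) (gradB (f k) x i 0 - g x i 0) ^+ 2 +
    \int[mu]_(x in Omega) (d k x * g x i 0 ^+ 2)) @[k --> \oo] --> (0 : R).
  by rewrite -(mulr0 2); apply: cvgMl_tmp; rewrite -[X in _ --> X]addr0; exact: cvgD.
apply: (squeeze_cvgr _ (cvg_cst 0) Hb); apply: nearW => k; apply/andP; split.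
  by apply: Rintegral_ge0 => x _; exact: sqr_ge0.
have [_ s1] := L2B oO (gradB_L2 oO bO hB i (lTf k)) tg.
have [_ s2] := L2B oO (hk k) gi.
have s3 : L1 (fun x => d k x * g x i 0 ^+ 2).
  have := @L1_mul _ _ _ oO (fun x => g x i 0 ^+ 2) (d k) 1 (proj2 gi) (md k).
  rewrite (_ : (fun x => g x i 0 ^+ 2 * d k x) = fun x => d k x * g x i 0 ^+ 2).
    by apply => x _; have /andP[? ?] := d01 k x; rewrite ger0_norm.
  by apply/funext => x; rewrite mulrC.
pose e x := tau (f k x) * gradB (f k) x i 0 - tau (w x) * g x i 0.
have ei : L2 e.
  have tL2 v' u' : L2 v' -> L2 u' -> L2 (fun x => tau (v' x) * u' x).
    move=> v2 q2; rewrite (_ : (fun x => _) = fun x => u' x * tau (v' x)).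
      by apply: (L2M oO q2 (mtw _ v2) (M := 1)).
    by apply/funext => x; rewrite mulrC.
  by apply: (L2B oO); exact: tL2.
rewrite (Rintegral_ae_eq oO s1 (proj2 ei)); last first.
  apply: ae_inS (gradB_comp_ae Omega B qT (lipcW (lf k))) => x _ ->.
  by rewrite /e !mxE.
rewrite -RintegralD// -RintegralZl//; last exact: (L1D oO).
apply: le_Rintegral => //; [exact: (proj2 ei)|by apply: (L1Z oO); exact: (L1D oO)|].
move=> x _; rewrite /e /d; set a := tau _; set b := tau _; set p := gradB _ _ _ _; set r := g _ _ _.
have /andP[a0 a1] : 0 <= a <= 1 by exact: t01.
have -> : a * p - b * r = a * (p - r) + (a - b) * r by ring.
have a2 : a ^+ 2 * (p - r) ^+ 2 <= (p - r) ^+ 2.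
  by apply: ler_piMl; [exact: sqr_ge0|rewrite expr_le1].
have := sqr_ge0 (a * (p - r) - (a - b) * r).
nra.
Qed.

End truncation_sobolev.

(** * Energy estimate *)

Section nonmeasurable_integrand.
Local Open Scope ereal_scope.
Context d (T : measurableType d) (R : realType) (mu : {measure set T -> \bar R}).
Implicit Types (D : set T) (f G : T -> \bar R).

(** The integral of a nonnegative function is a supremum over the simple functions below it, so
    monotonicity holds without measurability. *)
Lemma le_integral_patch D D' f G : (forall x, D' x -> 0 <= f x) -> (forall x, D x -> 0 <= G x) ->
  (forall x, (f \_ D') x <= (G \_ D) x) -> \int[mu]_(x in D') f x <= \int[mu]_(x in D) G x.
Proof.
move=> f0 G0 fG; rewrite !ge0_integralE//; apply: ereal_sup_le => _ [h hf <-].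
by exists h => // x; apply: le_trans (hf x) _.
Qed.

(** The majorant is [+oo] on a measurable null set and 0 elsewhere, whatever the measurability of
    [f]. *)
Lemma integral_ae0 D f : (forall x, 0 <= f x) -> {ae mu, forall x, D x -> f x = 0} ->
  \int[mu]_(x in D) f x = 0.
Proof.
move=> f0 [N [mN N0 HN]]; apply/eqP; rewrite eq_le integral_ge0// andbT.
apply: (@le_trans _ _ (\int[mu]_(x in N) +oo)); last first.
  rewrite (ge0_negligible_integral mN mN)//; first by rewrite setDv integral_set0.
apply: le_integral_patch => // x; rewrite /patch.
case: ifPn => [/set_mem Dx|_]; case: ifPn => [_|xN]; rewrite ?leey//.
have [-> //|fx] := eqVneq (f x) 0; move: xN; rewrite notin_setE => xN.
by exfalso; apply: xN; apply: HN => /= /(_ Dx) E; move: fx; rewrite E eqxx.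
Qed.

(* G need not be measurable: it will be the integrand [formA], which involves
   the choices made by [pinvmx]. *)
Lemma le_integral_ae D f G : measurable D -> measurable_fun D f -> (forall x, D x -> 0 <= f x) ->
  {ae mu, forall x, D x -> f x <= G x} -> \int[mu]_(x in D) f x <= \int[mu]_(x in D) G x.
Proof.
move=> mD mf f0 fG; rewrite [leRHS]integralE.
(* Almost everywhere [G >= f >= 0], so the negative part of [G] integrates to 0. *)
rewrite (integral_ae0 (f := G^\-)) ?sube0//; first last.
- apply: filterS fG => x H Dx; have := le_trans (f0 _ Dx) (H Dx).
  by move=> G0; rewrite funenegE; apply/max_idPr; rewrite oppe_le0.
have [N [mN N0 HN]] := fG.
rewrite (ge0_negligible_integral mN mD mf f0 N0).
apply: le_integral_patch => [x [Dx _]|x _|x]; [exact: f0|by []|rewrite /patch].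
case: ifPn => [/set_mem[Dx Nx]|_]; last by case: ifPn => // _; exact: funepos_ge0.
rewrite mem_set//; apply: (@le_trans _ _ (G x)); last by rewrite funeposE le_max lexx.
by apply: contrapT => H; apply: Nx; apply: HN => /= /(_ Dx).
Qed.

End nonmeasurable_integrand.

Section energy.
Context {R : realType} {n : nat}.
Notation Rn := 'rV[R]_n.+1.
Notation Ln := (leb_space R n).
Notation mu := (@leb R n).
Notation vec := 'cV[R]_n.+1.
Notation mat := 'M[R]_n.+1.
Variable Omega : set Rn.
Hypotheses (oO : open Omega) (bO : bounded_set Omega).
Notation L1 f := (mu.-integrable (Omega : set Ln) (EFin \o (f : Ln -> R))).
Notation L2 := (L2 Omega).
Notation L1cvg := (L1cvg Omega).
Notation L2cvg := (L2cvg Omega).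
Variable B : Rn -> mat.
Hypothesis hB : [lipschitz B x | x in Omega].
Notation wgrad := (wgrad Omega B).
Notation gradB := (gradB B).
Implicit Types (u v w : Rn -> R) (i j : 'I_n.+1) (g q : Rn -> vec).

Let mO : measurable (Omega : set Ln). Proof. exact: open_leb_measurable. Qed.
Let fO : (mu Omega < +oo)%E. Proof. exact: leb_bounded_fin. Qed.

(** On the set where all [S k] are at least [e], Chebyshev's inequality bounds [e] times its measure
    by every integral of [S k]. This replaces the choice of an almost everywhere convergent
    subsequence. *)
Lemma ae_inf_eq0 (S : nat -> Rn -> R) : (forall k x, 0 <= S k x) -> (forall k, L1 (S k)) ->
  \int[mu]_(x in Omega) S k x @[k --> \oo] --> (0 : R) ->
  ae_in Omega (fun x => forall m : nat, exists k, S k x < m.+1%:R^-1).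
Proof.
move=> S0 Si H; apply: ae_in_nat => m; set e : R := m.+1%:R^-1.
have e0 : 0 < e by rewrite invr_gt0.
pose A : set Ln := \bigcap_k (Omega `&` [set x | e <= S k x]).
have mA : measurable A.
  apply: bigcapT_measurable => k; have : measurable (Omega `&` S k @^-1` `[e, +oo[%classic : set Ln).
    by apply: (L1_meas (Si k)) => //; exact: measurable_itv.
  rewrite (_ : S k @^-1` _ = [set x | e <= S k x])//.
  by apply/seteqP; split => x /=; rewrite in_itv/= andbT.
have AO : A `<=` Omega by move=> x /(_ 0%N I) [].
exists A; split => //; last first.
  move=> x /= Hx k _; split; first by apply: contrapT => Ox; apply: Hx.
  by rewrite /= leNgt; apply/negP => Sk; apply: Hx => _; exists k.
have Afin : (mu A < +oo)%E by apply: le_lt_trans fO; exact: le_lebesgue_outer.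
have iA : L1 (\1_A : Rn -> R).
  apply: (@L1_bounded _ _ _ oO bO _ 1); first by apply: measurable_funTS; exact: measurable_indic.
  by move=> x _; rewrite indicE; case: (_ \in _); rewrite ?normr1 ?normr0.
have E : \int[mu]_(x in Omega) (\1_A x : R) = fine (mu A).
  by rewrite /Rintegral integral_indic// setIidl.
have le k : e * fine (mu A) <= \int[mu]_(x in Omega) S k x.
  rewrite -E -RintegralZl//; apply: le_Rintegral => //; first exact: (L1Z oO).
  move=> x Ox; rewrite indicE; case: (boolP (x \in A)) => [/set_mem/(_ k I)[_]|_]; rewrite ?mulr1//.
  by rewrite mulr0.
have : e * fine (mu A) <= 0 by apply: (cvgr_to_ge H); apply: nearW.
rewrite pmulr_rle0// => A0; apply/eqP; rewrite eq_le measure_ge0 andbT.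
have Af : mu A \is a fin_num by rewrite ge0_fin_numE.
by rewrite -(fineK Af) lee_fin.
Qed.

(* The range of [B x] is closed, and [g x] is a limit point of it for almost
   every x. *)
Lemma range_pinv (f : nat -> Rn -> R) g : (forall i, L1cvg (fun k x => gradB (f k) x i 0) (fun x => g x i 0)) ->
  ae_in Omega (fun x => B x *m (pinvmx (B x) *m g x) = g x).
Proof.
move=> fg; pose S k x := \sum_i `|gradB (f k) x i 0 - g x i 0|.
have dL k i : L1 (fun x => `|gradB (f k) x i 0 - g x i 0|).
  by have [h1 h2 _] := fg i; apply: L1_norm; exact: (L1B oO).
have Si k : L1 (S k) by exact: (L1_sum oO).
have Sc : \int[mu]_(x in Omega) S k x @[k --> \oo] --> (0 : R).
  rewrite (_ : (fun k => _) = fun k => \sum_i \int[mu]_(x in Omega) `|gradB (f k) x i 0 - g x i 0|).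
    by apply: cvg0_sum => i; case: (fg i).
  apply/funext => k; exact: (Rintegral_fsum oO (fun i => dL k i)).
have S0 k x : 0 <= S k x by apply: sumr_ge0.
apply: ae_inS (ae_inf_eq0 S0 Si Sc) => x Ox Hx.
rewrite mulmxA; set P := B x *m pinvmx (B x).
(* [P] projects onto the range of [B x] and fixes the approximants, so the defect [P g - g] is at
   most a constant times the distance [S k x] from [g x] to [gradB (f k) x]. *)
have Ph k : P *m gradB (f k) x = gradB (f k) x.
  have -> : gradB (f k) x = B x *m \col_j partial j (f k) x.
    by apply/colP => i; rewrite !mxE; apply: eq_bigr => j _; rewrite mxE.
  by rewrite mulmxA /P mulmxKpV.
apply/eqP; rewrite -subr_eq0; apply/eqP/colP => i; rewrite [RHS]mxE; apply/eqP; rewrite -normr_le0.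
set c := \sum_j `|P i j| + 1; have c0 : 0 < c by rewrite ltr_wpDl// sumr_ge0.
have le k : `|(P *m g x - g x) i 0| <= c * S k x.
  have -> : P *m g x - g x = P *m (g x - gradB (f k) x) - (g x - gradB (f k) x).
    by rewrite mulmxBr Ph opprB addrA subrK.
  rewrite mxE [X in _ + X]mxE [X in X - _]mxE; apply: le_trans (ler_normB _ _) _; rewrite mulrDl mul1r.
  have dS j : `|(g x - gradB (f k) x) j 0| <= S k x.
    rewrite mxE [X in _ + X]mxE distrC /S (bigD1 j)//= lerDl; exact: sumr_ge0.
  apply: lerD; last exact: dS.
  apply: le_trans (ler_norm_sum _ _ _) _; rewrite mulr_suml; apply: ler_sum => j _.
  by rewrite normrM ler_wpM2l.
apply/ler_addgt0Pr => e e0; rewrite add0r.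
have ec : 0 < e / c by rewrite divr_gt0.
have [m Hm] := filter_ex (near_infty_natSinv_lt (PosNum ec)).
have [k Hk] := Hx m; apply: le_trans (le k) _; rewrite mulrC -ler_pdivlMr//.
exact/ltW/(lt_trans Hk).
Qed.

Lemma L1_ind w (s : R) : measurable_in Omega w -> L1 (fun x => (s < w x)%R%:R).
Proof.
move=> mw; apply: (@L1_bounded _ _ _ oO bO _ 1); last by move=> x _; case: (s < w x)%R; rewrite ?normr1 ?normr0.
apply: (@measurableT_comp _ _ _ _ _ _ (fun t => (s < t)%R%:R : R)) => //.
rewrite (_ : (fun t => _) = \1_`]s, +oo[); first exact: measurable_indic.
by apply/funext => t; rewrite indicE mem_setE in_itv/= andbT.
Qed.

(** Clearing the denominator is delicate only when the gradient integral is 0: a nonzero numerator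
    would then make the quotient [+oo], against the bound [r]. *)
Lemma X_norm_le phi v q (r : R) : in_WA0 1 Omega B v q -> (X_norm Omega B phi <= r%:E)%E ->
  (\int[mu]_(x in Omega) `|v x * phi x|%:E <= (r * \int[mu]_(x in Omega) enorm (q x))%:E)%E.
Proof.
move=> vq Xr; have [/in_WA_integrable iE _] := vq.
have [mv mq] := in_WA_meas vq.1.
have iq : L1 (fun x => enorm (q x)).
  apply: le_integrable iE => //; first by apply/measurable_EFinP; exact: enorm_meas.
  by move=> x _ /=; rewrite lee_fin !expr1 [leLHS]ger0_norm ?enorm_ge0// [leRHS]ger0_norm ?addr_ge0 ?enorm_ge0// lerDr.
set b := \int[mu]_(x in Omega) enorm (q x).
have bE : (\int[mu]_(x in Omega) (enorm (q x))%:E)%E = b%:E.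
  by rewrite /b /Rintegral fineK//; exact: integrable_fin_num iq.
have b0 : 0 <= b by apply: Rintegral_ge0 => x _; exact: enorm_ge0.
set a := (\int[mu]_(x in Omega) _)%E.
have a0 : (0 <= a)%E by apply: integral_ge0 => x _; rewrite lee_fin.
have H : (a / b%:E <= r%:E)%E.
  by apply: le_trans Xr; apply: ereal_sup_ubound; exists v, q; rewrite bE.
have [bz|bp] := eqVneq b 0; last first.
  by move: H; rewrite inver (negbTE bp) lee_pdivrMr ?lt0r ?bp// EFinM.
move: H; rewrite bz inve0 mulr0; have [->//|an0] := eqVneq a 0%E.
by rewrite gt0_muley ?leye_eq// lt0e an0.
Qed.

(** Let [J] and [Q] be the integrals of [tau |g|] and [tau |g|^2]. Equation and admissibility give
    [k Q <= r J]. Expanding [(k |g| - r)^2 >= 0] with weight [tau / k], and bounding [tau] by the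
    indicator of [w > s], gives [2 r J <= k Q + (r^2 / k) |{w > s}|]; the term [k Q] is absorbed. *)
Lemma energy_est (k K r s h : R) cA phi u (gu : Rn -> vec) w g :
  0 < k -> 0 < r -> 0 <= s -> 0 < h ->
  structural Omega B k K cA -> measurable_in Omega phi -> (X_norm Omega B phi <= r%:E)%E ->
  (forall w gw, in_WA0 2 Omega B w gw -> ae_in Omega (fun x => 0 <= w x) ->
    (- (\int[mu]_(x in Omega) (formA (B x) (cA x (u x)) (gw x) (gu x))%:E) >=
     \int[mu]_(x in Omega) (phi x * w x)%:E)%E) ->
  in_WA0 2 Omega B w g -> ae_in Omega (fun x => w x != 0 -> gu x = g x) ->
  \int[mu]_(x in Omega) enorm (dstrunc s h (w x) *: g x) <= r / k * \int[mu]_(x in Omega) (s < w x)%R%:R.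
Proof.
move=> k0 r0 s0 h0 HA mphi Xr Hu wg gug.
have [f [lf fw fg]] := in_WA0_2E oO bO hB wg.
set T := strunc s h; set tau := dstrunc s h.
have lT kk : lipschitz_c Omega (fun x => T (f kk x)) by exact: (lipc_comp (strunc_lip s h0) (strunc0 s0 h0) (lf kk)).
have cT : L2cvg (fun k x => T (f k x)) (fun x => T (w x)) by exact: (L2cvg_comp oO (strunc_lip s h0) (strunc0 s0 h0)).
have cg : forall i, L2cvg (fun k x => gradB (fun y => T (f k y)) x i 0) (fun x => (tau (w x) *: g x) i 0).
  by apply: (L2cvg_grad_comp oO bO hB (strunc_lip s h0) (strunc0 s0 h0) (quad_der_strunc s h0) (dstrunc_itv s h0) (dstrunc_lip s h0)).
(* [T (w)] plays two parts: a test function of the equation in W_0^{1,2}, and a competitor in the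
   norm of [phi] in W_0^{1,1}. *)
have W2 := in_WA0_2I oO bO hB lT cT cg.
have W1 := in_WA0_1I oO bO hB lT (L2cvg_L1cvg oO bO cT) (fun i => L2cvg_L1cvg oO bO (cg i)).
have T0 x : 0 <= T (w x) by exact: (strunc_ge0 s h0).
have t01 x : 0 <= tau (w x) <= 1 by exact: (dstrunc_itv s h0).
have [w2 g2] := in_WA2 oO wg.1; have [mw _] := w2.
have Rg := range_pinv (fun i => L2cvg_L1cvg oO bO (fg i)).
have mtw : measurable_in Omega (fun x => tau (w x)).
  by apply: (measurableT_comp (lip1_measurable (dstrunc_lip s h0))).
have iJ : L1 (fun x => tau (w x) * enorm (g x)).
  have := @L1_mul _ _ _ oO (fun x => enorm (g x)) (fun x => tau (w x)) 1 (L1_enorm oO (fun i => L2_L1 oO bO (g2 i))) mtw.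
  rewrite (_ : (fun x => enorm (g x) * _) = fun x => tau (w x) * enorm (g x)); last by apply/funext => x; rewrite mulrC.
  by apply => x _; have /andP[? ?] := t01 x; rewrite ger0_norm.
have ie2 : L1 (fun x => enorm (g x) ^+ 2).
  rewrite (_ : (fun x => _) = fun x => \sum_i g x i 0 ^+ 2); last by apply/funext => x; rewrite enorm_sqr.
  by apply: (L1_sum oO) => i; have [] := g2 i.
have iQ : L1 (fun x => tau (w x) * enorm (g x) ^+ 2).
  have := @L1_mul _ _ _ oO _ (fun x => tau (w x)) 1 ie2 mtw.
  rewrite (_ : (fun x => enorm (g x) ^+ 2 * _) = fun x => tau (w x) * enorm (g x) ^+ 2); last by apply/funext => x; rewrite mulrC.
  by apply => x _; have /andP[? ?] := t01 x; rewrite ger0_norm.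
have JE : \int[mu]_(x in Omega) enorm (tau (w x) *: g x) = \int[mu]_(x in Omega) (tau (w x) * enorm (g x)).
  by apply: eq_Rintegral => x _; rewrite enormZ ger0_norm//; have /andP[] := t01 x.
rewrite JE; set J := \int[mu]_(x in Omega) (tau (w x) * enorm (g x)).
set Q := \int[mu]_(x in Omega) (tau (w x) * enorm (g x) ^+ 2).
have Q1 : ((k * Q)%:E <= \int[mu]_(x in Omega) (formA (B x) (cA x (u x)) (tau (w x) *: g x) (gu x))%:E)%E.
  have -> : (k * Q)%:E = (\int[mu]_(x in Omega) (k * (tau (w x) * enorm (g x) ^+ 2))%:E)%E.
    rewrite /Q -RintegralZl// /Rintegral fineK//; exact: integrable_fin_num (L1Z oO k iQ).
  apply: le_integral_ae => //.
  - by apply/measurable_EFinP; exact: L1_meas (L1Z oO k iQ).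
  - by move=> x _; rewrite lee_fin mulr_ge0 ?(ltW k0)// mulr_ge0 ?sqr_ge0//; have /andP[] := t01 x.
  have H : ae_in Omega (fun x => k * (tau (w x) * enorm (g x) ^+ 2) <=
      formA (B x) (cA x (u x)) (tau (w x) *: g x) (gu x)).
    apply: ae_inS2 HA (ae_inS2 (S := fun x => B x *m (pinvmx (B x) *m g x) = g x /\ (w x != 0 -> gu x = g x)) _ Rg gug) => [x Ox HAx [Rx gx]|x _ //].
    (* Where [tau (w x)] is nonzero, so is [w x], hence [gu = g] and [formA] is [tau] times a
       quadratic form at a vector [xi] with [B xi = g]; there the lower structural bound reads
       [k |g|^2]. *)
    have [tz|tn] := eqVneq (tau (w x)) 0.
      by rewrite tz mul0r mulr0 scale0r /formA /qform mulmx0 trmx0 !mul0mx mxE.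
    have wn : w x != 0.
      apply: contra tn => /eqP ->; rewrite eq_le; have /andP[-> _] := dstrunc_itv s h0 0; rewrite andbT.
      by apply: le_trans (dstrunc_le_ind s h0 0) _; rewrite ltNge s0.
    rewrite (gx wn) /formA; set xi := pinvmx (B x) *m g x in Rx *.
    have [+ _] := HAx (u x) xi.
    have -> : qform ((B x)^T *m B x) xi xi = enorm (g x) ^+ 2.
      rewrite enorm_sqr -Rx /qform mulmxA -trmx_mul -mulmxA mxE.
      by apply: eq_bigr => i _; rewrite mxE -expr2.
    have -> : qform (cA x (u x)) (pinvmx (B x) *m (tau (w x) *: g x)) xi = tau (w x) * qform (cA x (u x)) xi xi.
      by rewrite /qform -scalemxAr -/xi linearZ/= -!scalemxAl mxE.
    by move=> Hq; rewrite mulrCA; apply: ler_wpM2l => //; have /andP[] := t01 x.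
  by move: H; rewrite /ae_in; apply: filterS => x H /H; rewrite lee_fin.
have mT : measurable_in Omega (fun x => T (w x)) by case: cT => _ [].
have Q2 : (\int[mu]_(x in Omega) (formA (B x) (cA x (u x)) (tau (w x) *: g x) (gu x))%:E <= (r * J)%:E)%E.
  have := Hu _ _ W2 (ae_inP (fun x _ => T0 x)); rewrite leeNr => /le_trans; apply.
  rewrite /J -JE; apply: le_trans (X_norm_le W1 Xr).
  rewrite (_ : (\int[mu]_(x in Omega) `|_|%:E)%E = (\int[mu]_(x in Omega) `|(phi x * T (w x))%:E|)%E); last first.
    by apply: eq_integral => x _; rewrite abse_EFin mulrC.
  apply: le_trans (le_abse_integral _ _ _) => //; first by rewrite -abseN lee_abs.
  by apply/measurable_EFinP; exact: measurable_funM.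
have kQ : k * Q <= r * J by rewrite -lee_fin; exact: le_trans Q1 Q2.
set m := \int[mu]_(x in Omega) (s < w x)%R%:R.
have im : L1 (fun x => (s < w x)%R%:R : R) by exact: L1_ind.
have young : 2 * r * J <= k * Q + r ^+ 2 / k * m.
  rewrite /Q /J /m -!RintegralZl// -RintegralD//; [|exact: (L1Z oO)..].
  apply: le_Rintegral => //; [exact: (L1Z oO)|by apply: (L1D oO); exact: (L1Z oO)|].
  move=> x _; have /andP[tx _] := t01 x; have tm := dstrunc_le_ind s h0 (w x).
  rewrite -/tau in tm; set t := tau _ in tx tm *; set a := enorm _.
  have rk : 0 <= r ^+ 2 / k by rewrite divr_ge0 ?sqr_ge0// ltW.
  apply: (@le_trans _ _ (k * (t * a ^+ 2) + r ^+ 2 / k * t)); last by rewrite lerD2l ler_wpM2l.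
  rewrite -subr_ge0 (_ : _ - _ = t / k * (k * a - r) ^+ 2); last by field; rewrite gt_eqF.
  by rewrite mulr_ge0 ?sqr_ge0// divr_ge0// ltW.
have : r * J <= r * (r / k * m).
  rewrite (_ : r * (r / k * m) = r ^+ 2 / k * m); last by ring.
  lra.
by rewrite ler_pM2l.
Qed.

End energy.

(** * Decay of superlevel sets *)

Section Phi_growth.
Context {R : realType}.
Variable m : R.
Hypothesis m2 : 2 < m.
Implicit Types t y : R.

Let m0 : 0 < m. Proof. exact: lt_trans m2. Qed.
Let mn0 : m != 0. Proof. by rewrite gt_eqF. Qed.
Let E := E_ m.
Let E0 : 0 < E. Proof. exact: expR_gt0. Qed.

Let lnE t : E <= t -> 2 `^ m <= ln t.
Proof. by move=> Et; rewrite -(expRK (2 `^ m)) ler_ln// posrE ?expR_gt0//; exact: lt_le_trans E0 Et. Qed.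

Let root t : 2 `^ m <= t -> 2 <= t `^ m^-1.
Proof.
move=> mt; have E2 : 2 = (2 `^ m) `^ m^-1 :> R by rewrite -powRrM divff// powRr1.
rewrite [leLHS]E2; apply: ge0_ler_powR => //; rewrite ?nnegrE ?powR_ge0 ?invr_ge0 ?(ltW m0)//.
by apply: le_trans mt; exact: powR_ge0.
Qed.

Lemma Phi_top_gt0 t : 0 < Phi_top m t. Proof. exact: expR_gt0. Qed.

Let c0 : 0 < Phi_top m E / E. Proof. exact: divr_gt0 (Phi_top_gt0 E) E0. Qed.

Lemma Phi_top_le t y : E <= t -> t <= y -> Phi_top m t <= Phi_top m y.
Proof.
move=> Et ty; have Ey := le_trans Et ty; rewrite ler_expR.
have l0 := lnE Et; have l1 := lnE Ey.
have p0 : 0 <= 2 `^ m by exact: powR_ge0.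
apply: ge0_ler_powR; rewrite ?nnegrE ?addr_ge0 ?powR_ge0 ?(ltW m0)// lerD2r.
apply: ge0_ler_powR; rewrite ?nnegrE ?invr_ge0 ?(ltW m0) ?(le_trans p0)//.
by rewrite ler_ln// posrE; [exact: lt_le_trans E0 Et|exact: lt_le_trans E0 Ey].
Qed.

Lemma Phi0 : Phi_ m 0 = 0.
Proof. by rewrite /Phi_ leNgt E0/= mulr0. Qed.

Let Phi_small t : t < E -> Phi_ m t = Phi_top m E / E * t.
Proof. by move=> tE; rewrite /Phi_ leNgt tE. Qed.

Let Phi_large t : E <= t -> Phi_ m t = Phi_top m t.
Proof. by move=> tE; rewrite /Phi_ tE. Qed.

Lemma Phi_homo : {homo Phi_ m : t y / t <= y}.
Proof.
move=> t y ty; have [Et|Et] := leP E t; have [Ey|Ey] := leP E y.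
- rewrite (Phi_large Et) (Phi_large Ey); exact: Phi_top_le Et ty.
- by have := le_lt_trans ty Ey; rewrite ltNge Et.
- rewrite (Phi_small Et) (Phi_large Ey); apply: le_trans (Phi_top_le (lexx E) Ey).
  by rewrite -[leRHS](divfK (lt0r_neq0 E0)) (ler_pM2l c0); exact: ltW.
- by rewrite (Phi_small Et) (Phi_small Ey) (ler_pM2l c0).
Qed.

Lemma Phi_ge0 t : 0 <= t -> 0 <= Phi_ m t.
Proof. by move=> t0; rewrite -Phi0; exact: Phi_homo. Qed.

Lemma Phi_gt0 t : 0 < t -> 0 < Phi_ m t.
Proof.
move=> t0; rewrite /Phi_; case: ifPn => _; first exact: Phi_top_gt0.
exact: mulr_gt0 c0 t0.
Qed.

Lemma Phi_meas : measurable_fun setT (Phi_ m).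
Proof. exact: (nondecreasing_measurable measurableT Phi_homo). Qed.

(** Needed so that [Phi_inv] is a genuine right inverse on nonnegative values. Both pieces of [Phi_]
    are inverted explicitly. *)
Lemma Phi_surj y : 0 <= y -> exists2 t, 0 <= t & Phi_ m t = y.
Proof.
move=> y0; have [yE|yE] := ltP y (Phi_top m E).
  exists (y / (Phi_top m E / E)); first by rewrite divr_ge0// ltW.
  rewrite Phi_small; first by rewrite mulrCA divff ?mulr1//; exact: lt0r_neq0 c0.
  by rewrite ltr_pdivrMr// mulrC divfK//; exact: lt0r_neq0 E0.
have yp : 0 < y by apply: lt_le_trans yE; exact: Phi_top_gt0.
have p0 : 0 <= 2 `^ m by exact: powR_ge0.
(* The value at [E] is thus [exp (3^m)]. Above it [(ln y)^(1/m)] is at least 3; subtracting 1 leaves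
   at least 2, so the preimage lies beyond [E]. *)
have rE : ln E `^ m^-1 = 2 by rewrite expRK -powRrM divff// powRr1.
have l3 : 3 `^ m <= ln y.
  have := yE; rewrite -ler_ln ?posrE ?Phi_top_gt0// /Phi_top expRK rE.
  by rewrite (_ : 2 + 1 = 3 :> R)//; lra.
have ly0 : 0 <= ln y by apply: le_trans l3; exact: powR_ge0.
set z := ln y `^ m^-1.
have z3 : 3 <= z.
  have E3 : 3 = (3 `^ m) `^ m^-1 :> R by rewrite -powRrM divff// powRr1.
  rewrite [leLHS]E3; by apply: ge0_ler_powR => //; rewrite ?nnegrE ?powR_ge0 ?invr_ge0 ?(ltW m0).
have z1 : 0 <= z - 1 by lra.
exists (expR ((z - 1) `^ m)); first exact: expR_ge0.
rewrite /Phi_ -/E (_ : E <= _); last first.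
  by rewrite ler_expR; apply: ge0_ler_powR; rewrite ?nnegrE ?(ltW m0)//; lra.
rewrite /Phi_top expRK -powRrM divff// powRr1// subrK /z -powRrM mulVf// powRr1//.
by rewrite lnK.
Qed.

(** Surjectivity gives [Phi_ m (Phi_inv y) = y], and monotonicity of [Phi_] forbids a preimage below
    1. *)
Lemma Phi_inv_ge1 y : Phi_ m 1 < y -> 1 <= Phi_inv (Phi_ m) y.
Proof.
move=> y1; rewrite leNgt; apply/negP => lt1.
have y0 : 0 <= y by apply: le_trans (ltW y1); exact: Phi_ge0.
have [t t0 ty] := Phi_surj y0.
have : Phi_ m (Phi_inv (Phi_ m) y) = y.
  by rewrite /Phi_inv; apply: pinvK; rewrite inE; exists t.
by move=> Ey; have := Phi_homo (ltW lt1); rewrite Ey leNgt y1.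
Qed.

(** With [x = t^(2/m)] the exponent on the right is [(x + 1)^m], the square of [(x + 1)^(m/2)].
    Since [m / 2 >= 1] this power is superadditive, so it is at least [x^(m/2) + 1 = t + 1]. *)
Lemma Phi_exp_sqr t : 0 <= t -> E <= expR (t ^+ 2) -> expR ((t + 1) ^+ 2) <= Phi_ m (expR (t ^+ 2)).
Proof.
move=> t0 Et; rewrite /Phi_ -/E Et /Phi_top expRK ler_expR.
set x := (t ^+ 2) `^ m^-1; have x0 : 0 <= x by exact: powR_ge0.
have x2 : 2 <= x by apply: root; have := lnE Et; rewrite expRK.
have m2' : 1 <= m / 2 by rewrite ler_pdivlMr// mul1r ltW.
have tx : t = x `^ (m / 2).
  rewrite /x -powRrM mulrA mulVf// mul1r -powR_mulrn// -powRrM divff ?pnatr_eq0// powRr1//.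
have key : x `^ (m / 2) + 1 <= (x + 1) `^ (m / 2).
  have split1 a : 0 < a -> a `^ (m / 2) = a * a `^ (m / 2 - 1).
    move=> a0; have := @powRD _ a 1 (m / 2 - 1); rewrite addrC subrK powRr1 ?(ltW a0)//; apply.
    by rewrite (gt_eqF a0) implybT.
  have xp : 0 < x by exact: lt_le_trans x2.
  rewrite !split1// ?addr_gt0// mulrDl mul1r; apply: lerD.
    apply: ler_wpM2l => //; apply: ge0_ler_powR; rewrite ?nnegrE ?subr_ge0 ?addr_ge0//.
    by rewrite lerDl.
  have P1 : 1 = 1 `^ (m / 2 - 1) :> R by rewrite powR1.
  rewrite [leLHS]P1; apply: ge0_ler_powR; rewrite ?nnegrE ?subr_ge0 ?addr_ge0//.
  by rewrite lerDr.
have mm : m = m / 2 * 2%:R by rewrite divfK// pnatr_eq0.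
have -> : (x + 1) `^ m = ((x + 1) `^ (m / 2)) ^+ 2.
  by rewrite [X in _ `^ X = _]mm powRrM powR_mulrn// powR_ge0.
by rewrite ler_sqr ?nnegrE ?addr_ge0 ?powR_ge0// [X in X + 1]tx.
Qed.

(* With t_k = 2^m + k/2 the levels h_k = A M_k exp(t_k^2) and the bounds
   M_(k+1) = Phi 1 * exp(-(t_k + 1)^2) make h_k decay geometrically. *)
Lemma decay_iteration (M0 : R) : 0 < M0 -> exists2 S : R, 0 <= S &
  forall (a : R -> R) (A : R), 0 < A -> (forall s, 0 <= a s) ->
    (forall s s', s <= s' -> a s' <= a s) -> a 0 <= M0 ->
    (forall s h M, 0 <= s -> 0 < h -> 0 < M -> a s <= M ->
       Phi_ m (h / (A * M)) * a (s + h) <= Phi_ m 1) ->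
    a (A * S) = 0.
Proof.
(* Starting the parameters at [K = 2^m >= 1] ensures [t_k^2 >= 2^m], that is [exp (t_k^2) >= E], the
   range of the growth estimate. *)
move=> M00; pose K := 2 `^ m : R; have K1 : 1 <= K.
  by rewrite -(powRr0 2); apply: ler_powR; [lra|exact: ltW].
have K0 : 0 <= K by exact: le_trans K1.
pose t k : R := K + k%:R / 2.
have tk k : k%:R / 2 <= t k by rewrite lerDr.
have tK k : K <= t k by rewrite lerDl divr_ge0.
have t0 k : 0 <= t k by apply: le_trans (tK k).
have tE k : E <= expR (t k ^+ 2).
  rewrite ler_expR; apply: (@le_trans _ _ (K ^+ 2)).
    by rewrite -[leLHS]mulr1 expr2 ler_wpM2l.
  by rewrite ler_sqr ?nnegrE.
pose P := Phi_ m 1; have P0 : 0 < P by exact: Phi_gt0.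
pose M k : R := if k is k'.+1 then P / expR ((t k' + 1) ^+ 2) else M0.
have Mk0 k : 0 < M k by case: k => //= k; rewrite divr_gt0// expR_gt0.
pose q : R := expR (- 2^-1).
have q1 : q < 1 by rewrite -expR0 ltr_expR oppr_lt0 invr_gt0.
have q0 : 0 < q by exact: expR_gt0.
have qq : 0 < 1 - q by rewrite subr_gt0.
pose b0 := M0 * expR (t 0%N ^+ 2); have b00 : 0 <= b0 by rewrite mulr_ge0 ?expR_ge0// ltW.
(* The first step starts from [M0] and contributes [b0]; all later ones together stay below the
   geometric series [P / (1 - q)]. The factor [A] scales out of the levels. *)
pose S := b0 + P / (1 - q); have PS : 0 <= P / (1 - q) by rewrite divr_ge0// ltW.
have S0 : 0 <= S by exact: addr_ge0.
exists S => // a A A0 a0 amono aM0 H.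
pose s k := A * \sum_(i < k) M i * expR (t i ^+ 2).
have s0 k : 0 <= s k.
  by rewrite mulr_ge0 ?(ltW A0)// sumr_ge0// => i _; rewrite mulr_ge0 ?expR_ge0 ?(ltW (Mk0 i)).
have as_ k : a (s k) <= M k.
  elim: k => [|k IH]; first by rewrite /s big_ord0 mulr0.
  have h0 : 0 < A * (M k * expR (t k ^+ 2)) by rewrite !mulr_gt0// expR_gt0.
  have := H (s k) _ (M k) (s0 k) h0 (Mk0 k) IH.
  have sE : s k.+1 = s k + A * (M k * expR (t k ^+ 2)) by rewrite /s big_ord_recr /= mulrDr.
  rewrite -sE.
  rewrite (_ : _ / (A * M k) = expR (t k ^+ 2)); last by field; rewrite !gt_eqF.
  move=> Hk; rewrite /= ler_pdivlMr ?expR_gt0// mulrC; apply: le_trans Hk.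
  by apply: ler_wpM2r => //; exact: Phi_exp_sqr.
(* The exponent is [(t_k + 1/2)^2 - (t_k + 1)^2 = - t_k - 3/4], which is at most [- k / 2]. *)
have term k : M k.+1 * expR (t k.+1 ^+ 2) <= P * q ^+ k.
  rewrite /= -mulrA ler_wpM2l ?(ltW P0)// -expRN -expRD /q -expRM_natl ler_expR.
  have -> : t k.+1 = t k + 2^-1 by rewrite /t -addn1 natrD mulrDl mul1r addrA.
  have := tk k; rewrite -[_ *+ k]mulr_natl; set x := t k; set y := k%:R; lra.
have sS k : s k <= A * S.
  apply: ler_wpM2l; first exact: ltW.
  case: k => [|k]; first by rewrite big_ord0.
  rewrite big_ord_recl /= lerD2l; apply: (@le_trans _ _ (P / (1 - q) * (1 - q ^+ k))); last first.
    by rewrite ler_piMr// lerBlDr lerDl exprn_ge0// ltW.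
  elim: k => [|k IH]; first by rewrite big_ord0 expr0 subrr mulr0.
  rewrite big_ord_recr /=; apply: (le_trans (lerD IH (term k))).
  by rewrite le_eqVlt; apply/orP; left; apply/eqP; rewrite exprS; field; rewrite gt_eqF.
(* With [exp z >= 1 + z] this gives [M (k + 1) <= 2 P / (k + 1)], and [a (A * S)] lies below all
   these bounds. *)
have nl (x y : R) : 0 <= x -> y / 2 <= x -> (y + 1) / 2 <= 1 + (x + 1) ^+ 2.
  move=> x0 xy; have -> : (x + 1) ^+ 2 = x ^+ 2 + 2 * x + 1 by ring.
  have := sqr_ge0 x; lra.
have aS : (fun=> a (A * S)) k @[k --> \oo] --> (0 : R).
  apply: (@cvg0_harmonic _ _ (2 * P)) => k; rewrite ger0_norm//.
  apply: le_trans (amono _ _ (sS k.+1)) _; apply: le_trans (as_ k.+1) _.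
  rewrite /= [2 * P]mulrC -mulrA ler_wpM2l ?(ltW P0)//.
  rewrite -[2 / _]invrK invf_div lef_pV2 ?posrE ?expR_gt0 ?divr_gt0//.
  apply: le_trans (expR_ge1Dx _); have := tk k; have := t0 k.
  by move=> u1 u2; rewrite -[k.+1]addn1 natrD; apply: nl.
by apply/esym; exact: (cvg_unique (@Rhausdorff R) aS (cvg_cst _)).
Qed.

End Phi_growth.

Section decay.
Context {R : realType} {n : nat}.
Notation Rn := 'rV[R]_n.+1.
Notation Ln := (leb_space R n).
Notation mu := (@leb R n).
Notation vec := 'cV[R]_n.+1.
Notation mat := 'M[R]_n.+1.
Variable Omega : set Rn.
Hypotheses (oO : open Omega) (bO : bounded_set Omega).
Notation L1 f := (mu.-integrable (Omega : set Ln) (EFin \o (f : Ln -> R))).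
Notation L1cvg := (L1cvg Omega).
Notation L2cvg := (L2cvg Omega).
Variable B : Rn -> mat.
Hypothesis hB : [lipschitz B x | x in Omega].
Notation gradB := (gradB B).
Implicit Types (u v w : Rn -> R) (i j : 'I_n.+1) (g q : Rn -> vec).

Let mO : measurable (Omega : set Ln). Proof. exact: open_leb_measurable. Qed.

Lemma L1cvg_enorm (h : nat -> Rn -> vec) g : (forall i, L1cvg (fun k x => h k x i 0) (fun x => g x i 0)) ->
  L1cvg (fun k x => enorm (h k x)) (fun x => enorm (g x)).
Proof.
move=> hg; have hi k i : L1 (fun x => h k x i 0) by case: (hg i).
have gi i : L1 (fun x => g x i 0) by case: (hg i).
have di k i : L1 (fun x => `|h k x i 0 - g x i 0|) by apply: L1_norm; exact: (L1B oO).
apply: (L1cvg_le (b := fun k => \sum_i \int[mu]_(x in Omega) `|h k x i 0 - g x i 0|)).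
- by move=> k; exact: L1_enorm.
- exact: L1_enorm.
- move=> k; rewrite -(Rintegral_fsum oO (di k)); apply: le_Rintegral => //.
  + by apply: L1_norm; apply: (L1B oO); exact: L1_enorm.
  + exact: (L1_sum oO).
  + by move=> x _; exact: enorm_dist.
- by apply: cvg0_sum => i; case: (hg i).
Qed.

(** The bump inequality is stated for Lipschitz functions, so it is applied to [lam * T (f k)]. The
    scaling makes the right side eventually less than 1, which forces the integral of [Phi_ m |F k|]
    below [Phi_ m 1]; Chebyshev's inequality is then transferred to the limit [w]. *)
Lemma decay (m C s h lam : R) w g : 2 < m ->
  (forall w g, lipschitz_c Omega w -> is_gradA Omega B w g ->
    ((Phi_inv (Phi_ m) (fine (\int[mu]_(x in Omega) (Phi_ m `|w x|)%:E)))%:E <=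
     C%:E * (\int[mu]_(x in Omega) (enorm (g x))%:E))%E) ->
  0 <= C -> 0 <= s -> 0 < h -> 0 < lam -> in_WA0 2 Omega B w g ->
  C * (lam * \int[mu]_(x in Omega) enorm (dstrunc s h (w x) *: g x)) < 1 ->
  Phi_ m (lam * h / 4) * \int[mu]_(x in Omega) (s + h < w x)%R%:R <= Phi_ m 1.
Proof.
move=> m2 bump C0 s0 h0 l0 wg small.
have [f [lf fw fg]] := in_WA0_2E oO bO hB wg.
set T := strunc s h; set tau := dstrunc s h.
have T0 := strunc0 s0 h0; have TL := strunc_lip s h0.
have lT kk : lipschitz_c Omega (fun x => T (f kk x)) by exact: (lipc_comp TL T0 (lf kk)).
have cT := L2cvg_L1cvg oO bO (L2cvg_comp oO TL T0 fw).
have cg i := L2cvg_L1cvg oO bO (L2cvg_grad_comp oO bO hB TL T0 (quad_der_strunc s h0) (dstrunc_itv s h0) (dstrunc_lip s h0) lf fw fg i).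
have cJ := L1cvg_Rintegral oO (L1cvg_enorm cg).
pose F k x := lam * T (f k x).
have lF k : lipschitz_c Omega (F k) by exact: lipcZ.
have gF k : ae_in Omega (fun x => gradB (F k) x = lam *: gradB (fun y => T (f k y)) x).
  have q0 : quad_der (fun t => lam * t) (fun=> lam) 0.
    by move=> a b; rewrite mulrBr subrr normr0 mul0r.
  exact: (gradB_comp_ae Omega B q0 (lipcW (lT k))).
have iJ k : L1 (fun x => enorm (gradB (fun y => T (f k y)) x)).
  by apply: (L1_enorm oO) => i; exact: (gradB_L1 oO bO hB i (lipcW (lT k))).
have iF k : L1 (fun x => enorm (gradB (F k) x)).
  by apply: (L1_enorm oO) => i; exact: (gradB_L1 oO bO hB i (lipcW (lF k))).
have EF k : \int[mu]_(x in Omega) enorm (gradB (F k) x) = lam * \int[mu]_(x in Omega) enorm (gradB (fun y => T (f k y)) x).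
  rewrite -RintegralZl//; apply: (Rintegral_ae_eq oO (iF k) (L1Z oO lam (iJ k))).
  by apply: ae_inS (gF k) => x _ ->; rewrite enormZ gtr0_norm.
have iPhi k : L1 (fun x => Phi_ m `|F k x|).
  have [M M0 FM] := lipc_bounded (lF k).
  apply: (@L1_bounded _ _ _ oO bO _ (Phi_ m M)).
    apply: (measurableT_comp (Phi_meas m2)); apply: measurableT_comp => //; exact: lipc_meas.
  by move=> x _; rewrite ger0_norm ?Phi_ge0//; exact: Phi_homo.
have cJl : C * (lam * \int[mu]_(x in Omega) enorm (gradB (fun y => T (f k y)) x)) @[k --> \oo] -->
    C * (lam * \int[mu]_(x in Omega) enorm (tau (w x) *: g x)).
  by apply: cvgMl_tmp; apply: cvgMl_tmp.
have ev : \forall k \near \oo, \int[mu]_(x in Omega) Phi_ m `|F k x| <= Phi_ m 1.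
  have : \forall k \near \oo, C * (lam * \int[mu]_(x in Omega) enorm (gradB (fun y => T (f k y)) x)) < 1.
    exact: cvgr_lt cJl _ small.
  apply: filterS => k Hk; rewrite leNgt; apply/negP => /(Phi_inv_ge1 m2) I1.
  have := bump _ _ (lF k) (wgrad_is_gradA oO bO hB (wgrad_lip oO bO hB (lF k))).
  have -> : (\int[mu]_(x in Omega) (enorm (gradB (F k) x))%:E = (\int[mu]_(x in Omega) enorm (gradB (F k) x))%:E)%E.
    by rewrite /Rintegral fineK//; exact: integrable_fin_num (iF k).
  rewrite -EFinM lee_fin EF => /(le_trans I1); by rewrite leNgt Hk.
set P := Phi_ m (lam * h / 4).
have P0 : 0 <= P by apply: Phi_ge0 => //; rewrite !mulr_ge0 ?invr_ge0// ltW.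
have [mw _] := (in_WA2 oO wg.1).1.
have [iTf iTw cTf] := cT.
(* Where [w > s + h] one has [T (w) >= h / 2]. Either [T (f k) >= h / 4], and the integrand with
   [Phi_] is at least [P]; or [T (f k)] and [T (w)] differ by at least [h / 4], and the error term,
   of vanishing integral, covers [P]. *)
have key k : P * \int[mu]_(x in Omega) (s + h < w x)%R%:R <=
    \int[mu]_(x in Omega) Phi_ m `|F k x| + P * (4 / h) * \int[mu]_(x in Omega) `|T (f k x) - T (w x)|.
  have i1 : L1 (fun x => (s + h < w x)%R%:R : R) by exact: L1_ind.
  have i2 : L1 (fun x => `|T (f k x) - T (w x)|) by apply: L1_norm; exact: (L1B oO).
  rewrite -!RintegralZl// -RintegralD//; last exact: (L1Z oO).
  apply: le_Rintegral => //; [exact: (L1Z oO)|by apply: (L1D oO) => //; exact: (L1Z oO)|].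
  move=> x _; have Q0 : 0 <= P * (4 / h) by rewrite mulr_ge0// divr_ge0// ltW.
  case: (ltP (s + h) (w x)) => sw /=; last first.
    by rewrite mulr0 addr_ge0 ?Phi_ge0// mulr_ge0.
  rewrite mulr1; have Tw := strunc_ge_half h0 (ltW sw); rewrite -/T in Tw.
  have [Tf|Tf] := leP (h / 4) (T (f k x)).
    rewrite -[leLHS]addr0; apply: lerD; last by rewrite mulr_ge0.
    apply: Phi_homo => //; rewrite /F normrM gtr0_norm// -mulrA ler_wpM2l ?(ltW l0)//.
    exact: le_trans (ler_norm _).
  rewrite -[leLHS]add0r; apply: lerD; first exact: Phi_ge0.
  rewrite -mulrA; apply: ler_peMr => //; rewrite -ler_pdivrMl ?divr_gt0// invf_div mulr1.
  rewrite distrC; apply: le_trans (ler_norm _); move: Tw Tf; set a := T _; set b := T _; lra.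
have lim : P * (4 / h) * \int[mu]_(x in Omega) `|T (f k x) - T (w x)| @[k --> \oo] --> (0 : R).
  by rewrite -[X in _ --> X](mulr0 (P * (4 / h))); exact: cvgMl_tmp.
apply/ler_addgt0Pr => e e0; move/cvgr0Pnorm_le: lim => /(_ _ e0) lim.
have [k [k1 k2]] := filter_ex (filterI ev lim).
by apply: le_trans (key k) _; apply: lerD => //; apply: le_trans k2; exact: ler_norm.
Qed.

End decay.

(** * The essential bound above one level *)

Section boundedness.
Context {R : realType} {n : nat}.
Notation Rn := 'rV[R]_n.+1.
Notation Ln := (leb_space R n).
Notation mu := (@leb R n).
Notation vec := 'cV[R]_n.+1.
Notation mat := 'M[R]_n.+1.
Variable Omega : set Rn.
Hypotheses (oO : open Omega) (bO : bounded_set Omega).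
Notation L1 f := (mu.-integrable (Omega : set Ln) (EFin \o (f : Ln -> R))).
Variable B : Rn -> mat.
Hypothesis hB : [lipschitz B x | x in Omega].
Implicit Types (u v w : Rn -> R) (g q : Rn -> vec).

Let mO : measurable (Omega : set Ln). Proof. exact: open_leb_measurable. Qed.

Lemma Rintegral_eq0_ae (f : Rn -> R) : L1 f -> (forall x, 0 <= f x) -> \int[mu]_(x in Omega) f x = 0 ->
  ae_in Omega (fun x => f x = 0).
Proof.
move=> fi f0 If.
have E : (\int[mu]_(x in Omega) `|(f x)%:E| = 0)%E.
  rewrite -[RHS]/(0%:E) -If /Rintegral fineK; last exact: integrable_fin_num fi.
  by apply: eq_integral => x _; rewrite abse_EFin ger0_norm.
have [+ _] := ae_eq_integral_abs mu mO (measurable_int _ fi).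
move=> /(_ E); rewrite /ae_in; apply: filterS => x H Ox.
by have /= [] := H Ox.
Qed.

(** The zero function competes in the supremum, with quotient 0. *)
Lemma X_norm_ge0 phi : (0 <= X_norm Omega B phi)%E.
Proof.
have l0 : lipschitz_c Omega (fun=> 0 : R).
  apply/lipschitz_cP; split; first exact: lip_cst.
  rewrite /compact_support_in (_ : [set x | _] = set0) ?closure0; first by split; [exact: compact0|].
  by apply/seteqP; split => x //=; rewrite eqxx.
have g0 x : gradB B (fun=> 0) x = 0.
  by apply/colP => i; rewrite !mxE big1// => j _; rewrite /partial derive_cst mulr0.
have c0 : L1cvg Omega (fun=> fun=> 0) (fun=> 0).
  split; [by move=> _; exact: L1_cst|exact: L1_cst|].
  rewrite (_ : (fun k => _) = fun=> 0); first exact: cvg_cst.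
  by apply/funext => k; rewrite /Rintegral integral0_eq// => x _; rewrite subrr normr0.
have W : in_WA0 1 Omega B (fun=> 0) (fun=> 0).
  apply: (in_WA0_1I oO bO hB (f := fun=> fun=> 0)) => // i.
  rewrite (_ : (fun k x => _) = fun=> fun=> 0); last by apply/funext => k; apply/funext => x; rewrite g0 mxE.
  by rewrite (_ : (fun x => _) = fun=> 0)//; apply/funext => x; rewrite mxE.
apply: ereal_sup_ubound; exists (fun=> 0), (fun=> 0); split => //.
by rewrite integral0_eq ?mul0e// => x _; rewrite mul0r normr0.
Qed.

(** The function [v = u - l - w] is the nonpositive part of [u - l], so [v * w = 0]. The Leibniz
    rule gives [w (gu - g) + v g = 0] almost everywhere, and [v] vanishes where [w] does not. *)
Lemma gradient_eq_on_superlevel u gu (l : R) g :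
  in_WA 2 Omega B u gu -> in_WA0 2 Omega B (fun x => Num.max (u x - l) 0) g ->
  ae_in Omega (fun x => Num.max (u x - l) 0 != 0 -> gu x = g x).
Proof.
move=> uW wW; set w := fun x => Num.max (u x - l) 0.
have [f [lf fw fg]] := in_WA0_2E oO bO hB wW.
have wu := in_WA2_wgrad oO bO hB uW; have ww := in_WA2_wgrad oO bO hB wW.1.
have [u2 gu2] := in_WA2 oO uW; have [w2 g2] := in_WA2 oO wW.1.
have wv := wgradB oO bO hB (wgradB oO bO hB wu (wgrad_cst oO bO hB l)) ww.
have v2 : L2 Omega (fun x => u x - l - w x).
  apply: (L2B oO) => //; apply: (L2B oO) => //.
  by apply: (L2_bounded oO bO (M := `|l|)) => //; exact: measurable_cst.
have q2 i : L2 Omega (fun x => (gu x - 0 - g x) i 0).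
  rewrite (_ : (fun x => _) = fun x => gu x i 0 - g x i 0); first exact: (L2B oO).
  by apply/funext => x; rewrite subr0 mxE [X in _ + X]mxE.
have vw x : Omega x -> (u x - l - w x) * w x = 0.
  move=> _; rewrite /w; have [ul|ul] := leP (u x - l) 0; first by rewrite mulr0.
  by rewrite subrr mul0r.
apply: ae_inS (wgrad_disjoint oO bO hB lf fw fg wv v2 q2 vw) => x Ox H wx.
move: H; have /eqP := vw x Ox; rewrite mulf_eq0 (negbTE wx) orbF => /eqP ->.
rewrite scale0r addr0 subr0 => /eqP; rewrite scaler_eq0 (negbTE wx)/= subr_eq0 => /eqP //.
Qed.

Lemma ess_sup_level_bound (k m : R) : 0 < k -> 2 < m -> Orlicz_bump Omega B (Phi_ m) ->
  exists2 C : R, 0 <= C & forall (K : R) (cA : Rn -> R -> mat) phi u gu (l r : R) g,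
    structural Omega B k K cA -> measurable_in Omega phi ->
    in_WA 2 Omega B u gu ->
    (forall w gw, in_WA0 2 Omega B w gw -> ae_in Omega (fun x => 0 <= w x) ->
      (- (\int[mu]_(x in Omega) (formA (B x) (cA x (u x)) (gw x) (gu x))%:E) >=
       \int[mu]_(x in Omega) (phi x * w x)%:E)%E) ->
    in_WA0 2 Omega B (fun x => Num.max (u x - l) 0) g ->
    0 < r -> (X_norm Omega B phi <= r%:E)%E ->
    (ess_sup_in Omega u <= (l + C * r)%:E)%E.
Proof.
(* The constant of the bump inequality carries no sign; enlarging it to at least 1 allows division
   by it. *)
move=> k0 m2 [Cb0 bump0]; pose Cb := Num.max Cb0 1.
have Cb1 : 0 < Cb by rewrite lt_max ltr01 orbT.
have bump w g : lipschitz_c Omega w -> is_gradA Omega B w g ->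
    ((Phi_inv (Phi_ m) (fine (\int[mu]_(x in Omega) (Phi_ m `|w x|)%:E)))%:E <=
     Cb%:E * (\int[mu]_(x in Omega) (enorm (g x))%:E))%E.
  move=> lw gw; apply: le_trans (bump0 _ _ lw gw) _; apply: lee_wpmul2r.
    by apply: integral_ge0 => x _; rewrite lee_fin enorm_ge0.
  by rewrite lee_fin le_max lexx.
(* The superlevel sets have at most the measure of [Omega]; the [+ 1] keeps the initial bound
   positive. *)
pose M0 := fine (mu Omega) + 1.
have M00 : 0 < M0 by rewrite ltr_wpDl// fine_ge0.
have [S S0 HS] := decay_iteration m2 M00.
exists (8 * Cb / k * S); first by rewrite !mulr_ge0 ?invr_ge0 ?(ltW k0) ?(ltW Cb1).
move=> K cA phi u gu l r g HA mphi uW Hu wW r0 Xr.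
set w := fun x => Num.max (u x - l) 0.
have [[mw _] _] := in_WA2 oO wW.1.
have gug := gradient_eq_on_superlevel uW wW.
pose a (s : R) := \int[mu]_(x in Omega) (s < w x)%R%:R : R.
have ai s : L1 (fun x => (s < w x)%R%:R : R) by exact: L1_ind.
pose A := 8 * Cb / k * r.
have A0 : 0 < A by rewrite !mulr_gt0 ?invr_gt0.
have aS : a (A * S) = 0.
  apply: HS => //.
  - by move=> s; apply: Rintegral_ge0.
  - move=> s s' ss; apply: le_Rintegral => // x _; rewrite ler_nat.
    by case: (ltP s' (w x)) => // sw; rewrite (le_lt_trans ss sw).
  - apply: (@le_trans _ _ (\int[mu]_(x in Omega) (1 : R))).
      by apply: le_Rintegral => //; [exact: L1_cst|move=> x _; case: (_ < _)].
    by rewrite /Rintegral integral_cst// mul1e /M0 lerDl.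
  move=> s h M s0 h0 Mp asM.
  have J := energy_est oO bO hB k0 r0 s0 h0 HA mphi Xr Hu wW gug.
  (* Chosen so that [Cb * lam * (r / k) * M = 1 / 2], below 1 as the decay estimate requires; then
     [lam * h / 4 = h / (A * M)] with [A = 8 Cb r / k]. *)
  pose lam := k / (2 * Cb * r * M); have lam0 : 0 < lam by rewrite divr_gt0 ?mulr_gt0.
  have := @decay _ _ _ oO bO _ hB m Cb s h lam w g m2 bump (ltW Cb1) s0 h0 lam0 wW.
  rewrite (_ : lam * h / 4 = h / (A * M)); last by rewrite /lam /A; field; rewrite !gt_eqF.
  apply; apply: (@le_lt_trans _ _ (Cb * (lam * (r / k * M)))).
    apply: ler_wpM2l; first exact: ltW.
    apply: ler_wpM2l; first exact: ltW.
    by apply: le_trans J _; rewrite ler_wpM2l// divr_ge0// ltW.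
  rewrite (_ : Cb * _ = 2^-1) ?invf_lt1 ?ltr1n//.
  by rewrite /lam; field; rewrite !gt_eqF.
have H : ae_in Omega (fun x => ((A * S < w x)%R%:R : R) = 0) by exact: Rintegral_eq0_ae.
apply/ess_supP; move: H; rewrite /ae_in; apply: filterS => x H.
rewrite /patch; case: ifPn => [/set_mem/H/eqP|_]; last exact: leNye.
rewrite pnatr_eq0 eqb0 -leNgt => wA; rewrite /= lee_fin -lerBlDl.
apply: le_trans (_ : w x <= _); first by rewrite le_max lexx.
by apply: le_trans wA _; rewrite /A mulrAC.
Qed.

End boundedness.

Theorem theorem13 (R : realType) (n : nat) (Omega : set 'rV[R]_n.+1)
    (B : 'rV[R]_n.+1 -> 'M[R]_n.+1) (k : R)
    (hOmega : bounded_domain Omega)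
    (hB : [lipschitz B x | x in Omega])
    (hk : 0 < k)
    (hbump : exists2 m : R, 2 < m & Orlicz_bump Omega B (Phi_ m)) :
  exists C : R,
    forall (K : R) (cA : 'rV[R]_n.+1 -> R -> 'M[R]_n.+1)
           (phi u : 'rV[R]_n.+1 -> R),
      0 < K ->
      (forall x z, Omega x -> nonneg_semidefinite (cA x z)) ->
      structural Omega B k K cA ->
      Lp_loc 2 Omega phi ->
      (forall i j, measurable_in Omega (fun x => cA x (u x) i j)) ->
      ae_in Omega (fun x => 0 <= u x) ->
      weak_subsolution Omega B cA phi u ->
      admissible Omega B phi ->
      (ess_sup_in Omega u <= bdry_sup Omega B u + C%:E * X_norm Omega B phi)%E.
Proof.
have [oO _ _ bO] := hOmega; have [m m2 bump] := hbump.
have [C C0 HC] := ess_sup_level_bound oO bO hB hk m2 bump.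
exists C => K cA phi u _ _ HA [mphi _] _ _ [gu guW Hu] adm.
have X0 := X_norm_ge0 oO bO hB phi.
have Xfin : X_norm Omega B phi \is a fin_num by rewrite ge0_fin_numE.
pose x := fine (X_norm Omega B phi); have x0 : 0 <= x by exact: fine_ge0.
have XE : X_norm Omega B phi = x%:E by rewrite fineK.
(* The norm of [phi] is finite, so it can be moved to the left and the boundary supremum treated
   level by level; without admissible levels the infimum is [+oo]. *)
rewrite XE -EFinM -leeBlDr//; apply: le_ereal_inf_tmp => _ [l [g wW] <-].
rewrite leeBlDr// -EFinD; apply/lee_addgt0Pr => e e0.
have C1 : 0 < C + 1 by rewrite ltr_wpDl.
(* The level bound needs a positive [r], whereas the norm may be 0. The excess costs
   [C * e / (C + 1) <= e]. *)
have r0 : 0 < x + e / (C + 1) by rewrite ltr_wpDl// divr_gt0.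
have Xr : (X_norm Omega B phi <= (x + e / (C + 1))%:E)%E.
  by rewrite XE lee_fin lerDl divr_ge0// ltW.
apply: le_trans (HC K cA phi u gu l _ g HA mphi guW Hu wW r0 Xr) _.
rewrite -EFinD lee_fin mulrDr addrA lerD2l mulrCA; apply: ler_piMr; first exact: ltW.
by rewrite ler_pdivrMr// mul1r lerDl.
Qed.
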